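(* Let $d\ge3$ and let $1<p,q<\infty$ satisfy $\frac1p-\frac1{d+1}\le\frac1q<\frac1p$. Then there is a constant $C>0$ such that for any $f\in L^{1,p}_{H_{\mathrm{par}}}(\mathbb R^{d+1})$, $$\|f\|_{L^q(\mathbb R^{d+1})}\le C\|\nabla_{H_{\mathrm{par}}}f\|_{L^p(\mathbb R^{d+1})}.$$
   Context: Write $z=(\rho,x)\in\mathbb R\times\mathbb R^d$. The partial harmonic oscillator is $H_{\mathrm{par}}=-\partial_\rho^2-\Delta_x+|x|^2$ on $\mathbb R^{d+1}$. First order operators: $A_0=-\partial_\rho$, and for $1\le j\le d$, $A_j=-\partial_{x_j}+x_j$, $A_{-j}=A_j^*=\partial_{x_j}+x_j$. The associated gradient is $\nabla_{H_{\mathrm{par}}}f=(A_0f,A_1f,\dots,A_df,A_{-1}f,\dots,A_{-d}f)$ (derivatives in the distributional sense), and $\|\nabla_{H_{\mathrm{par}}}f\|_{L^p}=\sum_{-d\le j\le d}\|A_jf\|_{L^p}$. The potential space is $L^{1,p}_{H_{\mathrm{par}}}(\mathbb R^{d+1})=H_{\mathrm{par}}^{-1/2}(L^p(\mathbb R^{d+1}))$, where $H_{\mathrm{par}}^{-1/2}=\frac1{\Gamma(1/2)}\int_0^\infty t^{-1/2}e^{-tH_{\mathrm{par}}}\,dt$ is bounded and one-to-one on $L^p(\mathbb R^{d+1})$, and $e^{-tH_{\mathrm{par}}}$ is the integral operator with kernel $E(t,z,z')=2^{-\frac{d+2}2}\pi^{-\frac{d+1}2}t^{-1/2}(\sinh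 2t)^{-d/2}\exp\big(-\tfrac14(2\coth 2t-\tanh t)|x-x'|^2-\tfrac{\tanh t}4|x+x'|^2-\tfrac{(\rho-\rho')^2}{4t}\big)$. *)

(* Defs.v *)
From HB Require Import structures.
From mathcomp Require Import all_boot all_order all_algebra.
From mathcomp Require Import all_classical all_reals all_analysis.
From mathcomp Require Import complex.

Set Implicit Arguments.
Unset Strict Implicit.
Unset Printing Implicit Defensive.
Import Order.TTheory GRing.Theory Num.Theory.
Import numFieldNormedType.Exports.
Local Open Scope classical_set_scope.
Local Open Scope ring_scope.

(* Row vectors carry the product sigma-algebra (the one generated by the
   coordinate maps), as tuples do in the library; for T = R it is the Borel
   sigma-algebra. *)
Definition measure_rV_display : measure_display -> measure_display.
Proof. exact. Qed.

Section measurable_rV.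
Context {d : measure_display} {T : measurableType d} (n : nat).

Let coord : 'I_n -> 'rV[T]_n -> T := fun i v => v ord0 i.

Let rV_set0 : g_sigma_preimage coord set0.
Proof. exact: sigma_algebra0. Qed.

Let rV_setC A : g_sigma_preimage coord A -> g_sigma_preimage coord (~` A).
Proof. exact: sigma_algebraC. Qed.

Let rV_bigcup (F : (set 'rV[T]_n)^nat) :
  (forall i, g_sigma_preimage coord (F i)) ->
  g_sigma_preimage coord (\bigcup_i (F i)).
Proof. exact: sigma_algebra_bigcup. Qed.

HB.instance Definition _ := @isMeasurable.Build (measure_rV_display d)
  'rV[T]_n (g_sigma_preimage coord) rV_set0 rV_setC rV_bigcup.

End measurable_rV.

Section measurable_rV_lemmas.
Context {d d' : measure_display} {T : measurableType d} {S : measurableType d'}.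

Lemma measurable_rV_coord n (i : 'I_n) :
  measurable_fun [set: 'rV[T]_n] (fun v : 'rV[T]_n => v ord0 i).
Proof.
move=> _ Y mY; rewrite setTI; apply: sub_sigma_algebra => /=.
rewrite -bigcup_seq/=; exists i => /=; first by rewrite mem_index_enum.
by exists Y => //; rewrite setTI.
Qed.

Lemma measurable_rVP n (f : S -> 'rV[T]_n) :
  (forall i, measurable_fun [set: S] (fun s => f s ord0 i)) ->
  measurable_fun [set: S] f.
Proof.
move=> mf _ Y mY; rewrite setTI.
suff : @measurable _ 'rV[T]_n `<=` [set A | measurable (f @^-1` A)] by exact.
apply: smallest_sub.
- split => /=; first by rewrite preimage_set0.
  + by move=> A mA; rewrite setTD preimage_setC; exact: measurableC.
  + by move=> F mF; rewrite preimage_bigcup; exact: bigcupT_measurable.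
- rewrite -bigcup_seq => A [i _ [B mB <-]] /=; rewrite setTI.
  by have := mf i measurableT B mB; rewrite setTI.
Qed.

End measurable_rV_lemmas.

Section lebesgue_rV.
Context {R : realType}.

Definition rV_cons n (p : R * 'rV[R]_n) : 'rV[R]_n.+1 :=
  \row_i (if unlift ord0 i is Some j then p.2 ord0 j else p.1).

Definition rV_uncons n (v : 'rV[R]_n.+1) : R * 'rV[R]_n :=
  (v ord0 ord0, \row_j v ord0 (lift ord0 j)).

Lemma rV_consK n : cancel (@rV_cons n) (@rV_uncons n).
Proof.
move=> [x v]; rewrite /rV_uncons /rV_cons mxE unlift_none; congr pair.
by apply/rowP => j; rewrite !mxE liftK.
Qed.

Lemma measurable_rV_cons n :
  measurable_fun [set: measurableTypeR R * 'rV[R]_n] (@rV_cons n).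
Proof.
apply: measurable_rVP => i; rewrite /rV_cons.
case: (unliftP ord0 i) => [j ->|->].
- under eq_fun do rewrite mxE liftK.
  exact: (measurableT_comp (measurable_rV_coord j) measurable_snd).
- under eq_fun do rewrite mxE unlift_none.
  exact: measurable_fst.
Qed.

Lemma measurable_rV_uncons n :
  measurable_fun [set: 'rV[R]_n.+1]
    (@rV_uncons n : _ -> measurableTypeR R * 'rV[R]_n).
Proof.
apply: measurable_fun_pair; first exact: measurable_rV_coord.
apply: measurable_rVP => i; under eq_fun do rewrite mxE.
exact: measurable_rV_coord.
Qed.

Section step.
Local Open Scope ereal_scope.
Variables (n : nat) (m : {sigma_finite_measure set 'rV[R]_n -> \bar R}).

Definition lebesgue_rV_step : set 'rV[R]_n.+1 -> \bar R :=
  pushforward (lebesgue_measure \x m) (@rV_cons n).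

Let step0 : lebesgue_rV_step set0 = 0.
Proof. by rewrite /lebesgue_rV_step /pushforward preimage_set0 measure0. Qed.

Let step_ge0 A : 0 <= lebesgue_rV_step A.
Proof. exact: (measure_ge0 (lebesgue_measure \x m)). Qed.

Let step_sigma_additive : semi_sigma_additive lebesgue_rV_step.
Proof.
move=> F mF tF mUF; rewrite /lebesgue_rV_step /pushforward preimage_bigcup.
have mcons A : measurable A ->
    @measurable _ (measurableTypeR R * 'rV[R]_n)%type (@rV_cons n @^-1` A).
  by move=> mA; rewrite -[X in measurable X]setTI; exact: measurable_rV_cons.
apply: (@measure_semi_sigma_additive _ _ _ (lebesgue_measure \x m)
  (fun k => @rV_cons n @^-1` F k)).
- by move=> k; exact: mcons.
- apply/trivIsetP => i j _ _ ij; rewrite -preimage_setI.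
  by move/trivIsetP : tF => ->//; rewrite preimage_set0.
- by rewrite -preimage_bigcup; exact: mcons.
Qed.

HB.instance Definition _ := isMeasure.Build _ _ _ lebesgue_rV_step
  step0 step_ge0 step_sigma_additive.

Let step_sigma_finite : sigma_finite setT lebesgue_rV_step.
Proof.
have /sigma_finiteP[F [UF ndF Foo]] := sigma_finiteT (@lebesgue_measure R).
have /sigma_finiteP[G [UG ndG Goo]] := sigma_finiteT m.
exists (fun k => @rV_uncons n @^-1` (F k `*` G k)) => [|k].
  apply/seteqP; split => // v _.
  have [[i _ Fi] [j _ Gj]] : (\bigcup_i F i) (rV_uncons v).1 /\
      (\bigcup_i G i) (rV_uncons v).2 by rewrite -UF -UG.
  exists (maxn i j) => //; split => /=.
  - by move: Fi; exact/subsetPset/ndF/leq_maxl.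
  - by move: Gj; exact/subsetPset/ndG/leq_maxr.
have [mF Fk] := Foo k; have [mG Gk] := Goo k; split.
  rewrite -[X in measurable X]setTI.
  by apply: measurable_rV_uncons => //; exact: measurableX.
rewrite /lebesgue_rV_step /pushforward -comp_preimage.
rewrite (_ : _ \o _ = id); last by apply/funext => p; exact: rV_consK.
by rewrite preimage_id product_measure1E// lte_mul_pinfty// ge0_fin_numE.
Qed.

HB.instance Definition _ := Measure_isSigmaFinite.Build _ _ _ lebesgue_rV_step
  step_sigma_finite.

End step.

Fixpoint lebesgue_rV n : {sigma_finite_measure set 'rV[R]_n -> \bar R} :=
  if n is n'.+1 then lebesgue_rV_step (lebesgue_rV n')
  else \d_(0 : 'rV[R]_0).

End lebesgue_rV.

Lemma measurable_box (R : realType) n (A : 'I_n -> set R) :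
  (forall i, measurable (A i)) ->
  measurable [set v : 'rV[R]_n | forall i, A i (v ord0 i)].
Proof.
move=> mA.
rewrite (_ : [set _ | _] =
    \bigcap_(i in [set: 'I_n]) ((fun v : 'rV[R]_n => v ord0 i) @^-1` A i)).
  apply: fin_bigcap_measurable => // i _.
  by rewrite -[X in measurable X]setTI; exact: measurable_rV_coord.
by apply/seteqP; split => v vA i; [move=> _; exact: vA|exact: (vA i I)].
Qed.

Lemma lebesgue_rV_box (R : realType) n (A : 'I_n -> set R) :
  (forall i, measurable (A i)) ->
  lebesgue_rV n [set v | forall i, A i (v ord0 i)]
  = (\prod_(i < n) lebesgue_measure (A i))%E.
Proof.
elim: n A => [|n IHn] A mA.
  rewrite big_ord0 /= diracE mem_set//= => -[]//.
rewrite big_ord_recl -IHn; last by move=> i; exact: mA.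
rewrite [LHS]/= /lebesgue_rV_step /pushforward.
rewrite (_ : _ @^-1` _ =
    A ord0 `*` [set v : 'rV[R]_n | forall i, A (lift ord0 i) (v ord0 i)]).
  rewrite product_measure1E//; first exact: mA.
  by apply: (@measurable_box R n (fun i => A (lift ord0 i))) => i; exact: mA.
apply/seteqP; split => [[x v] /= Av|[x v] [/= Ax Av] i].
  split => [|i]; first by have := Av ord0; rewrite mxE unlift_none.
  by have := Av (lift ord0 i); rewrite mxE liftK.
by rewrite mxE; case: (unliftP ord0 i) => [j ->|->].
Qed.

(* R^{d+1} is [R * 'rV[R]_d], z = (rho, x); the norms of the library on it are
   sup norms, so the Euclidean ones are spelled out where they occur. *)
Section partial_harmonic_oscillator.
Context {R : realType} (d : nat).
Local Notation Z := (R * 'rV[R]_d)%type.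
(* same type, with the sigma-algebra for which [lebesgue_measure] is declared *)
Local Notation mZ := (measurableTypeR R * 'rV[R]_d)%type.
Local Notation mu := (@lebesgue_measure R \x lebesgue_rV d)%E.

Definition Cmeasurable (f : Z -> R[i]) : Prop :=
  measurable_fun [set: mZ] (fun z => complex.Re (f z)) /\
  measurable_fun [set: mZ] (fun z => complex.Im (f z)).

Definition Cintegral {disp : measure_display} {T : measurableType disp}
    (m : {measure set T -> \bar R}) (D : set T) (f : T -> R[i]) : R[i] :=
  Complex (\int[m]_(x in D) complex.Re (f x)) (\int[m]_(x in D) complex.Im (f x)).

Definition CLnorm (p : R) (f : Z -> R[i]) : \bar R :=
  Lnorm mu p%:E (fun z => (ComplexField.Normc.normc (f z))%:E).

Definition Lp (p : R) : set (Z -> R[i]) :=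
  [set f | Cmeasurable f /\ (CLnorm p f < +oo)%E].

Definition sinh (t : R) : R := (expR t - expR (- t)) / 2.
Definition cosh (t : R) : R := (expR t + expR (- t)) / 2.
Definition tanh (t : R) : R := sinh t / cosh t.
Definition coth (t : R) : R := cosh t / sinh t.

Definition Gamma (s : R) : R :=
  \int[lebesgue_measure]_(u in `]0, +oo[) (u `^ (s - 1) * expR (- u)).

Definition sqnorm (x : 'rV[R]_d) : R := \sum_(j < d) x ord0 j ^+ 2.

Definition heat_kernel (t : R) (z z' : Z) : R :=
  2 `^ (- (d%:R + 2) / 2) * pi `^ (- (d%:R + 1) / 2) *
  t `^ (- (1 / 2)) * sinh (2 * t) `^ (- (d%:R / 2)) *
  expR (- (1 / 4) * (2 * coth (2 * t) - tanh t) * sqnorm (z.2 - z'.2)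
        - tanh t / 4 * sqnorm (z.2 + z'.2)
        - (z.1 - z'.1) ^+ 2 / (4 * t)).

Definition heat_semigroup (t : R) (f : Z -> R[i]) (z : Z) : R[i] :=
  Cintegral mu setT (fun z' => (heat_kernel t z z')%:C%C * f z').

(* For f in L^p the integral converges absolutely for almost every z. *)
Definition Hpar_invsqrt (f : Z -> R[i]) (z : Z) : R[i] :=
  ((Gamma (1 / 2))^-1)%:C%C *
  Cintegral lebesgue_measure `]0, +oo[
    (fun t => (t `^ (- (1 / 2)))%:C%C * heat_semigroup t f z).

Definition potential_space (p : R) : set (Z -> R[i]) :=
  [set f | Cmeasurable f /\
    exists2 g, Lp p g & {ae mu, forall z, f z = Hpar_invsqrt g z}].

Definition iter_derive (vs : seq Z) (phi : Z -> R) : Z -> R :=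
  foldr (fun v psi => 'D_v psi) phi vs.

Definition smooth (phi : Z -> R) : Prop :=
  forall vs : seq Z, continuous (iter_derive vs phi) /\
    forall z v, derivable (iter_derive vs phi) z v.

Definition test_function (phi : Z -> R) : Prop :=
  smooth phi /\ compact (closure [set z | phi z != 0]).

(* Distributions act on real test functions, with complex values. *)
Definition distribution := (Z -> R) -> R[i].

Definition dist_of (f : Z -> R[i]) : distribution :=
  fun phi => Cintegral mu setT (fun z => f z * (phi z)%:C%C).

Definition dist_partial (v : Z) (u : distribution) : distribution :=
  fun phi => - u ('D_v phi).

Definition dist_mul (m : Z -> R) (u : distribution) : distribution :=
  fun phi => u (fun z => m z * phi z).

Definition e_rho : Z := (1, 0).
Definition e_x (j : 'I_d) : Z := (0, delta_mx ord0 j).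
Definition x_ (j : 'I_d) (z : Z) : R := z.2 ord0 j.

Definition A_0 (u : distribution) : distribution :=
  fun phi => - dist_partial e_rho u phi.
Definition A_pos (j : 'I_d) (u : distribution) : distribution :=
  fun phi => - dist_partial (e_x j) u phi + dist_mul (x_ j) u phi.
Definition A_neg (j : 'I_d) (u : distribution) : distribution :=
  fun phi => dist_partial (e_x j) u phi + dist_mul (x_ j) u phi.

(* The L^p norm of the L^p function representing u, which is unique up to null
   sets, and +oo when there is none. *)
Definition dist_Lnorm (p : R) (u : distribution) : \bar R :=
  ereal_inf [set CLnorm p g | g in
    [set g | Lp p g /\ forall phi, test_function phi -> u phi = dist_of g phi]].

Definition gradient_Lnorm (p : R) (f : Z -> R[i]) : \bar R :=
  (dist_Lnorm p (A_0 (dist_of f)) +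
   \sum_(j < d) dist_Lnorm p (A_pos j (dist_of f)) +
   \sum_(j < d) dist_Lnorm p (A_neg j (dist_of f)))%E.

End partial_harmonic_oscillator.

(* Main.v *)
Require Import Defs.
From HB Require Import structures.
From mathcomp Require Import all_boot all_order all_algebra.
From mathcomp Require Import all_classical all_reals all_analysis.
From mathcomp Require Import complex measurable_realfun.
From mathcomp Require Import ring lra.
Set Implicit Arguments.
Unset Strict Implicit.
Unset Printing Implicit Defensive.
Import Order.TTheory GRing.Theory Num.Theory.
Import numFieldNormedType.Exports.
Local Open Scope classical_set_scope.
Local Open Scope ring_scope.

(* Only two facts about f are used: it is locally integrable, and the weak
   derivatives along the n = d+1 coordinates and the products x_j f are linear
   combinations of the components A_j f, hence in L^p.  Since the real and
   imaginary parts u of f are absolutely continuous on almost every line, with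
   slope in L^p, the one-dimensional inequality
     int |W|^p <= C (int |x|^p |W|^p + int |W'|^p)
   on the lines parallel to an x-axis gives u in L^p.  For w = min(|u|, M), the
   fundamental theorem of calculus on the lines in direction i bounds w^s by
   s int w^(s-1) |d_i u| along the line; multiplying the n bounds and using the
   Loomis-Whitney and Young inequalities gives the Gagliardo-Nirenberg estimate
   for the q-norm of w, uniformly in M.  Local integrability of f comes from
   Schur's test, the heat kernel being dominated by a Gaussian of mass
   C exp(-t). *)

(** * Lebesgue measure on row vectors *)

(** [gradient_Lnorm] is purely distributional: its components act on test functions, and neither
    pointwise derivatives nor membership of f in L^p come with it. Since A_j - A_{-j} = -2 d/dx_j
    and A_j + A_{-j} = 2 x_j, the claim becomes an inhomogeneous Sobolev inequality whose L^p term
    is paid for by the confinement in x; rho is not confined. Only products of one-variable bumps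
    are tested, because they separate the variable of a line from the others. Each bump in that
    variable leaves its own null set of lines, so a countable family (rational endpoints, integer
    steepness) has to determine a function up to a constant. The chain rule for w^s is obtained from
    increments, without derivatives, and thus survives truncation. The exponent s = q d / (d+1)
    makes the product of the d+1 line bounds, each to the power 1/d, control exactly w^q; when this
    s is below p it is replaced by p, and q is reached by interpolation. The condition 1/p - 1/(d+1)
    <= 1/q is what keeps the exponent from Young's inequality at most q. *)

Section rV_measure.
Context {R : realType}.
Local Notation leb := (@lebesgue_measure R).

Definition rV_obox n (a b : 'I_n -> R) : set 'rV[R]_n :=
  [set v | forall i, `]a i, b i[%classic (v ord0 i)].

Definition rV_oboxes n : set (set 'rV[R]_n) :=
  [set B | exists a b, B = rV_obox a b].

Lemma measurable_rV_obox n (a b : 'I_n -> R) : measurable (rV_obox a b).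
Proof. by apply: (@measurable_box R n (fun i => `]a i, b i[%classic)) => i. Qed.

Lemma setI_closed_rV_oboxes n : setI_closed (@rV_oboxes n).
Proof.
move=> _ _ [a [b ->]] [a' [b' ->]].
exists (fun i => Num.max (a i) (a' i)), (fun i => Num.min (b i) (b' i)).
apply/seteqP; split => [v [h h'] i|v h].
  have := h i; have := h' i; rewrite /= !in_itv/= => /andP[? ?] /andP[? ?].
  by rewrite gt_max lt_min; apply/andP; split; apply/andP.
split=> i; have := h i; rewrite /= !in_itv/= gt_max lt_min.
  by move=> /andP[/andP[-> _] /andP[->]].
by move=> /andP[/andP[_ ->] /andP[_ ->]].
Qed.

Definition rV_cube n (k : nat) : set 'rV[R]_n :=
  rV_obox (fun=> - k%:R) (fun=> k%:R).

Lemma rV_cubeP n k (v : 'rV[R]_n) :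
  rV_cube k v <-> forall i, `|v ord0 i| < k%:R.
Proof.
by split=> h i; have := h i; rewrite /= in_itv/= ltr_norml.
Qed.

Lemma sub_rV_cube n k l : (k <= l)%N -> @rV_cube n k `<=` @rV_cube n l.
Proof.
move=> kl v /rV_cubeP h; apply/rV_cubeP => i.
by rewrite (lt_le_trans (h i))// ler_nat.
Qed.

Lemma rV_cube_cover n : \bigcup_k @rV_cube n k = setT.
Proof.
apply/seteqP; split => // v _.
have [k hk] : exists k : nat, forall i, `|v ord0 i| < k%:R.
  exists (\max_i (Num.truncn `|v ord0 i|).+1) => i.
  apply: (lt_le_trans (truncnS_gt _)).
  by rewrite ler_nat (leq_bigmax i).
by exists k => //; apply/rV_cubeP.
Qed.

(** The preimage of an open interval under a coordinate is a countable union of open boxes whose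
    other sides grow like ]-k, k[. With boxes as generators, measures and integrals can be compared
    by pi-lambda arguments. *)
Lemma measurable_rV_oboxE n :
  @measurable _ 'rV[R]_n = <<s @rV_oboxes n >>.
Proof.
apply/seteqP; split; last first.
  by apply: smallest_sub; [exact: sigma_algebra_measurable|
    move=> _ [a [b ->]]; exact: measurable_rV_obox].
apply: smallest_sub; first exact: smallest_sigma_algebra.
rewrite -bigcup_seq => A [i _ [B mB <-]] /=; rewrite setTI.
suff : @measurable _ (measurableTypeR R) `<=`
    [set B | <<s @rV_oboxes n >> ((fun v : 'rV[R]_n => v ord0 i) @^-1` B)].
  by apply.
rewrite (RGenOpens.measurableE R); apply: smallest_sub.
- split => /=.
  + by rewrite preimage_set0; exact: sigma_algebra0.
  + by move=> C; rewrite setTD preimage_setC; exact: sigma_algebraC.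
  + by move=> F mF; rewrite preimage_bigcup; exact: sigma_algebra_bigcup.
- move=> _ [x [y ->]] /=.
  rewrite (_ : _ @^-1` _ = \bigcup_k rV_obox
    (fun j => if j == i then x else - k%:R) (fun j => if j == i then y else k%:R)).
    by apply: sigma_algebra_bigcup => k; apply: sub_sigma_algebra; do 2 eexists.
  apply/seteqP; split => [v /= xy|v [k _ /(_ i)]]; last by rewrite eqxx.
  have : (\bigcup_k @rV_cube n k) v by rewrite rV_cube_cover.
  by move=> [k _ kv]; exists k => // j; case: eqP => [->//|_]; exact: kv.
Qed.

Lemma rV_measure_unique n (m1 m2 : {measure set 'rV[R]_n -> \bar R}) :
  (forall a b, m1 (rV_obox a b) = m2 (rV_obox a b)) ->
  (forall k, (m1 (rV_cube k) < +oo)%E) ->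
  forall A, measurable A -> m1 A = m2 A.
Proof.
move=> m12 m1oo A mA.
apply: (measure_unique (@rV_oboxes n) (@rV_cube n)) => //.
- exact: measurable_rV_oboxE.
- exact: setI_closed_rV_oboxes.
- by move=> k; do 2 eexists.
- exact: rV_cube_cover.
- by move=> _ [a [b ->]].
Qed.

Lemma lebesgue_rV_cube_lty n k : (lebesgue_rV n (@rV_cube n k) < +oo)%E.
Proof.
rewrite (@lebesgue_rV_box R n (fun=> `]- k%:R, k%:R[%classic))//.
rewrite lebesgue_measure_itv/=.
by case: ifPn => _; rewrite -?EFinB prodEFin ltry.
Qed.

(* [rV_ins ord0] is [rV_cons]. *)
Definition rV_ins m (i : 'I_m.+1) (z : R * 'rV[R]_m) : 'rV[R]_m.+1 :=
  \row_k (if unlift i k is Some j then z.2 ord0 j else z.1).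

Lemma rV_ins_eq m i z : @rV_ins m i z ord0 i = z.1.
Proof. by rewrite mxE unlift_none. Qed.

Lemma rV_ins_lift m i z j : @rV_ins m i z ord0 (lift i j) = z.2 ord0 j.
Proof. by rewrite mxE liftK. Qed.

Lemma measurable_rV_ins m (i : 'I_m.+1) :
  measurable_fun [set: measurableTypeR R * 'rV[R]_m] (rV_ins i).
Proof.
apply: measurable_rVP => k; case: (unliftP i k) => [j ->|->].
- under eq_fun do rewrite rV_ins_lift.
  exact: (measurableT_comp (measurable_rV_coord j) measurable_snd).
- under eq_fun do rewrite rV_ins_eq.
  exact: measurable_fst.
Qed.

(** [lebesgue_rV] is built by splitting off the first coordinate. Comparing volumes of boxes shows
    that any coordinate may be split off instead, which is what allows Fubini along lines in every
    direction. *)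
Lemma lebesgue_rV_ins m (i : 'I_m.+1) A : measurable A ->
  lebesgue_rV m.+1 A = pushforward (leb \x lebesgue_rV m)%E (rV_ins i) A.
Proof.
have mf := measurable_rV_ins i.
pose P : {measure set 'rV[R]_m.+1 -> \bar R} :=
  measure_function_pushforward__canonical__measure_function_Measure
    (leb \x lebesgue_rV m)%E mf.
move=> mA; apply: (@rV_measure_unique _ (lebesgue_rV m.+1) P) => //; last first.
  exact: lebesgue_rV_cube_lty.
move=> a b; rewrite /P/= /pushforward.
rewrite (@lebesgue_rV_box R m.+1 (fun i => `]a i, b i[%classic))//.
rewrite (_ : _ @^-1` _ = `]a i, b i[%classic `*`
   [set v : 'rV[R]_m | forall j, `]a (lift i j), b (lift i j)[%classic (v ord0 j)]).
  rewrite product_measure1E//; last first.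
    by apply: (@measurable_box R m
      (fun j => `]a (lift i j), b (lift i j)[%classic)).
  rewrite (@lebesgue_rV_box R m
    (fun j => `]a (lift i j), b (lift i j)[%classic))// [LHS](bigD1_ord i)//.
apply/seteqP; split => [[x v] /= h|[x v] [/= h0 h] k].
  split => [|j]; first by have := h i; rewrite rV_ins_eq.
  by have := h (lift i j); rewrite rV_ins_lift.
case: (unliftP i k) => [j ->|->].
- by have := h j; rewrite rV_ins_lift.
- by rewrite rV_ins_eq.
Qed.

Lemma ge0_integral_rV_ins m (i : 'I_m.+1) (F : 'rV[R]_m.+1 -> \bar R) :
  measurable_fun [set: 'rV[R]_m.+1] F -> (forall v, 0 <= F v)%E ->
  (\int[lebesgue_rV m.+1]_v F v =
   \int[leb \x lebesgue_rV m]_z F (rV_ins i z))%E.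
Proof.
move=> mF F0.
rewrite (@eq_measure_integral _ _ _ setT
  (measure_function_pushforward__canonical__measure_function_Measure
    (leb \x lebesgue_rV m)%E (measurable_rV_ins i))); last first.
  by move=> A mA _; exact: lebesgue_rV_ins.
by rewrite ge0_integral_pushforward//; exact: measurable_rV_ins.
Qed.

Lemma integral_rV_ins m (i : 'I_m.+1) (F : 'rV[R]_m.+1 -> \bar R) :
  measurable_fun [set: 'rV[R]_m.+1] F ->
  (\int[lebesgue_rV m.+1]_v F v =
   \int[leb \x lebesgue_rV m]_z F (rV_ins i z))%E.
Proof.
move=> mF; rewrite integralE [RHS]integralE !(ge0_integral_rV_ins i)//.
- by congr (_ - _)%E; apply: eq_integral => z _; rewrite ?funeposE ?funenegE.
- exact: measurable_funeneg.
- exact: measurable_funepos.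
Qed.

Definition rV_del m (i : 'I_m.+1) (v : 'rV[R]_m.+1) : R * 'rV[R]_m :=
  (v ord0 i, \row_j v ord0 (lift i j)).

Lemma rV_delK m (i : 'I_m.+1) : cancel (rV_del i) (rV_ins i).
Proof.
move=> v; apply/rowP => k; case: (unliftP i k) => [j ->|->].
- by rewrite rV_ins_lift mxE.
- by rewrite rV_ins_eq.
Qed.

Lemma rV_insK m (i : 'I_m.+1) : cancel (rV_ins i) (rV_del i).
Proof.
move=> [x v]; rewrite /rV_del rV_ins_eq; congr pair.
by apply/rowP => j; rewrite mxE rV_ins_lift.
Qed.

Lemma measurable_rV_del m (i : 'I_m.+1) :
  measurable_fun [set: 'rV[R]_m.+1]
    (rV_del i : _ -> measurableTypeR R * 'rV[R]_m).
Proof.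
apply: measurable_fun_pair; first exact: measurable_rV_coord.
apply: measurable_rVP => j; under eq_fun do rewrite mxE.
exact: measurable_rV_coord.
Qed.

End rV_measure.

(** * Loomis-Whitney inequality *)

Section generalized_hoelder.
Context {R : realType}.

Lemma prod_powR (I : finType) (P : {pred I}) (b : I -> R) (r : R) :
  (forall i, 0 <= b i) ->
  \prod_(i in P) b i `^ r = (\prod_(i in P) b i) `^ r.
Proof.
move=> b0; suff [_ ->//] : 0 <= \prod_(i in P) b i /\
  (\prod_(i in P) b i) `^ r = \prod_(i in P) b i `^ r.
apply: (big_ind2 (fun x y => 0 <= x /\ x `^ r = y)) => [|x1 x2 y1 y2 [? <-] [? <-]|//].
  by rewrite powR1.
by split; [exact: mulr_ge0|exact: powRM].
Qed.

(** The arithmetic-geometric mean inequality with extended values: an infinite entry makes the mean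
    infinite, and otherwise all entries are real. *)
Lemma prod_poweR_le_mean (I : finType) (P : {pred I}) (a : I -> \bar R) :
  (0 < #|P|)%N -> (forall i, 0 <= a i)%E ->
  (\prod_(i in P) (a i `^ #|P|%:R^-1) <=
   #|P|%:R^-1%:E * \sum_(i in P) a i)%E.
Proof.
move=> P0 a0; set m := #|P|.
have m0 : 0 < (m%:R : R) by rewrite ltr0n.
have [[i [Pi ai]]|afin] := pselect (exists i, i \in P /\ a i = +oo%E).
  rewrite [X in (_ <= _ * X)%E](bigD1 i)//= ai addye.
    by rewrite gt0_muley ?leey// lte_fin invr_gt0.
  by rewrite gt_eqF// (lt_le_trans ltNy0)// sume_ge0.
pose b i : R := if i \in P then fine (a i) else 0.
have b0 i : 0 <= b i by rewrite /b; case: ifP => // _; exact: fine_ge0.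
have ab i : i \in P -> a i = (b i)%:E.
  move=> iP; rewrite /b iP fineK// ge0_fin_numE// ltey; apply/eqP => ai.
  by apply: afin; exists i.
rewrite (eq_bigr (fun i => (b i `^ m%:R^-1)%:E)); last first.
  by move=> i iP; rewrite ab// poweR_EFin.
rewrite [X in (_ <= _ * X)%E](eq_bigr (fun i => (b i)%:E)); last by move=> i /ab.
rewrite prodEFin sumEFin -EFinM lee_fin prod_powR//.
have S0 : 0 <= (\sum_(i in P) b i) / m%:R.
  by apply: mulr_ge0; [exact: sumr_ge0|rewrite invr_ge0 ltW].
have H : \prod_(i in P) b i <= ((\sum_(i in P) b i) / m%:R) ^+ m.
  have [+ _] := @leif_AGM R I P b (fun i _ => b0 i); exact.
apply: (le_trans (ge0_ler_powR _ _ _ H)).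
- by rewrite invr_ge0 ltW.
- by rewrite nnegrE; exact: prodr_ge0.
- by rewrite nnegrE exprn_ge0.
by rewrite -powR_mulrn// -powRrM mulfV ?gt_eqF// powRr1// mulrC.
Qed.

Context {d} {T : measurableType d} (mu : {measure set T -> \bar R}).

Lemma emeasurable_prod (I : Type) (s : seq I) (P : pred I) (f : I -> T -> \bar R) :
  (forall i, measurable_fun setT (f i)) ->
  measurable_fun setT (fun x => \prod_(i <- s | P i) f i x)%E.
Proof.
move=> mf; elim: s => [|i s ih].
  by under eq_fun do rewrite big_nil; exact: measurable_cst.
under eq_fun do rewrite big_cons; case: (P i) => //.
exact: emeasurable_funM.
Qed.

Lemma measurable_fun_poweR (f : T -> \bar R) r :
  measurable_fun setT f -> measurable_fun setT (fun x => f x `^ r)%E.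
Proof. by move=> mf; exact: (measurableT_comp (measurable_poweR r) mf). Qed.

Lemma ge0_integral_eq0_ae (f : T -> \bar R) :
  measurable_fun setT f -> (forall x, 0 <= f x)%E ->
  (\int[mu]_x f x = 0)%E -> {ae mu, forall x, f x = 0%E}.
Proof.
move=> mf f0 if0.
have : (\int[mu]_x `|f x| = 0)%E by under eq_integral do rewrite gee0_abs//.
by move=> /(ae_eq_integral_abs mu measurableT mf) /=; apply: filterS => x; exact.
Qed.

Lemma ge0_ae_integral_eq0 (f : T -> \bar R) :
  measurable_fun setT f -> (forall x, 0 <= f x)%E ->
  {ae mu, forall x, f x = 0%E} -> (\int[mu]_x f x = 0)%E.
Proof.
move=> mf f0 fae.
under eq_integral do rewrite -(gee0_abs (f0 _)).
by apply/(ae_eq_integral_abs mu measurableT mf); apply: filterS fae => x /= ->.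
Qed.

(* Arithmetic-geometric mean, after normalizing the integrals to 1. *)
Lemma generalized_hoelder (I : finType) (P : {pred I}) (f : I -> T -> \bar R) :
  (0 < #|P|)%N -> (forall i, measurable_fun setT (f i)) ->
  (forall i x, 0 <= f i x)%E ->
  (\int[mu]_x (\prod_(i in P) (f i x `^ #|P|%:R^-1)) <=
   \prod_(i in P) ((\int[mu]_x f i x) `^ #|P|%:R^-1))%E.
Proof.
move=> P0 mf f0; set th := #|P|%:R^-1.
have th0 : 0 < th by rewrite invr_gt0 ltr0n.
have A0 i : (0 <= \int[mu]_x f i x)%E by exact: integral_ge0.
have mprod : measurable_fun setT (fun x => \prod_(i in P) (f i x `^ th))%E.
  by apply: emeasurable_prod => i; exact: measurable_fun_poweR.
have prod0 x : (0 <= \prod_(i in P) (f i x `^ th))%E.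
  by apply: prode_ge0 => i _; exact: poweR_ge0.
(* Normalizing divides by the integrals, so 0 and infinity are treated apart: a zero integral makes
   the product vanish almost everywhere, and an infinite one, the others being positive, makes the
   right-hand side infinite. *)
have [[i [iP i0]]|Apos] := pselect (exists i, i \in P /\ (\int[mu]_x f i x = 0)%E).
  rewrite ge0_ae_integral_eq0//; last first.
    have := ge0_integral_eq0_ae (mf i) (f0 i) i0; apply: filterS => x fx.
    by rewrite (bigD1 i)//= fx poweR0r ?mul0e// gt_eqF.
  by apply: prode_ge0 => j _; exact: poweR_ge0.
have {}Apos i : i \in P -> (0 < \int[mu]_x f i x)%E.
  by move=> iP; rewrite lt_neqAle A0 andbT eq_sym; apply/eqP => i0; apply: Apos; exists i.
have [[i [iP ioo]]|Afin] := pselect (exists i, i \in P /\ (\int[mu]_x f i x = +oo)%E).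
  rewrite (bigD1 i)//= ioo poweRyr ?gt_eqF// gt0_mulye ?leey//.
  apply: (big_ind (fun x : \bar R => 0 < x)%E) => [//|x y|j /andP[jP _]].
    exact: mule_gt0.
  by apply: poweR_gt0; exact: Apos.
pose a i : R := if i \in P then fine (\int[mu]_x f i x)%E else 1.
have aE i : i \in P -> (\int[mu]_x f i x = (a i)%:E)%E.
  move=> iP; rewrite /a iP fineK// ge0_fin_numE// ltey; apply/eqP => ai.
  by apply: Afin; exists i.
have a0 i : 0 < a i.
  by case: (boolP (i \in P)) => iP; [rewrite -lte_fin -aE//; exact: Apos|rewrite /a (negbTE iP)].
pose c := (\prod_(i in P) (a i `^ th)%:E)%E.
have c0 : (0 <= c)%E by apply: prode_ge0 => i _; rewrite lee_fin powR_ge0.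
have -> : (\prod_(i in P) ((\int[mu]_x f i x) `^ th) = c)%E.
  by apply: eq_bigr => i iP; rewrite aE// poweR_EFin.
pose g i x := ((a i)^-1%:E * f i x)%E.
have g0 i x : (0 <= g i x)%E by rewrite mule_ge0// lee_fin invr_ge0 ltW.
have mg i : measurable_fun setT (g i) by exact: measurable_funeM.
have fg x : (\prod_(i in P) (f i x `^ th) = c * \prod_(i in P) (g i x `^ th))%E.
  rewrite /c -big_split/=; apply: eq_bigr => i iP.
  rewrite -poweR_EFin -(@poweRM _ _ (g i x)) ?lee_fin ?(ltW (a0 i))// /g.
  by rewrite muleA -EFinM mulfV ?mul1e// gt_eqF.
under eq_integral do rewrite fg.
rewrite ge0_integralZl//; last 2 first.
- by apply: emeasurable_prod => i; exact: measurable_fun_poweR.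
- by move=> x _; apply: prode_ge0 => i _; exact: poweR_ge0.
rewrite -[leRHS]mule1; apply: lee_wpmul2l => //.
apply: (@le_trans _ _ (\int[mu]_x (th%:E * \sum_(i <- enum P) g i x)))%E.
  apply: ge0_le_integral => //.
  - by move=> x _; apply: prode_ge0 => i _; exact: poweR_ge0.
  - by apply: emeasurable_prod => i; exact: measurable_fun_poweR.
  - by apply: measurable_funeM; apply: emeasurable_sum.
  - by move=> x _; rewrite big_enum; exact: prod_poweR_le_mean.
rewrite ge0_integralZl//; last 3 first.
- exact: emeasurable_sum.
- by move=> x _; exact: sume_ge0.
- by rewrite lee_fin ltW.
rewrite ge0_integral_sum// big_enum /= (eq_bigr (fun=> 1%E)); last first.
  move=> i iP; rewrite ge0_integralZl// ?lee_fin ?invr_ge0 ?(ltW (a0 _))//.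
  by rewrite aE// -EFinM mulVf// gt_eqF.
rewrite sumEFin sumr_const -EFinM lee_fin /th mulVf// pnatr_eq0.
by rewrite -lt0n.
Qed.

End generalized_hoelder.

Section loomis_whitney.
Context {R : realType} (n : nat).
Local Notation leb := (@lebesgue_measure R).
Local Notation V := 'rV[R]_n.
Implicit Types (i j : 'I_n) (F : V -> \bar R) (J : seq 'I_n).

Definition rV_upd i (t : R) (v : V) : V :=
  \row_k (if k == i then t else v ord0 k).

Lemma rV_updE i t v k : rV_upd i t v ord0 k = if k == i then t else v ord0 k.
Proof. by rewrite mxE. Qed.

Lemma rV_updC i j s t v : i != j ->
  rV_upd i s (rV_upd j t v) = rV_upd j t (rV_upd i s v).
Proof.
move=> ij; apply/rowP => k; rewrite !rV_updE.
by case: eqP => [->|//]; rewrite (negbTE ij).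
Qed.

Lemma rV_updK i s t v : rV_upd i s (rV_upd i t v) = rV_upd i s v.
Proof. by apply/rowP => k; rewrite !rV_updE; case: eqP. Qed.

Lemma measurable_rV_upd i :
  measurable_fun [set: measurableTypeR R * V] (fun z => rV_upd i z.1 z.2).
Proof.
apply: measurable_rVP => k; under eq_fun do rewrite rV_updE.
by case: eqP => _; [exact: measurable_fst|
  exact: (measurableT_comp (measurable_rV_coord k) measurable_snd)].
Qed.

Lemma measurable_rV_updl i v :
  measurable_fun [set: measurableTypeR R] (fun t => rV_upd i t v).
Proof.
apply: measurable_rVP => k; under eq_fun do rewrite rV_updE.
by case: eqP => _; [exact: measurable_id|exact: measurable_cst].
Qed.

(** Integrating a coordinate out leaves a function on the whole space that is constant in that
    coordinate. This replaces functions on hyperplanes, so that all factors of the Loomis-Whitney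
    product share one domain. *)
Definition rV_part i F : V -> \bar R := fun v => (\int[leb]_t F (rV_upd i t v))%E.

Definition nnmeas F := measurable_fun [set: V] F /\ forall v, (0 <= F v)%E.

Lemma nnmeas_upd i F v : nnmeas F ->
  measurable_fun [set: measurableTypeR R] (fun t => F (rV_upd i t v)).
Proof. by move=> [mF _]; exact: (measurableT_comp mF (measurable_rV_updl i v)). Qed.

Lemma nnmeas_part i F : nnmeas F -> nnmeas (rV_part i F).
Proof.
move=> [mF F0]; split; last by move=> v; exact: integral_ge0.
apply: (measurable_fun_fubini_tonelli_G
  (fun z : measurableTypeR R * V => F (rV_upd i z.1 z.2))) => //.
exact: (measurableT_comp mF (measurable_rV_upd i)).
Qed.

Lemma rV_partC i j F : nnmeas F -> rV_part i (rV_part j F) = rV_part j (rV_part i F).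
Proof.
have [->//|ij] := eqVneq i j; move=> [mF F0]; apply/funext => v.
pose G (z : measurableTypeR R * measurableTypeR R) := F (rV_upd j z.2 (rV_upd i z.1 v)).
have mG : measurable_fun setT G.
  apply: (measurableT_comp mF); apply: measurable_rVP => k.
  under eq_fun do rewrite !rV_updE; case: eqP => _; first exact: measurable_snd.
  by case: eqP => _; [exact: measurable_fst|exact: measurable_cst].
have := @fubini_tonelli _ _ _ _ R leb leb G mG (fun z => F0 _).
rewrite /rV_part /G /= => ->; apply: eq_integral => t _; apply: eq_integral => s _.
by rewrite rV_updC 1?eq_sym.
Qed.

Definition rV_parts J F := foldr rV_part F J.

Lemma nnmeas_parts J F : nnmeas F -> nnmeas (rV_parts J F).
Proof. by move=> hF; elim: J => //= j J; exact: nnmeas_part. Qed.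

Lemma rV_parts_part J i F : nnmeas F ->
  rV_parts J (rV_part i F) = rV_part i (rV_parts J F).
Proof.
by move=> hF; elim: J => //= j J ->; rewrite rV_partC//; exact: nnmeas_parts.
Qed.

Lemma rV_parts_rem J i F : nnmeas F -> i \in J ->
  rV_parts J F = rV_parts (rem i J) (rV_part i F).
Proof.
move=> hF; elim: J => //= j J ih; rewrite inE eq_sym.
case: eqVneq => /= [-> _|ji iJ]; first by rewrite rV_parts_part.
by rewrite /= ih.
Qed.

Definition indep i F := forall t v, F (rV_upd i t v) = F v.

Lemma indep_part i F : indep i (rV_part i F).
Proof. by move=> t v; apply: eq_integral => s _; rewrite rV_updK. Qed.

Lemma indep_parts i J F : indep i F -> indep i (rV_parts J F).
Proof.
move=> iF; elim: J => //= j J ih.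
have [->|ij] := eqVneq i j; first exact: indep_part.
by move=> t v; apply: eq_integral => s _; rewrite rV_updC 1?eq_sym// ih.
Qed.

(** Loomis-Whitney by integrating one variable at a time. When variable j is integrated, the factor
    of index j is constant and leaves the integral; the other n - 1 factors carry the exponent
    1/(n-1) and fall under Hoelder's inequality. In the end the factor of index i has been
    integrated over all variables of [J] but its own, whence [rem i J]. *)
Lemma rV_parts_prod J (F : 'I_n -> V -> \bar R) : (1 < n)%N -> uniq J ->
  (forall i, nnmeas (F i)) -> (forall i, indep i (F i)) ->
  forall v, (rV_parts J (fun v => \prod_i (F i v `^ n.-1%:R^-1)) v <=
    \prod_i (rV_parts (rem i J) (F i) v `^ n.-1%:R^-1))%E.
Proof.
move=> n1 + hF iF; set th : R := n.-1%:R^-1; set P := fun v => _.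
have hP : nnmeas P.
  split=> [|v]; last by apply: prode_ge0 => i _; exact: poweR_ge0.
  by apply: emeasurable_prod => i; apply: measurable_fun_poweR; case: (hF i).
elim: J => [_ v //|j J ih /= /andP[jJ uJ] v].
apply: (@le_trans _ _ (\int[leb]_t
   \prod_i (rV_parts (rem i J) (F i) (rV_upd j t v) `^ th))%E).
  apply: ge0_le_integral => //.
  - by move=> t _; have [_] := nnmeas_parts J hP.
  - by apply: nnmeas_upd; exact: nnmeas_parts.
  - apply: emeasurable_prod => i; apply: measurable_fun_poweR.
    by apply: nnmeas_upd; exact: nnmeas_parts.
  - by move=> t _; exact: ih.
pose c := (rV_parts J (F j) v `^ th)%E.
have cE t : (rV_parts (rem j J) (F j) (rV_upd j t v) `^ th = c)%E.
  by rewrite (rem_id jJ) indep_parts.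
have cardP : #|[pred i | i != j]| = n.-1.
  by have := cardC1 j; rewrite card_ord => <-; apply: eq_card => i; rewrite !inE.
under eq_integral do rewrite (bigD1 j)//= cE.
rewrite ge0_integralZl//; last 3 first.
- apply: emeasurable_prod => i; apply: measurable_fun_poweR.
  by apply: nnmeas_upd; exact: nnmeas_parts.
- by move=> t _; apply: prode_ge0 => i _; exact: poweR_ge0.
- exact: poweR_ge0.
rewrite [leRHS](bigD1 j)//= eqxx; apply: lee_wpmul2l; first exact: poweR_ge0.
rewrite (eq_bigr (fun i => (\int[leb]_t rV_parts (rem i J) (F i) (rV_upd j t v)) `^ th)%E); last first.
  by move=> i ij; rewrite eq_sym (negbTE ij).
have := @generalized_hoelder R _ _ leb 'I_n [pred i | i != j]
  (fun i t => rV_parts (rem i J) (F i) (rV_upd j t v)).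
rewrite cardP; apply.
- by rewrite -subn1 subn_gt0.
- by move=> i; apply: nnmeas_upd; exact: nnmeas_parts.
- by move=> i t; have [_] := nnmeas_parts (rem i J) (hF i).
Qed.

End loomis_whitney.

Section loomis_whitney_integral.
Context {R : realType}.
Local Notation leb := (@lebesgue_measure R).

Lemma rV_upd_ins0 n t (x : R) (w : 'rV[R]_n) :
  rV_upd ord0 t (rV_ins ord0 (x, w)) = rV_ins ord0 (t, w).
Proof.
apply/rowP => k; rewrite rV_updE.
case: (unliftP ord0 k) => [j ->|->]; last by rewrite eqxx rV_ins_eq.
by rewrite !rV_ins_lift eq_sym (negbTE (neq_lift _ _)).
Qed.

Lemma rV_upd_ins_lift n (j : 'I_n) t (x : R) (w : 'rV[R]_n) :
  rV_upd (lift ord0 j) t (rV_ins ord0 (x, w)) = rV_ins ord0 (x, rV_upd j t w).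
Proof.
apply/rowP => k; rewrite rV_updE.
case: (unliftP ord0 k) => [l ->|->].
  by rewrite !rV_ins_lift (inj_eq lift_inj) rV_updE.
by rewrite (negbTE (neq_lift _ _)) !rV_ins_eq.
Qed.

(** Every coordinate of [v] is overwritten, so the base point is immaterial. *)
Lemma integral_rV_parts n (F : 'rV[R]_n -> \bar R) v : nnmeas F ->
  (\int[lebesgue_rV n]_w F w = rV_parts (enum 'I_n) F v)%E.
Proof.
elim: n F v => [|n ih] F v [mF F0].
  rewrite -[enum _]/(enum 'I_0) enum_ord0 /= integral_dirac// diracT mul1e.
  by congr F; apply/rowP => -[].
rewrite (ge0_integral_rV_ins ord0)// fubini_tonelli1//; last first.
  exact: (measurableT_comp mF (measurable_rV_ins ord0)).
rewrite enum_ordSl /=; apply: eq_integral => t _.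
rewrite /fubini_F (ih _ (rV_del ord0 v).2); last first.
  split => // ; apply: (measurableT_comp mF).
  exact: (measurableT_comp (measurable_rV_ins ord0) (pair1_measurable t)).
rewrite -[in RHS](rV_delK ord0 v) [rV_del ord0 v]surjective_pairing rV_upd_ins0.
elim: (enum 'I_n) (rV_del ord0 v).2 => //= j J ihJ w.
by rewrite /rV_part; apply: eq_integral => s _; rewrite rV_upd_ins_lift ihJ.
Qed.

(** The functions on the hyperplanes are taken as line integrals of [H i]; integrating them over the
    remaining variables restores the full integral on the right. *)
Lemma loomis_whitney n (H : 'I_n -> 'rV[R]_n -> \bar R) : (1 < n)%N ->
  (forall i, nnmeas (H i)) ->
  (\int[lebesgue_rV n]_v \prod_i (rV_part i (H i) v `^ n.-1%:R^-1) <=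
   \prod_i ((\int[lebesgue_rV n]_v H i v) `^ n.-1%:R^-1))%E.
Proof.
move=> n1 hH; rewrite (integral_rV_parts 0); last first.
  split=> [|v]; last by apply: prode_ge0 => i _; exact: poweR_ge0.
  apply: emeasurable_prod => i; apply: measurable_fun_poweR.
  by case: (nnmeas_part i (hH i)).
apply: (le_trans (rV_parts_prod n1 (enum_uniq _) _ _ 0)) => //.
- by move=> i; exact: nnmeas_part.
- by move=> i; exact: indep_part.
rewrite le_eqVlt; apply/orP; left; apply/eqP; apply: eq_bigr => i _.
by rewrite (integral_rV_parts 0)// (rV_parts_rem (hH i) (i := i))// mem_enum.
Qed.

End loomis_whitney_integral.

(** * Test functions *)

Section derive_extra.
Context {R : realType}.

Lemma is_deriveP (V W : normedModType R) (f : V -> W) x v l :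
  is_derive x v f l <-> h^-1 *: (f (h *: v + x) - f x) @[h --> 0^'] --> l.
Proof.
split=> [[fd <-]|fl]; first exact: fd.
by split; [exact: (cvgP l)|exact: cvg_lim].
Qed.

Lemma is_derive_affine (f : R -> R) (c s x l : R) :
  is_derive (c * x + s) 1 f l -> is_derive x 1 (fun y => f (c * y + s)) (c * l).
Proof.
move=> fl; rewrite mulrC.
have -> : (fun y => f (c * y + s)) = f \o (fun y => c * y + s) by [].
apply: is_derive1_comp.
have -> : (fun y => c * y + s) = (c \*: id) + cst s by apply/funext => y.
by apply: is_derive_eq; rewrite addr0 /GRing.scale/= mulr1.
Qed.

Lemma is_derive_quadratic0 (f : R -> R) C : (forall x, `|f x| <= C * x ^+ 2) ->
  is_derive (0 : R) 1 f 0.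
Proof.
move=> fC; have f0 : f 0 = 0.
  by apply/eqP; have := fC 0; rewrite expr2 mul0r mulr0 normr_le0.
have C0 : 0 <= C by have := le_trans (normr_ge0 _) (fC 1); rewrite expr1n mulr1.
apply/is_deriveP; apply/cvgr0Pnorm_le => e e0.
near=> h; rewrite f0 subr0 addr0 /GRing.scale/= mulr1.
have h0 : h != 0 by near: h; exact: nbhs_dnbhs_neq.
rewrite normrM normfV ler_pdivrMl ?normr_gt0//.
apply: (le_trans (fC h)).
rewrite -real_normK ?num_real// expr2 mulrCA ler_wpM2l//.
rewrite (@le_trans _ _ ((C + 1) * `|h|))//; first by rewrite ler_wpM2r// lerDl.
rewrite mulrC -ler_pdivlMr ?ltr_wpDl//.
by near: h; apply: dnbhs0_le; rewrite divr_gt0// ltr_wpDl.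
Unshelve. all: by end_near. Qed.

End derive_extra.

Section smooth1.
Context {R : realType}.
Implicit Types (f g : R -> R) (p : {poly R}).

(* exp(-1/x) on x > 0 times a polynomial in 1/x: the functions produced by
   differentiating exp(-1/x). *)
Definition flat p (x : R) : R := if 0 < x then p.[x^-1] * expR (- x^-1) else 0.

(** With y = 1/x, the exponential series gives y^(i+2) <= (i+2)! e^y, which bounds each monomial of
    [p]; hence the factorials in the constant. A quadratic bound is enough for a zero derivative at
    the origin. *)
Lemma flat_quadratic p : exists C, forall x, `|flat p x| <= C * x ^+ 2.
Proof.
exists (\sum_(i < size p) `|p`_i| * (i.+2)`!%:R) => x; rewrite /flat.
case: ifPn => x0; last first.
  by rewrite normr0 mulr_ge0 ?sqr_ge0// sumr_ge0// => i _; rewrite mulr_ge0.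
set y := x^-1; have y0 : 0 < y by rewrite invr_gt0.
have -> : x ^+ 2 = (y ^+ 2)^-1 by rewrite /y exprVn invrK.
rewrite ler_pdivlMr ?exprn_gt0// normrM (gtr0_norm (expR_gt0 _)).
rewrite horner_coef.
apply: (@le_trans _ _ ((\sum_(i < size p) `|p`_i| * y ^+ i) * expR (- y) * y ^+ 2)).
  rewrite ler_wpM2r ?sqr_ge0// ler_wpM2r ?expR_ge0//.
  apply: (le_trans (ler_norm_sum _ _ _)); apply: ler_sum => i _.
  by rewrite normrM normrX (gtr0_norm y0).
rewrite !mulr_suml; apply: ler_sum => i _.
rewrite -mulrA -mulrA ler_wpM2l//.
rewrite expRN mulrA mulrAC -exprD addn2 ler_pdivrMr ?expR_gt0//.
rewrite -ler_pdivrMl ?ltr0n ?fact_gt0// mulrC.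
by apply: le_trans (expR_ge1Dxn i.+1 (ltW y0)); rewrite lerDr.
Qed.

(** For x > 0 the chain rule turns p(1/x) exp(-1/x) into (p - p')(1/x) x^(-2) exp(-1/x), again of
    the same form. *)
Lemma is_derive_flat p (x : R) :
  is_derive x (1 : R) (flat p) (flat ((p - p^`()) * 'X^2) x).
Proof.
have [x0|x0|<-] := ltgtP 0 x; last first.
- rewrite [X in is_derive _ _ _ X]/flat ltxx.
  by have [C] := flat_quadratic p; exact: is_derive_quadratic0.
- apply: (@near_eq_is_derive _ _ _ (cst 0)); last first.
    by apply: is_derive_eq; rewrite /flat ltNge (ltW x0).
  near=> y; rewrite /flat ltNge ltW//.
  by near: y; exact: lt_nbhsl.
- apply: (@near_eq_is_derive _ _ _ (fun y : R => p.[y^-1] * expR (- y^-1))).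
    near=> y; rewrite /flat; suff -> : 0 < y by [].
    by near: y; exact: lt_nbhsr.
  have dV : is_derive x (1 : R) (fun y : R => y^-1) (- x ^- 2).
    apply: is_derive_eq; [apply: (is_deriveV (f := id)); by rewrite gt_eqF|].
    by rewrite /GRing.scale/= mulr1.
  have dp : is_derive x (1 : R) (fun y : R => p.[y^-1]) (p^`().[x^-1] * - x ^- 2).
    by apply: (is_derive1_comp (f := horner p)).
  have de : is_derive x (1 : R) (fun y : R => expR (- y^-1)) (expR (- x^-1) * (x ^- 2)).
    apply: (is_derive1_comp (f := expR)); rewrite -[X in is_derive _ _ _ X]opprK.
    exact: is_deriveN.
  apply: (is_derive_eq (is_deriveM dp de)).
  rewrite /GRing.scale/= /flat x0 hornerM hornerXn hornerD hornerN exprVn.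
  ring.
Unshelve. all: by end_near. Qed.

(* Closed under differentiation by construction, so that smoothness needs no
   higher derivatives. *)
Inductive smooth1 : (R -> R) -> Prop :=
| smooth1_flat p (c s : R) : smooth1 (fun x => flat p (c * x + s))
| smooth1_cst (c : R) : smooth1 (fun=> c)
| smooth1D f g : smooth1 f -> smooth1 g -> smooth1 (fun x => f x + g x)
| smooth1M f g : smooth1 f -> smooth1 g -> smooth1 (fun x => f x * g x)
| smooth1V f : smooth1 f -> (forall x, f x != 0) -> smooth1 (fun x => (f x)^-1)
(* Antiderivatives of bumps are defined by integrals, not by formulas, and must be test functions
   too. *)
| smooth1_prim f g : smooth1 g -> (forall x : R, is_derive x (1 : R) f (g x)) -> smooth1 f.

Lemma smooth1_derive f : smooth1 f ->
  exists2 g, smooth1 g & forall x : R, is_derive x (1 : R) f (g x).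
Proof.
elim=> {f} [p c s|c|f g _ [f' sf' ff'] _ [g' sg' gg']
  |f g sf [f' sf' ff'] sg [g' sg' gg']|f sf [f' sf' ff'] f0|f g sg _ fg].
- exists (fun x => c * flat ((p - p^`()) * 'X^2) (c * x + s)).
    by apply: smooth1M; [exact: smooth1_cst|exact: smooth1_flat].
  by move=> x; apply: is_derive_affine; exact: is_derive_flat.
- by exists (fun=> 0); [exact: smooth1_cst|move=> x; exact: is_derive_cst].
- by exists (fun x => f' x + g' x); [exact: smooth1D|move=> x; exact: is_deriveD].
- exists (fun x => f x * g' x + g x * f' x); last by move=> x; exact: is_deriveM.
  by apply: smooth1D; exact: smooth1M.
- exists (fun x => -1 * (f x)^-1 * (f x)^-1 * f' x).
    by do !apply: smooth1M => //; [exact: smooth1_cst|exact: smooth1V..].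
  move=> x; apply: (is_derive_eq (is_deriveV (f0 x) (ff' x))).
  by rewrite /GRing.scale/= mulN1r expr2 invfM mulNr.
- by exists g.
Qed.

Lemma smooth1_continuous f : smooth1 f -> continuous f.
Proof.
move=> /smooth1_derive[g _ fg] x.
by apply/differentiable_continuous/derivable1_diffP; case: (fg x).
Qed.

Lemma smooth1_affine f (c s : R) : smooth1 f -> smooth1 (fun x => f (c * x + s)).
Proof.
move=> sf; elim: sf c s => {f} [p c s|c|f g _ hf _ hg|f g _ hf _ hg|f _ hf f0
  |f g _ hg fg] c' s'.
- under eq_fun do rewrite mulrDr mulrA -addrA.
  exact: smooth1_flat.
- exact: smooth1_cst.
- exact: smooth1D.
- exact: smooth1M.
- exact: smooth1V.
- apply: (@smooth1_prim _ (fun x => c' * g (c' * x + s'))).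
    by apply: smooth1M => //; exact: smooth1_cst.
  by move=> x; exact: is_derive_affine.
Qed.

Definition step1 (x : R) : R := flat 1 x / (flat 1 x + flat 1 (1 - x)).

Lemma flat1_ge0 x : 0 <= flat 1 x.
Proof. by rewrite /flat; case: ifP => // _; rewrite hornerC mul1r expR_ge0. Qed.

Lemma flat1_gt0 x : 0 < x -> 0 < flat 1 x.
Proof. by move=> x0; rewrite /flat x0 hornerC mul1r expR_gt0. Qed.

Lemma flat_le0 p x : x <= 0 -> flat p x = 0.
Proof. by rewrite /flat leNgt => /negbTE ->. Qed.

Lemma step1_den_gt0 x : 0 < flat 1 x + flat 1 (1 - x).
Proof.
have [x0|x0] := ltP 0 x; first by rewrite ltr_pwDl// ?flat1_gt0// flat1_ge0.
by rewrite ltr_wpDl ?flat1_ge0// flat1_gt0// subr_gt0 (le_lt_trans x0).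
Qed.

Lemma smooth1_step1 : smooth1 step1.
Proof.
have s1 : smooth1 (flat 1).
  rewrite (_ : flat 1 = fun x => flat 1 (1 * x + 0)); first exact: smooth1_flat.
  by apply/funext => x; rewrite mul1r addr0.
apply: smooth1M => //; apply: smooth1V.
- apply: smooth1D => //.
  rewrite (_ : (fun _ => _) = (fun x => flat 1 (-1 * x + 1))); first exact: smooth1_flat.
  by apply/funext => x; rewrite mulN1r addrC.
- by move=> x; rewrite gt_eqF// step1_den_gt0.
Qed.

Lemma step1_itv x : 0 <= step1 x <= 1.
Proof.
apply/andP; split; first by rewrite divr_ge0 ?flat1_ge0// ltW// step1_den_gt0.
by rewrite ler_pdivrMr ?step1_den_gt0// mul1r lerDl flat1_ge0.
Qed.

Lemma step1_le0 x : x <= 0 -> step1 x = 0.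
Proof. by move=> x0; rewrite /step1 flat_le0// mul0r. Qed.

Lemma step1_ge1 x : 1 <= x -> step1 x = 1.
Proof.
move=> x1; rewrite /step1 (@flat_le0 _ (1 - x)) ?subr_le0// addr0 divff//.
by rewrite gt_eqF// flat1_gt0// (lt_le_trans _ x1).
Qed.

Definition bumpfun f := smooth1 f /\ exists k : nat, forall x, k%:R <= `|x| -> f x = 0.

(** Both ramps lie inside ]a, b[ and have width 1/(k+1), so that the limit is the indicator of the
    open interval while the support never leaves [a, b]. *)
Definition plateau (a b : R) (k : nat) (x : R) : R :=
  step1 (k.+1%:R * (x - a)) * step1 (k.+1%:R * (b - x)).

Lemma plateau_itv a b k x : 0 <= plateau a b k x <= 1.
Proof.
have /andP[s0 s1] := step1_itv (k.+1%:R * (x - a)).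
have /andP[t0 t1] := step1_itv (k.+1%:R * (b - x)).
by rewrite mulr_ge0// mulr_ile1.
Qed.

Lemma plateau_out a b k x : ~ (`]a, b[%classic x) -> plateau a b k x = 0.
Proof.
move=> /= /negP; rewrite in_itv/= negb_and -!leNgt /plateau => /orP[xa|bx].
  by rewrite step1_le0 ?mul0r// mulr_ge0_le0// subr_le0.
by rewrite [X in _ * X]step1_le0 ?mulr0// mulr_ge0_le0// subr_le0.
Qed.

Lemma smooth1_plateau a b k : smooth1 (plateau a b k).
Proof.
apply: smooth1M.
  rewrite (_ : (fun _ => _) = (fun x => step1 (k.+1%:R * x + - (k.+1%:R * a)))).
    exact: smooth1_affine smooth1_step1.
  by apply/funext => x; rewrite mulrBr.
rewrite (_ : (fun _ => _) = (fun x => step1 (- k.+1%:R * x + (k.+1%:R * b)))).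
  exact: smooth1_affine smooth1_step1.
by apply/funext => x; rewrite mulrBr mulNr addrC.
Qed.

Lemma bump_plateau a b k : bumpfun (plateau a b k).
Proof.
split; first exact: smooth1_plateau.
exists (Num.truncn (Num.max `|a| `|b|)).+1 => x kx; apply: plateau_out => /=.
rewrite in_itv/= => /andP[ax xb].
have : `|x| < (Num.truncn (Num.max `|a| `|b|)).+1%:R.
  apply: le_lt_trans (truncnS_gt _); rewrite le_max.
  have [x0|x0] := leP 0 x.
    by apply/orP; right; rewrite ger0_norm// (le_trans (ltW xb))// ler_norm.
  by apply/orP; left; rewrite ltr0_norm// -(normrN a) (le_trans _ (ler_norm _))// lerN2 ltW.
by rewrite ltNge kx.
Qed.

Lemma cvg_plateau a b x :
  plateau a b k x @[k --> \oo] --> (\1_`]a, b[%classic x : R).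
Proof.
rewrite indicE; case: (boolP (x \in `]a, b[%classic)) => [|xab]; last first.
  rewrite (_ : (fun _ => _) = cst 0); first exact: cvg_cst.
  by apply/funext => k; rewrite plateau_out//; move: xab; rewrite notin_setE.
rewrite inE /= in_itv/= => /andP[ax xb].
have H (c : R) : 0 < c -> \forall k \near \oo, 1 <= k.+1%:R * c.
  move=> c0; near=> k; rewrite -ler_pdivrMr// div1r.
  apply: (@le_trans _ _ (k%:R : R)); last by rewrite ler_nat.
  by near: k; exact: nbhs_infty_ger.
apply: cvg_near_cst; near=> k; rewrite /plateau !step1_ge1 ?mulr1//.
- by near: k; apply: H; rewrite subr_gt0.
- by near: k; apply: H; rewrite subr_gt0.
Unshelve. all: by end_near. Qed.

End smooth1.

Section test_functions.
Context {R : realType} (d : nat).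
Local Notation Z := (R * 'rV[R]_d)%type.
Implicit Types (phi : Z -> R) (i : 'I_d.+1).

(** A uniform numbering of the d+1 coordinates, with rho at index 0. *)
Definition coordZ i (z : Z) : R := rV_ins ord0 z ord0 i.

Lemma coordZ_line i (h : R) (v z : Z) :
  coordZ i (h *: v + z) = coordZ i v * h + coordZ i z.
Proof.
rewrite /coordZ; case: (unliftP ord0 i) => [j ->|->].
  by rewrite !rV_ins_lift /= !mxE mulrC.
by rewrite !rV_ins_eq /= mulrC.
Qed.

Lemma continuous_coordZ i : continuous (coordZ i).
Proof.
case: (unliftP ord0 i) => [j ->|->].
  rewrite (_ : coordZ _ = (fun v : 'rV[R]_d => v ord0 j) \o snd); last first.
    by apply/funext => z; rewrite /coordZ rV_ins_lift.
  by move=> z; apply: continuous_comp; [exact: cvg_snd|exact: coord_continuous].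
rewrite (_ : coordZ _ = fst); first by move=> z; exact: cvg_fst.
by apply/funext => z; rewrite /coordZ rV_ins_eq.
Qed.

Lemma is_derive_coordZ i (f : R -> R) (z v : Z) (l : R) :
  is_derive (coordZ i z) (1 : R) f l ->
  is_derive z v (fun z => f (coordZ i z)) (coordZ i v * l).
Proof.
move=> fl; apply/is_deriveP.
have : is_derive (0 : R) (1 : R) (fun h => f (coordZ i v * h + coordZ i z)) (coordZ i v * l).
  by apply: is_derive_affine; rewrite mulr0 add0r.
move=> /is_deriveP; apply: cvg_trans; apply: near_eq_cvg; apply: nearW => h /=.
by rewrite coordZ_line mulr0 add0r addr0 /GRing.scale/= mulr1.
Qed.

(** [smooth] quantifies over all finite lists of directions; a class closed under every directional
    derivative reduces it to continuity and one derivative. *)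
Inductive smoothZ : (Z -> R) -> Prop :=
| smoothZ_coord i f : smooth1 f -> smoothZ (fun z => f (coordZ i z))
| smoothZ_cst (c : R) : smoothZ (fun=> c)
| smoothZD phi psi : smoothZ phi -> smoothZ psi -> smoothZ (fun z => phi z + psi z)
| smoothZM phi psi : smoothZ phi -> smoothZ psi -> smoothZ (fun z => phi z * psi z).

Lemma smoothZ_derive phi v : smoothZ phi ->
  exists2 psi, smoothZ psi & forall z, is_derive z v phi (psi z).
Proof.
elim=> {phi} [i f /smooth1_derive[g sg fg]|c|f g _ [f' sf' ff'] _ [g' sg' gg']
  |f g sf [f' sf' ff'] sg [g' sg' gg']].
- exists (fun z => coordZ i v * g (coordZ i z)).
    by apply: smoothZM; [exact: smoothZ_cst|exact: smoothZ_coord].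
  by move=> z; exact: is_derive_coordZ.
- by exists (fun=> 0); [exact: smoothZ_cst|move=> x; exact: is_derive_cst].
- by exists (fun x => f' x + g' x); [exact: smoothZD|move=> x; exact: is_deriveD].
- exists (fun x => f x * g' x + g x * f' x); last by move=> x; exact: is_deriveM.
  by apply: smoothZD; exact: smoothZM.
Qed.

Lemma smoothZ_continuous phi : smoothZ phi -> continuous phi.
Proof.
elim=> {phi} [i f sf|c|f g _ cf _ cg|f g _ cf _ cg] z.
- apply: continuous_comp; [exact: continuous_coordZ|exact: smooth1_continuous].
- exact: cvg_cst.
- exact: cvgD (cf z) (cg z).
- exact: cvgM (cf z) (cg z).
Qed.

Lemma smoothZ_smooth phi : smoothZ phi -> smooth phi.
Proof.
move=> sphi vs.
have : smoothZ (iter_derive vs phi).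
  elim: vs => //= v vs /(@smoothZ_derive _ v)[psi spsi dpsi].
  rewrite (_ : 'D_v _ = psi)//; apply/funext => z.
  by have [_ ->] := dpsi z.
move=> s; split; first exact: smoothZ_continuous.
by move=> z v; have [psi _ /(_ z)[]] := smoothZ_derive v s.
Qed.

(** Differentiating in a coordinate direction replaces one factor, so the family is stable under the
    operators at hand; it is also rich enough to detect locally integrable functions. *)
Definition prod_bump (al : 'I_d.+1 -> R -> R) (z : Z) : R :=
  \prod_i al i (coordZ i z).

Lemma compact_boxZ (k : R) :
  compact [set z : Z | forall i, `[- k, k]%classic (coordZ i z)].
Proof.
rewrite (_ : [set _ | _] = `[- k, k]%classic `*`
    [set v : 'rV[R]_d | forall j, `[- k, k]%classic (v ord0 j)]).
  apply: compact_setX; first exact: segment_compact.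
  by apply: (@rV_compact _ _ (fun=> `[- k, k]%classic)) => i; exact: segment_compact.
apply/seteqP; split => [z h|z [h0 h] i].
  split; first by have := h ord0; rewrite /coordZ rV_ins_eq.
  by move=> j; have := h (lift ord0 j); rewrite /coordZ rV_ins_lift.
rewrite /coordZ; case: (unliftP ord0 i) => [j ->|->].
  by have := h j; rewrite rV_ins_lift.
by rewrite rV_ins_eq.
Qed.

Lemma bump_uniform (I : finType) (al : I -> R -> R) : (forall j, bumpfun (al j)) ->
  exists k : nat, forall j (x : R), k%:R <= `|x| -> al j x = 0.
Proof.
move=> hal; have /choice[k hk] : forall j, exists k : nat,
    forall x : R, k%:R <= `|x| -> al j x = 0.
  by move=> j; have [] := hal j.
exists (\max_j k j)%N => j x kx; apply: hk.
by apply: le_trans kx; rewrite ler_nat; exact: leq_bigmax.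
Qed.

Lemma test_prod_bump al : (forall i, bumpfun (al i)) -> test_function (prod_bump al).
Proof.
move=> bal; split.
  apply: smoothZ_smooth; rewrite /prod_bump; elim: (index_enum _) => [|i s ih].
    by under eq_fun do rewrite big_nil; exact: smoothZ_cst.
  under eq_fun do rewrite big_cons.
  by apply: smoothZM => //; apply: smoothZ_coord; have [] := bal i.
have [k hk] := bump_uniform bal.
apply: (subclosed_compact _ (@compact_boxZ k%:R)) => //; first exact: closed_closure.
have cK : closed [set z : Z | forall i, `[- k%:R, k%:R]%classic (coordZ i z)].
  by apply: compact_closed; [exact: norm_hausdorff|exact: compact_boxZ].
rewrite [X in _ `<=` X](iffLR (closure_id _) cK).
apply: closureS => z /= + i.
rewrite /prod_bump => /prodf_neq0 /(_ i erefl).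
apply: contra_neqP; rewrite in_itv/= -ler_norml => /negP; rewrite -ltNge => /ltW.
exact: hk.
Qed.

Definition dirZ i : Z := if unlift ord0 i is Some j then e_x j else e_rho d.

Lemma coordZ_dirZ i j : coordZ j (dirZ i) = (j == i)%:R.
Proof.
rewrite /coordZ /dirZ; case: (unliftP ord0 i) => [k ->|->].
- case: (unliftP ord0 j) => [l ->|->]; last by rewrite rV_ins_eq (negbTE (neq_lift _ _)).
  by rewrite rV_ins_lift /= mxE eqxx/= (inj_eq lift_inj).
- case: (unliftP ord0 j) => [l ->|->]; last by rewrite rV_ins_eq eqxx.
  by rewrite rV_ins_lift /= mxE.
Qed.

Lemma derive_prod_bump al i g : (forall x : R, is_derive x (1 : R) (al i) (g x)) ->
  'D_(dirZ i) (prod_bump al) =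
  prod_bump (fun j => if j == i then g else al j).
Proof.
move=> dal; apply/funext => z.
have dr : is_derive z (dirZ i) (fun z => \prod_(j | j != i) al j (coordZ j z)) 0.
  apply/is_deriveP; rewrite (_ : (fun _ => _) = cst 0); first exact: cvg_cst.
  apply/funext => h; rewrite [X in _ *: (X - _)](_ : _ = \prod_(j | j != i) al j (coordZ j z)).
    by rewrite subrr scaler0.
  apply: eq_bigr => j ji; rewrite coordZ_line coordZ_dirZ (negbTE ji) mul0r.
  by rewrite add0r.
have di : is_derive z (dirZ i) (fun z => al i (coordZ i z)) (g (coordZ i z)).
  by rewrite -[X in is_derive _ _ _ X]mul1r -[1]/(true%:R) -(eqxx i) -coordZ_dirZ;
    exact: is_derive_coordZ.
have [_] := is_deriveM di dr.
rewrite (_ : _ * _ = prod_bump al); last by apply/funext => y; rewrite /prod_bump (bigD1 i).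
move=> ->; rewrite scaler0 add0r /prod_bump [RHS](bigD1 i)//= eqxx /GRing.scale/= mulrC.
by congr (_ * _); apply: eq_bigr => j /negbTE ->.
Qed.

End test_functions.

(** * The fundamental lemma of the calculus of variations *)

Section du_bois_reymond.
Context {R : realType} (n : nat).
Local Notation lam := (@lebesgue_rV R n).
Local Notation V := 'rV[R]_n.

Definition locint (F : V -> R) := measurable_fun [set: V] F /\
  forall k, lam.-integrable (rV_cube k) (EFin \o F).

Lemma measurable_rV_cube k : measurable (@rV_cube R n k).
Proof. exact: measurable_rV_obox. Qed.

Lemma rV_obox_sub_cube (a b : 'I_n -> R) : exists k, rV_obox a b `<=` @rV_cube R n k.
Proof.
exists (\max_i (Num.truncn (Num.max `|a i| `|b i|)%R).+1)%N => v h.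
apply/rV_cubeP => i; have := h i; rewrite /= in_itv/= => /andP[ax xb].
apply: (@lt_le_trans _ _ (Num.truncn (Num.max `|a i| `|b i|)).+1%:R); last first.
  by rewrite ler_nat (leq_bigmax i).
apply: le_lt_trans (truncnS_gt _); rewrite le_max.
have [x0|x0] := leP 0 (v ord0 i).
  by apply/orP; right; rewrite ger0_norm// (le_trans (ltW xb))// ler_norm.
apply/orP; left; rewrite ltr0_norm// -(normrN (a i)).
by rewrite (le_trans _ (ler_norm _))// lerN2 ltW.
Qed.

(** Inside a fixed cube, where F is integrable, the sets over which F integrates to zero form a
    Dynkin system containing the boxes, hence include all measurable sets. *)
Lemma locint_obox_ae0 (F : V -> R) : locint F ->
  (forall a b, (\int[lam]_(v in rV_obox a b) (F v)%:E = 0)%E) ->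
  {ae lam, forall v, F v = 0}.
Proof.
move=> [mF iF] F0.
suff H N : ae_eq lam (rV_cube N) (EFin \o F) (cst 0%E).
  have : {ae lam, forall v N, rV_cube N v -> (F v)%:E = 0%E}.
    by apply: ae_foralln => N; exact: H.
  apply: filterS => v h.
  have [N _ Nv] : (\bigcup_k @rV_cube R n k) v by rewrite rV_cube_cover.
  by have [] := h N Nv.
have mC := measurable_rV_cube N.
have iS A : measurable A -> lam.-integrable (A `&` rV_cube N) (EFin \o F).
  by move=> mA; apply: integrableS (iF N) => //; exact: measurableI.
suff P A : measurable A -> (\int[lam]_(v in A `&` rV_cube N) (F v)%:E = 0)%E.
  apply: integral_ae_eq => // E EC mE; rewrite integral0.
  by rewrite -(P E mE) setIidl.
rewrite measurable_rV_oboxE; move: A.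
apply: (@dynkin_induction _ _ _
  (fun A => \int[lam]_(v in A `&` rV_cube N) (F v)%:E = 0)%E
  (@measurable_rV_oboxE R n)).
- exact: setI_closed_rV_oboxes.
- by rewrite setTI; exact: F0.
- move=> _ [a [b ->]].
  have [a' [b' ->]] : rV_oboxes (rV_obox a b `&` @rV_cube R n N).
    by apply: setI_closed_rV_oboxes; do 2 eexists.
  exact: F0.
- move=> S mS PS; have := F0 (fun=> - N%:R) (fun=> N%:R).
  rewrite -/(rV_cube N) -[X in (\int[lam]_(v in X) _)%E]setTI -(setUv S) setIUl.
  rewrite integral_setU//; last 4 first.
  + exact: measurableI.
  + by apply: measurableI => //; exact: measurableC.
  + by apply/measurable_EFinP; exact: measurable_funTS.
  + apply/disj_setPS => v [[Sv _] [nSv _]]; exact: nSv.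
  by rewrite PS add0e.
- move=> A mA tA PA; rewrite setI_bigcupl integral_bigcup.
  + by rewrite eseries0// => i _ _; exact: PA.
  + exact: trivIset_setIr.
  + by move=> k; exact: measurableI.
  + rewrite -setI_bigcupl; apply: iS; exact: bigcupT_measurable.
Qed.

Lemma measurable_prod_coord (al : 'I_n -> R -> R) :
  (forall i, smooth1 (al i)) ->
  measurable_fun [set: V] (fun v => \prod_i al i (v ord0 i)).
Proof.
move=> sal; apply: measurable_prod => i _.
apply: (measurableT_comp (f := al i)); last exact: measurable_rV_coord.
by apply: continuous_measurable_fun; exact: smooth1_continuous.
Qed.

(** Products of plateaus converge to the indicator of a box, dominated by |F| on a cube containing
    it; so the integrals of F over boxes vanish. *)
Theorem du_bois_reymond (F : V -> R) : locint F ->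
  (forall al, (forall i, bumpfun (al i)) ->
    (\int[lam]_v (F v * \prod_i al i (v ord0 i))%:E = 0)%E) ->
  {ae lam, forall v, F v = 0}.
Proof.
move=> lF HF; have [mF iF] := lF; apply: locint_obox_ae0 => // a b.
have [k0 bk0] := rV_obox_sub_cube a b.
have mB := @measurable_rV_obox R n a b.
have mC := measurable_rV_cube k0.
pose f_ k : V -> \bar R :=
  EFin \o (fun v => F v * \prod_i plateau (a i) (b i) k (v ord0 i)).
have f_out k v : ~ rV_obox a b v -> f_ k v = 0%E.
  move=> /existsNP[i vi]; rewrite /f_/= (bigD1 i)//= plateau_out//.
  by rewrite mul0r mulr0.
have plat k (v : V) : 0 <= \prod_i plateau (a i) (b i) k (v ord0 i) <= 1.
  apply/andP; split; first by apply: prodr_ge0 => i _; have /andP[] := plateau_itv (a i) (b i) k (v ord0 i).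
  by apply: prodr_ile1 => i _; exact: plateau_itv.
have mp k : measurable_fun [set: V] (fun v => \prod_i plateau (a i) (b i) k (v ord0 i)).
  by apply: (@measurable_prod_coord (fun i => plateau (a i) (b i) k)) => i; exact: smooth1_plateau.
have := @dominated_convergence _ V R lam setT measurableT f_
  ((EFin \o F) \_ (rV_obox a b)) (abse \o ((EFin \o F) \_ (rV_cube k0))).
case.
- by move=> k; apply/measurable_EFinP; exact: measurable_funM.
- apply/(measurable_restrictT _ mB); apply/measurable_EFinP.
  exact: measurable_funTS.
- apply: aeW => v _; rewrite patchE; case: ifPn => [|]; last first.
    rewrite notin_setE => nv; rewrite (_ : f_^~ v = cst 0%E); first exact: cvg_cst.
    by apply/funext => k; exact: f_out.
  rewrite inE => bv.
  have H : \prod_i plateau (a i) (b i) k (v ord0 i) @[k --> \oo] --> (1 : R).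
    elim: (index_enum _) => [|i s ih].
      by under eq_fun do rewrite big_nil; exact: cvg_cst.
    under eq_fun do rewrite big_cons.
    have := @cvg_plateau R (a i) (b i) (v ord0 i).
    rewrite indicE mem_set/=; last exact: bv.
    by move=> /cvgM /(_ ih); rewrite mulr1.
  apply: cvg_EFin; first exact: nearW.
  have h : F v * \prod_i plateau (a i) (b i) k (v ord0 i) @[k --> \oo] --> F v * 1.
    by apply: cvgM => //; exact: cvg_cst.
  by rewrite mulr1 in h; exact: h.
- apply: integrable_abse.
  by apply/(integrable_mkcond _ mC); exact: iF.
- apply: aeW => v k _; rewrite [X in (_ <= X)%E]/= patchE.
  have [bv|bv] := pselect (rV_obox a b v); last by rewrite f_out// abse0 abse_ge0.
  rewrite mem_set/=; last exact: bk0.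
  rewrite /f_/= lee_fin normrM ler_piMr//.
  by have /andP[p0 p1] := plat k v; rewrite ger0_norm.
move=> _ _ h; rewrite integral_mkcond -(cvg_lim _ h)//.
apply: lim_near_cst => //; apply: nearW => k.
apply: (HF (fun i => plateau (a i) (b i) k)) => i.
exact: bump_plateau.
Qed.

End du_bois_reymond.

(** * Integrability of cut-off functions and bounds for bumps *)

Section measure_extra.
Context {R : realType}.

Lemma integrable_cutoff d (T : measurableType d) (mu : {measure set T -> \bar R})
    (A : set T) (f psi : T -> R) (M : R) :
  measurable A -> measurable_fun [set: T] f -> measurable_fun [set: T] psi ->
  (forall x, `|psi x| <= M) -> (forall x, ~ A x -> psi x = 0) ->
  mu.-integrable A (EFin \o f) ->
  mu.-integrable setT (EFin \o (fun x => f x * psi x)).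
Proof.
move=> mA mf mpsi psiM psi0 fA.
have M0 : forall x : T, 0 <= M by move=> x; exact: le_trans (psiM x).
apply: (@le_integrable _ _ _ mu setT measurableT _
  (fun x => M%:E * (abse \o ((EFin \o f) \_ A)) x)%E).
- by apply/measurable_EFinP; exact: measurable_funM.
- move=> x _; rewrite /= abseM !abse_EFin/= abse_id (ger0_norm (M0 x)) patchE.
  have [xA|xA] := pselect (A x).
    rewrite mem_set//= -EFinM lee_fin normrM mulrC.
    by apply: ler_wpM2r => //; exact: psiM.
  by rewrite psi0// mulr0 normr0 mule_ge0 ?lee_fin ?abse_ge0//; exact: M0 x.
- apply: integrableZl => //; apply: integrable_abse.
  exact/(integrable_mkcond _ mA).
Qed.

Lemma measurable_param_integral d1 d2 (T1 : measurableType d1)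
    (T2 : measurableType d2) (m1 : {sigma_finite_measure set T1 -> \bar R})
    (f : T1 * T2 -> \bar R) :
  measurable_fun [set: T1 * T2] f ->
  measurable_fun [set: T2] (fun y => \int[m1]_x f (x, y))%E.
Proof.
move=> mf.
rewrite (_ : (fun _ => _) = (fun y => \int[m1]_x f^\+ (x, y)) \-
    (fun y => \int[m1]_x f^\- (x, y)))%E.
  apply: emeasurable_funB.
  - by apply: (measurable_fun_fubini_tonelli_G f^\+)%E => //; exact: measurable_funepos.
  - by apply: (measurable_fun_fubini_tonelli_G f^\-)%E => //; exact: measurable_funeneg.
apply/funext => y; rewrite integralE; congr (_ - _)%E; apply: eq_integral => x _.
  by rewrite !funeposE.
by rewrite !funenegE.
Qed.

Let lerNn (k : nat) : - (k%:R : R) <= k%:R.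
Proof. by rewrite lerNl (le_trans _ (ler0n _ _))// oppr_le0. Qed.

Lemma bump_bounded (f : R -> R) : bumpfun f ->
  exists (k : nat) (M : R), (forall x, `|f x| <= M) /\ forall x, k%:R <= `|x| -> f x = 0.
Proof.
move=> [sf [k hk]].
have cf : {within `[- (k%:R : R), k%:R], continuous (fun x => `|f x|)}.
  apply: continuous_subspaceT => x.
  by apply: continuous_comp; [exact: smooth1_continuous|exact: norm_continuous].
have [c _ fc] := @EVT_max R (fun x => `|f x|) (- k%:R) k%:R (@lerNn k) cf.
exists k, `|f c|; split => // x.
have [kx|xk] := leP k%:R `|x|; first by rewrite hk// normr0.
by apply: fc; rewrite in_itv/= -ler_norml ltW.
Qed.

Lemma bump_derive (f : R -> R) : bumpfun f ->
  exists2 g, bumpfun g & forall x : R, is_derive x (1 : R) f (g x).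
Proof.
move=> [sf [k hk]]; have [g sg fg] := smooth1_derive sf.
(* The radius grows by one because vanishing of the derivative needs f = 0 on a neighbourhood, which
   is known only where k < |x|. *)
exists g => //; split => //; exists k.+1 => x kx.
have kx' : k%:R < `|x| by rewrite (lt_le_trans _ kx)// ltr_nat.
have : is_derive x (1 : R) f 0.
  apply: (near_eq_is_derive _ (is_derive_cst (0 : R) x (1 : R))).
  have : {for x, continuous (fun y : R => `|y|)} by exact: norm_continuous.
  move=> /(_ _ (lt_nbhsr kx')) H; near=> y; rewrite hk// ltW//.
  by near: y; exact: H.
by case=> _; case: (fg x) => _ ->.
Unshelve. all: by end_near. Qed.

End measure_extra.

(** * Absolute continuity on lines *)

Section sections.
Context {R : realType} (m : nat) (i : 'I_m.+1).
Local Notation leb := (@lebesgue_measure R).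
Local Notation lam := (@lebesgue_rV R).
Local Notation V := 'rV[R]_m.+1.
Local Notation Y := 'rV[R]_m.
Local Notation ins := (@rV_ins R m i).

Lemma rV_cube_ins k x (y : Y) :
  rV_cube k (ins (x, y)) <-> `|x| < k%:R /\ rV_cube k y.
Proof.
split=> [/rV_cubeP h|[xk /rV_cubeP h]].
  split; first by have := h i; rewrite rV_ins_eq.
  by apply/rV_cubeP => j; have := h (lift i j); rewrite rV_ins_lift.
apply/rV_cubeP => j; case: (unliftP i j) => [l ->|->].
  by rewrite rV_ins_lift.
by rewrite rV_ins_eq.
Qed.

Lemma integrable_rV_ins (F : V -> \bar R) : (lam m.+1).-integrable setT F ->
  (leb \x lam m)%E.-integrable setT (F \o ins).
Proof.
move=> /integrableP[mF Foo]; apply/integrableP; split.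
  exact: (measurableT_comp mF (measurable_rV_ins i)).
move: Foo; rewrite (ge0_integral_rV_ins i)//.
exact: measurableT_comp.
Qed.

Lemma measurable_rV_ins1 (y : Y) :
  measurable_fun [set: measurableTypeR R] (fun x => ins (x, y)).
Proof. exact: (measurableT_comp (measurable_rV_ins i) (pair2_measurable y)). Qed.

Definition locint1 (f : R -> R) := measurable_fun [set: measurableTypeR R] f /\
  forall k : nat, leb.-integrable `]- k%:R, k%:R[ (EFin \o f).

Lemma itv_norm (k x : R) : `]- k, k[%classic x <-> `|x| < k.
Proof. by rewrite /= in_itv/= ltr_norml. Qed.

Lemma locint_section (f : V -> R) : locint f ->
  {ae lam m, forall y, locint1 (fun x => f (ins (x, y)))}.
Proof.
move=> [mf itf].
have mfi y : measurable_fun [set: measurableTypeR R] (fun x => f (ins (x, y))).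
  exact: (measurableT_comp mf (measurable_rV_ins1 y)).
have H K : {ae lam m, forall y, leb.-integrable setT
    ((fun x => ((EFin \o f) \_ (rV_cube K)) (ins (x, y))))}.
  apply: (@ae_integrable2 _ _ _ _ R leb (lam m) (((EFin \o f) \_ (rV_cube K)) \o ins)).
  apply: integrable_rV_ins; apply/(integrable_mkcond _ (measurable_rV_cube K)).
  exact: itf.
have : {ae lam m, forall y K, leb.-integrable setT
    ((fun x => ((EFin \o f) \_ (rV_cube K)) (ins (x, y))))}.
  exact: ae_foralln.
apply: filterS => y h; split => // k.
have [l _ ly] : (\bigcup_k @rV_cube R m k) y by rewrite rV_cube_cover.
have : leb.-integrable `]- k%:R, k%:R[
    (fun x => ((EFin \o f) \_ (rV_cube (maxn k l))) (ins (x, y))).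
  by apply: integrableS (h (maxn k l)).
apply: eq_integrable => // x; rewrite inE => /itv_norm xk.
rewrite patchE mem_set//; apply/rV_cube_ins; split.
  by rewrite (lt_le_trans xk)// ler_nat leq_maxl.
exact: sub_rV_cube (leq_maxr _ _) _ ly.
Qed.

Lemma locint1_bump (f g : R -> R) : locint1 f -> bumpfun g ->
  leb.-integrable setT (EFin \o (fun x => f x * g x)).
Proof.
move=> [mf itf] bg; have [k [M [gM g0]]] := bump_bounded bg.
apply: (@integrable_cutoff R _ _ leb `]- k%:R, k%:R[%classic f g M) => //.
- by apply: continuous_measurable_fun; apply: smooth1_continuous; case: bg.
- by move=> x /itv_norm/negP; rewrite -leNgt => /g0.
Qed.

Lemma bump_prod_bounded n (al : 'I_n -> R -> R) : (forall j, bumpfun (al j)) ->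
  exists (k : nat) (M : R), (forall v : 'rV[R]_n, `|\prod_j al j (v ord0 j)| <= M) /\
    forall v : 'rV[R]_n, ~ rV_cube k v -> \prod_j al j (v ord0 j) = 0.
Proof.
move=> bal; have /choice[f hf] : forall j, exists kM : nat * R,
    (forall x, `|al j x| <= kM.2) /\ forall x : R, kM.1%:R <= `|x| -> al j x = 0.
  by move=> j; have [k [M h]] := bump_bounded (bal j); exists (k, M).
exists (\max_j (f j).1)%N, (\prod_j (f j).2); split => v.
  rewrite normr_prod; apply: ler_prod => j _; rewrite normr_ge0/=.
  by have [+ _] := hf j; exact.
move=> nv; have [j kj] : exists j, (\max_j (f j).1)%N%:R <= `|v ord0 j|.
  apply: contrapT => h; apply: nv; apply/rV_cubeP => j.
  by rewrite ltNge; apply/negP => kj; apply: h; exists j.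
rewrite (bigD1 j)//=; have [_ ->] := hf j; first by rewrite mul0r.
by apply: le_trans kj; rewrite ler_nat; exact: (leq_bigmax j).
Qed.

Lemma locint_prod_bump (f : V -> R) al : locint f -> (forall j, bumpfun (al j)) ->
  (lam m.+1).-integrable setT (EFin \o (fun v => f v * \prod_j al j (v ord0 j))).
Proof.
move=> [mf itf] bal; have [k [M [aM a0]]] := bump_prod_bounded bal.
apply: (@integrable_cutoff R _ _ (lam m.+1) (rV_cube k) f _ M) => //.
  exact: measurable_rV_cube.
by apply: measurable_prod_coord => j; have [] := bal j.
Qed.

Definition ins_fun (al : R -> R) (be : 'I_m -> R -> R) (k : 'I_m.+1) : R -> R :=
  if unlift i k is Some j then be j else al.

Lemma prod_ins_fun al be x (y : Y) :
  \prod_k ins_fun al be k (ins (x, y) ord0 k) =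
  al x * \prod_j be j (y ord0 j).
Proof.
rewrite (bigD1_ord i)//= /ins_fun unlift_none rV_ins_eq; congr (_ * _).
by apply: eq_bigr => j _; rewrite liftK rV_ins_lift.
Qed.

Lemma bump_ins_fun al be : bumpfun al -> (forall j, bumpfun (be j)) ->
  forall k, bumpfun (ins_fun al be k).
Proof. by move=> ba bb k; rewrite /ins_fun; case: unlift. Qed.

(** Fubini turns the hypothesis into the vanishing of the integral of D(y) times a product of bumps
    in y, where D(y) is the difference of the two line integrals; the lemma of du Bois-Reymond in
    the transverse variables gives D = 0 almost everywhere. The null set depends on [al] and [g]. *)
Lemma weak_section (u h : V -> R) (al g : R -> R) :
  locint u -> locint h -> bumpfun al -> bumpfun g ->
  (forall be : 'I_m -> R -> R, (forall j, bumpfun (be j)) ->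
    (\int[lam m.+1]_v (u v * \prod_k ins_fun g be k (v ord0 k))%:E =
     \int[lam m.+1]_v (h v * \prod_k ins_fun al be k (v ord0 k))%:E)%E) ->
  {ae lam m, forall y, \int[leb]_x (u (ins (x, y)) * g x) =
                       \int[leb]_x (h (ins (x, y)) * al x)}.
Proof.
move=> lu lh bal bg W.
have [mu itu] := lu; have [mh ith] := lh.
have [ka [Ma [alM al0]]] := bump_bounded bal.
have [kg [Mg [gM g0]]] := bump_bounded bg.
have cont_m f : bumpfun f -> measurable_fun [set: measurableTypeR R] f.
  by move=> [sf _]; apply: continuous_measurable_fun; exact: smooth1_continuous.
have mcoord f : bumpfun f -> measurable_fun [set: V] (fun v => f (v ord0 i)).
  by move=> bf; exact: (measurableT_comp (cont_m f bf) (measurable_rV_coord i)).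
pose psi (v : V) := u v * g (v ord0 i) - h v * al (v ord0 i).
have mpsi : measurable_fun [set: V] psi.
  by apply: measurable_funB; apply: measurable_funM => //; exact: mcoord.
have good : {ae lam m, forall y, locint1 (fun x => u (ins (x, y))) /\
    locint1 (fun x => h (ins (x, y)))}.
  by apply: filterS2 (locint_section lu) (locint_section lh) => y.
pose D y := \int[leb]_x psi (ins (x, y)).
have DE : {ae lam m, forall y,
    leb.-integrable setT (EFin \o (fun x => psi (ins (x, y)))) /\
    D y = \int[leb]_x (u (ins (x, y)) * g x) - \int[leb]_x (h (ins (x, y)) * al x)}.
  apply: filterS good => y [luy lhy].
  have iu := locint1_bump luy bg; have ih := locint1_bump lhy bal.
  have psiE : (fun x => psi (ins (x, y))) =
      (fun x => u (ins (x, y)) * g x) \- (fun x => h (ins (x, y)) * al x).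
    by apply/funext => x; rewrite /psi rV_ins_eq.
  rewrite /D psiE; split; last by rewrite -RintegralB.
  by have := integrableB measurableT iu ih; apply: eq_integrable => // x _.
have mpsi_ins : measurable_fun [set: measurableTypeR R * Y] (EFin \o (psi \o ins)).
  by apply/measurable_EFinP; exact: (measurableT_comp mpsi (measurable_rV_ins i)).
have mDe : measurable_fun [set: Y] (fun y => \int[leb]_x (psi (ins (x, y)))%:E)%E.
  exact: (@measurable_param_integral R _ _ _ _ leb _ mpsi_ins).
have mD : measurable_fun [set: Y] D.
  exact: (measurableT_comp (fine_measurable measurableT) mDe).
have lD : locint D.
  split=> // l.
  (* For y in the cube of size l, the slice of psi is supported in the cube of size N, so D is
     dominated there by the line integral of a globally integrable cut-off. *)
  pose N := maxn l (maxn ka kg).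
  pose phi (v : V) := psi v * \1_(rV_cube N) v.
  have mI : measurable_fun [set: V] (\1_(rV_cube N) : V -> R).
    exact: measurable_indic (measurable_rV_cube N).
  have cut f b M : locint f -> bumpfun b -> (forall x, `|b x| <= M) ->
      (lam m.+1).-integrable setT
        (EFin \o (fun v => f v * (b (v ord0 i) * \1_(rV_cube N) v))).
    move=> [mf itf] bb bM.
    apply: (@integrable_cutoff R _ _ (lam m.+1) (rV_cube N) f _ M) => //.
    - exact: measurable_rV_cube.
    - by apply: measurable_funM => //; exact: mcoord.
    - move=> v; rewrite normrM (@le_trans _ _ (M * 1))//; last by rewrite mulr1.
      by apply: ler_pM => //; rewrite indicE; case: (_ \in _); rewrite ?normr1// normr0.
    - by move=> v nv; rewrite indicE memNset// mulr0.
  have iphi : (lam m.+1).-integrable setT (EFin \o phi).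
    have := integrableB measurableT (cut u g Mg lu bg gM) (cut h al Ma lh bal alM).
    by apply: eq_integrable => // v _ /=; rewrite -EFinB /phi /psi; congr EFin; ring.
  have mphi := measurable_int _ (integrable_rV_ins iphi).
  apply/integrableP; split.
    by apply/measurable_EFinP; exact: measurable_funTS.
  apply: le_lt_trans ((integrable21ltyP leb (lam m) mphi).1 (integrable_rV_ins iphi)).
  have mG : measurable_fun [set: Y] (fun y => \int[leb]_x `|(EFin \o phi \o ins) (x, y)|)%E.
    apply: (@measurable_param_integral R _ _ _ _ leb
      (abse \o (EFin \o phi \o ins))).
    exact: measurableT_comp.
  apply: (@le_trans _ _ (\int[lam m]_(y in rV_cube l)
      \int[leb]_x `|(EFin \o phi \o ins) (x, y)|)%E); last first.
    apply: ge0_subset_integral => //.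
    - exact: measurable_rV_cube.
    - by move=> y _; exact: integral_ge0.
  apply: ge0_le_integral => //.
  - exact: measurable_rV_cube.
  - by apply: measurableT_comp => //; apply/measurable_EFinP; exact: measurable_funTS.
  - exact: measurable_funTS.
  move=> y ly; rewrite /= /D.
  apply: (@le_trans _ _ `|\int[leb]_x (psi (ins (x, y)))%:E|)%E.
    by rewrite /Rintegral; case: (\int[leb]_x (psi (ins (x, y)))%:E)%E => [r| |]//=;
      rewrite leey.
  have psiphi x : psi (ins (x, y)) = phi (ins (x, y)).
    rewrite /phi indicE; have [xN|xN] := ltP `|x| N%:R.
      rewrite mem_set ?mulr1//; apply/rV_cube_ins; split => //.
      exact: sub_rV_cube (leq_maxl _ _) _ ly.
    rewrite /psi rV_ins_eq /= al0 ?g0 ?mulr0 ?subrr ?mul0r//.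
    + by rewrite (le_trans _ xN)// ler_nat /N !leq_max leqnn !orbT.
    + by rewrite (le_trans _ xN)// ler_nat /N !leq_max leqnn !orbT.
  under eq_integral do rewrite psiphi.
  apply: le_abse_integral => //.
  exact: (measurableT_comp mphi (pair2_measurable y)).
have D0 : {ae lam m, forall y, D y = 0}.
  apply: du_bois_reymond => // be bbe.
  have iu := locint_prod_bump lu (bump_ins_fun bg bbe).
  have ih := locint_prod_bump lh (bump_ins_fun bal bbe).
  have iPhi := integrableB measurableT iu ih.
  have := integral21_prod_meas1 (integrable_rV_ins iPhi).
  rewrite [RHS](_ : _ = 0%E); last first.
    rewrite -[LHS](integral_rV_ins i (measurable_int _ iPhi)).
    by rewrite integralB//= W// subee// integrable_fin_num.
  rewrite /fubini_G/= => <-; apply: ae_eq_integral => //.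
  - apply/measurable_EFinP; apply: measurable_funM => //.
    by apply: measurable_prod_coord => j; have [] := bbe j.
  - have mPhi := measurableT_comp (measurable_int _ iPhi) (measurable_rV_ins i).
    exact: (@measurable_param_integral R _ _ _ _ leb _ mPhi).
  - apply: filterS DE => y [ipsi _] _ /=.
    rewrite EFinM /D /Rintegral fineK; last exact: integrable_fin_num.
    rewrite -integralZr//; apply: eq_integral => x _ /=.
    by rewrite !prod_ins_fun -EFinB /psi rV_ins_eq; congr EFin; ring.
apply: filterS2 D0 DE => y D0 [_ DE].
by apply/eqP; rewrite -subr_eq0 -DE D0.
Qed.

End sections.

(** * Primitives on the line and bumps of mean zero *)

Section primitives.
Context {R : realType}.
Local Notation leb := (@lebesgue_measure R).
Implicit Types f g h u : R -> R.

Lemma locint1_itv f a b : locint1 f -> leb.-integrable `[a, b] (EFin \o f).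
Proof.
move=> [_ fk]; pose k := (Num.truncn (Num.max `|a| `|b|)).+1.
apply: (integrableS _ _ _ (fk k)) => // x /=; rewrite !in_itv/= => /andP[ax xb].
have : Num.max `|a| `|b| < k%:R by exact: truncnS_gt.
rewrite gt_max => /andP[ak bk]; rewrite -ltr_norml ltr_norml.
apply/andP; split; last by rewrite (le_lt_trans xb)// (le_lt_trans (ler_norm _)).
by rewrite (lt_le_trans _ ax)// ltrNl (le_lt_trans (ler_norm _))// normrN.
Qed.

Lemma Rintegral_chasles f a x b : locint1 f -> a <= x -> x <= b ->
  \int[leb]_(t in `[a, b]) f t =
  \int[leb]_(t in `[a, x]) f t + \int[leb]_(t in `[x, b]) f t.
Proof.
move=> lf ax xb; apply/eqP; rewrite addrC -subr_eq; apply/eqP.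
rewrite (Rintegral_itvB (locint1_itv a b lf))//; apply: Rintegral_itv_obnd_cbnd.
apply: (integrableS _ _ _ (locint1_itv a b lf)) => // y /=.
by rewrite !in_itv/= => /andP[xy ->]; rewrite (le_trans ax)// ltW.
Qed.

Lemma Rintegral_itv_ge f a b : b <= a -> \int[leb]_(t in `[a, b]) f t = 0.
Proof.
rewrite le_eqVlt => /predU1P[->|ba]; first by rewrite set_itv1 Rintegral_set1.
by rewrite set_itv_ge ?Rintegral_set0// bnd_simp -ltNge.
Qed.

(** The oriented integral from 0 to x: one of the two terms always vanishes. *)
Definition prim f x : R := \int[leb]_(t in `[0, x]) f t - \int[leb]_(t in `[x, 0]) f t.

Lemma prim_base f a x : locint1 f -> a <= x -> a <= 0 ->
  prim f x = \int[leb]_(t in `[a, x]) f t - \int[leb]_(t in `[a, 0]) f t.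
Proof.
move=> lf ax a0; rewrite /prim; have [x0|x0] := leP 0 x.
  rewrite (Rintegral_itv_ge _ x0) subr0.
  by rewrite (@Rintegral_chasles f a 0 x)// addrAC subrr add0r.
rewrite (Rintegral_itv_ge _ (ltW x0)).
by rewrite (@Rintegral_chasles f a x 0)// ?(ltW x0)// opprD addrA subrr.
Qed.

Lemma primB f a b : locint1 f -> a <= b ->
  prim f b - prim f a = \int[leb]_(t in `[a, b]) f t.
Proof.
move=> lf ab; pose c := Num.min a 0.
have ca : c <= a by rewrite ge_min lexx.
have c0 : c <= 0 by rewrite ge_min lexx orbT.
rewrite (prim_base lf (le_trans ca ab) c0) (prim_base lf ca c0).
by rewrite (Rintegral_chasles lf ca ab); ring.
Qed.

Lemma bump_measurable f : bumpfun f -> measurable_fun [set: measurableTypeR R] f.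
Proof.
by move=> [sf _]; apply: continuous_measurable_fun; exact: smooth1_continuous.
Qed.

Lemma bump_integrable f : bumpfun f -> leb.-integrable setT (EFin \o f).
Proof.
move=> bf; have l1 : locint1 (fun=> 1 : R).
  split; first exact: measurable_cst.
  move=> k; apply: measurable_bounded_integrable => //=.
    by rewrite lebesgue_measure_itv/=; case: ifP; rewrite ?ltry.
  by exists 1; split => // M M1 x _; rewrite normr1 ltW.
have := locint1_bump l1 bf; apply: eq_integrable => // x _ /=.
by rewrite mul1r.
Qed.

(** The primitive starting at minus infinity vanishes to the left of the support of g, and the zero
    mean makes it vanish to the right as well. *)
Lemma bump_prim g : bumpfun g -> \int[leb]_x g x = 0 ->
  exists2 al, bumpfun al & forall x : R, is_derive x (1 : R) al (g x).
Proof.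
move=> bg g0; have [sg [k hk]] := bg.
have ig := bump_integrable bg.
pose al x := \int[leb]_(t in `]-oo, x]) g t.
have dal (x : R) : is_derive x (1 : R) al (g x).
  have [] := @continuous_FTC1 R g -oo%O x (x + 1).
  - by rewrite ltrDl.
  - exact: integrableS ig.
  - by rewrite ltNyr.
  - exact: smooth1_continuous.
  by move=> d1 e; split; [exact: d1|rewrite -derive1E; exact: e].
exists al => //; split; first exact: smooth1_prim sg dal.
exists k => x; rewrite ler_normr => /orP[kx|kx].
  rewrite /al -g0 Rintegral_mkcond; apply: eq_Rintegral => y _.
  rewrite patchE; case: ifPn => //; rewrite notin_setE/= in_itv/= => /negP.
  rewrite -ltNge => xy; rewrite hk// (le_trans kx)//.
  by rewrite (le_trans (ltW xy))// ler_norm.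
rewrite /al Rintegral_mkcond [RHS](_ : _ = \int[leb]_y (cst 0 : R -> R) y); last first.
  by rewrite /Rintegral integral0.
apply: eq_Rintegral => y _; rewrite patchE; case: ifPn => //.
rewrite inE/= in_itv/= => yx; apply: hk; rewrite (le_trans kx)//.
by rewrite -normrN (le_trans _ (ler_norm _))// lerN2.
Qed.

(** With index 0 the ramps have width 1, so this bump equals 1 on [1, 2] and its mass is
    positive. *)
Definition bump0 : R -> R := plateau 0 3 0.
Definition mass0 : R := \int[leb]_x bump0 x.

Lemma mass0_gt0 : 0 < mass0.
Proof.
have ib := bump_integrable (bump_plateau 0 3 0 : bumpfun bump0).
apply: (@lt_le_trans _ _ (\int[leb]_x (\1_`[1, 2] x : R))).
  have L : (@lebesgue_measure R `[1%R, 2%R]%classic = 1%:E)%E.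
    rewrite lebesgue_measure_itv/= lte_fin ltr1n /= -EFinB; congr EFin; lra.
  rewrite /Rintegral integral_indic// setIT [ltRHS](_ : _ = 1)//.
  exact: (congr1 fine L).
apply: le_Rintegral => //.
  exact: integrable_indic_itv.
move=> x _; rewrite indicE; case: (boolP (x \in _)) => [|_]; last first.
  by have /andP[] := plateau_itv 0 3 0 x.
rewrite inE/= in_itv/= => /andP[x1 x2].
by rewrite /bump0 /plateau !step1_ge1 ?mulr1//; lra.
Qed.

(* The multiple of [bump0] makes the integral vanish, so that a primitive is
   again compactly supported. *)
Definition zero_bump (a b : R) (j : nat) (x : R) : R :=
  mass0 * plateau a b j x - (\int[leb]_t plateau a b j t) * bump0 x.

Lemma bump_lincomb f g (a b : R) : bumpfun f -> bumpfun g ->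
  bumpfun (fun x => a * f x - b * g x).
Proof.
move=> [sf [k hk]] [sg [l hl]]; split.
  rewrite (_ : (fun _ => _) = (fun x => a * f x + (- b) * g x)).
    by apply: smooth1D; apply: smooth1M => //; exact: smooth1_cst.
  by apply/funext => x; rewrite mulNr.
exists (maxn k l) => x klx; rewrite hk ?hl ?mulr0 ?subrr//.
  by rewrite (le_trans _ klx)// ler_nat leq_maxr.
by rewrite (le_trans _ klx)// ler_nat leq_maxl.
Qed.

Lemma bump_zero_bump a b j : bumpfun (zero_bump a b j).
Proof. by apply: bump_lincomb; exact: bump_plateau. Qed.

Lemma integral_zero_bump a b j : \int[leb]_x zero_bump a b j x = 0.
Proof.
have i1 := bump_integrable (bump_plateau a b j).
have i0 := bump_integrable (bump_plateau 0 3 0 : bumpfun bump0).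
rewrite /zero_bump RintegralB//; last 2 first.
- by have := integrableZl measurableT mass0 i1; apply: eq_integrable.
- by have := integrableZl measurableT (\int[leb]_t plateau a b j t) i0; apply: eq_integrable.
by rewrite !RintegralZl// -/mass0 mulrC subrr.
Qed.

End primitives.

(** * Integration by parts against a primitive *)

Section acl1.
Context {R : realType}.
Local Notation leb := (@lebesgue_measure R).
Implicit Types f g h u : R -> R.

Lemma continuous_prim h : locint1 h -> continuous (prim h).
Proof.
move=> lh x; pose k := `|x| + 1.
have xk : `|x| < k by rewrite ltrDl.
have k0 : 0 <= k by rewrite addr_ge0.
have kk : - k < k by rewrite (lt_trans (y := `|x|))// (lt_le_trans (y := 0))// oppr_lt0 ltr_pwDr.
have xin : x \in `]- k, k[ by rewrite in_itv/= -ltr_norml.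
have hc := parameterized_integral_continuous (ltW kk) (locint1_itv (- k) k lh).
have ct := within_continuous_continuous kk hc xin.
have pE y : - k <= y ->
    parameterized_integral leb (- k) y h + prim h (- k) = prim h y.
  by move=> ky; rewrite /parameterized_integral -(primB lh ky) subrK.
have H : parameterized_integral leb (- k) y h + prim h (- k) @[y --> x] -->
    parameterized_integral leb (- k) x h + prim h (- k).
  by apply: cvgD => //; exact: cvg_cst.
have /andP[kx _] : - k < x < k by rewrite -ltr_norml.
rewrite pE ?ltW// in H; apply: cvg_trans H; apply: near_eq_cvg; near=> y.
by rewrite pE// ltW//; near: y; exact: lt_nbhsr.
Unshelve. all: by end_near. Qed.

Lemma locint1_continuous f : continuous f -> locint1 f.
Proof.
move=> cf; split; first exact: continuous_measurable_fun.
move=> k; have ik : leb.-integrable `[- k%:R, k%:R] (EFin \o f).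
  apply: continuous_compact_integrable; first exact: segment_compact.
  exact: continuous_subspaceT.
by apply: (integrableS _ _ _ ik) => //; exact: subset_itv_oo_cc.
Qed.

Lemma integral_EFin_Rintegral d (T : measurableType d) (mu : {measure set T -> \bar R})
    D (f : T -> R) : measurable D -> mu.-integrable D (EFin \o f) ->
  (\int[mu]_(x in D) (f x)%:E = (\int[mu]_(x in D) f x)%:E)%E.
Proof. by move=> mD fi; rewrite /Rintegral fineK//; exact: integrable_fin_num. Qed.

Lemma integral_indicr d (T : measurableType d) (mu : {measure set T -> \bar R})
    D (f : T -> R) :
  (\int[mu]_x (f x * \1_D x)%:E = \int[mu]_(x in D) (f x)%:E)%E.
Proof.
rewrite [RHS]integral_mkcond; apply: eq_integral => x _.
by rewrite patchE indicE; case: ifPn => _; rewrite ?mulr1// mulr0.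
Qed.

Lemma mem_itvcc (a b x : R) : (x \in `[a, b]%classic) = (a <= x <= b).
Proof. by apply/idP/idP; rewrite inE/= in_itv. Qed.

Lemma bump_FTC al g (k : nat) : bumpfun g ->
  (forall x : R, is_derive x (1 : R) al (g x)) ->
  (forall x, k%:R <= `|x| -> al x = 0) ->
  forall t, t <= k%:R -> \int[leb]_(x in `[t, k%:R]) g x = - al t.
Proof.
move=> bg dal al0 t; rewrite le_eqVlt => /predU1P[->|tk].
  by rewrite set_itv1 Rintegral_set1 al0 ?oppr0// ger0_norm.
have cg : {within `[t, k%:R], continuous g}.
  by apply: continuous_subspaceT; apply: smooth1_continuous; case: bg.
have cal : continuous al.
  by move=> x; apply/differentiable_continuous/derivable1_diffP; case: (dal x).
have := @continuous_FTC2 R g al t k%:R tk cg.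
rewrite /Rintegral => -> /=.
- by rewrite (al0 k%:R) ?sub0r// ger0_norm.
- split.
  + by move=> x _; case: (dal x).
  + by apply: cvg_at_right_filter; exact: cal.
  + by apply: cvg_at_left_filter; exact: cal.
- by move=> x _; rewrite derive1E; case: (dal x).
Qed.

(** Integration by parts through Fubini on the triangle t <= x, since [prim h] need not be
    differentiable everywhere. Integrating g(x) h(t) first in t gives g times an increment of
    [prim h], and first in x gives -h(t) al(t). The constant [prim h (- K)] disappears because g has
    mean zero. *)
Lemma prim_parts h al g : locint1 h -> bumpfun al -> bumpfun g ->
  (forall x : R, is_derive x (1 : R) al (g x)) ->
  \int[leb]_x (prim h x * g x) = - \int[leb]_x (h x * al x).
Proof.
move=> lh bal bg dal; have [mh ith] := lh.
have [_ [ka hka]] := bal; have [_ [kg hkg]] := bg.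
pose k := maxn ka kg; pose K : R := k%:R.
have al0 x : K <= `|x| -> al x = 0.
  by move=> Kx; rewrite hka// (le_trans _ Kx)// ler_nat leq_maxl.
have g0 x : K <= `|x| -> g x = 0.
  by move=> Kx; rewrite hkg// (le_trans _ Kx)// ler_nat leq_maxr.
have K0 : 0 <= K by exact: ler0n.
have KK : - K <= K by rewrite (le_trans _ K0)// oppr_le0.
pose hK t := h t * \1_(`[- K, K]) t.
pose Phi (z : R * R) := (g z.1 * hK z.2) * \1_([set z : R * R | z.2 <= z.1]) z.
have mg := bump_measurable bg.
have mI : measurable (`[- K, K]%classic : set (measurableTypeR R)) by [].
have mhK : measurable_fun [set: measurableTypeR R] hK.
  by apply: measurable_funM => //; exact: measurable_indic.
have ihK : leb.-integrable setT (EFin \o hK).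
  apply: (@integrable_cutoff R _ _ leb `[- K, K] h _ 1) => //.
  - by move=> x; rewrite indicE; case: (_ \in _); rewrite ?normr1// normr0.
  - by move=> x nx; rewrite indicE memNset.
  - exact: locint1_itv.
have igh : (leb \x leb)%E.-integrable setT (EFin \o (fun z => g z.1 * hK z.2)).
  apply/integrable12ltyP.
    apply/measurable_EFinP; apply: measurable_funM.
      exact: (measurableT_comp mg measurable_fst).
    exact: (measurableT_comp mhK measurable_snd).
  have [_ hoo] := integrableP _ _ _ ihK.
  have [_ goo] := integrableP _ _ _ (bump_integrable bg).
  under eq_integral => x _.
    under eq_integral => t _ do rewrite /= normrM EFinM.
    rewrite ge0_integralZl//; last by apply/measurable_EFinP; exact: measurableT_comp.
    over.
  rewrite ge0_integralZr//=; last 2 first.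
    by apply/measurable_EFinP; exact: measurableT_comp.
    exact: integral_ge0.
  apply: lte_mul_pinfty => //; first exact: integral_ge0.
  by rewrite ge0_fin_numE//; exact: integral_ge0.
have iPhi : (leb \x leb)%E.-integrable setT (EFin \o Phi).
  apply: (@integrable_cutoff R _ _ (leb \x leb)%E setT
    (fun z => g z.1 * hK z.2) _ 1) => //.
  - apply: measurable_funM.
      exact: (measurableT_comp mg measurable_fst).
    exact: (measurableT_comp mhK measurable_snd).
  - apply: measurable_indic.
    have := @measurable_fun_le _ (measurableTypeR R * measurableTypeR R)%type R setT
      snd fst measurableT measurable_snd measurable_fst.
    by rewrite setTI.
  - by move=> x; rewrite indicE; case: (_ \in _); rewrite ?normr1// normr0.
  - by move=> z /(_ I).
have Eg : \int[leb]_x g x = 0.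
  have := bump_FTC bg dal al0 KK; rewrite al0 ?normrN ?ger0_norm// oppr0 => <-.
  rewrite [RHS]Rintegral_mkcond; apply: eq_Rintegral => x _; rewrite patchE.
  case: ifPn => //; rewrite notin_setE/= in_itv/= -ler_norml => /negP.
  by rewrite -ltNge => /ltW /g0.
have L x : (\int[leb]_t (Phi (x, t))%:E = (g x * (prim h x - prim h (- K)))%:E)%E.
  have [xK|Kx] := ltP `|x| K; last first.
    rewrite g0// mul0r; under eq_integral do rewrite /Phi /= g0// !mul0r.
    by rewrite integral0.
  have /andP[Kx1 xK1] : - K < x < K by rewrite -ltr_norml.
  rewrite primB ?(ltW Kx1)// EFinM -integral_EFin_Rintegral//; last exact: locint1_itv.
  rewrite -integral_indicr -integralZl//; last first.
    apply: (@integrable_cutoff R _ _ leb `[- K, x] h _ 1) => //.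
    + by move=> y; rewrite indicE; case: (_ \in _); rewrite ?normr1// normr0.
    + by move=> y nx; rewrite indicE memNset.
    + exact: locint1_itv.
  apply: eq_integral => t _; rewrite -EFinM /Phi /hK /= -!mulrA; congr (_ * (_ * _))%:E.
  rewrite !indicE -natrM mulnb; congr (nat_of_bool _)%:R.
  rewrite !mem_itvcc (_ : (x, t) \in _ = (t <= x)); last by apply/idP/idP; rewrite inE.
  rewrite -andbA; congr (_ && _).
  case tx : (t <= x); rewrite ?andbF// andbT.
  exact: le_trans tx (ltW xK1).
have M t : (\int[leb]_x (Phi (x, t))%:E = (- (h t * al t))%:E)%E.
  have [tK|Kt] := leP `|t| K; last first.
    rewrite al0 ?(ltW Kt)// mulr0 oppr0.
    have hK0 : hK t = 0 by rewrite /hK indicE mem_itvcc -ler_norml leNgt Kt mulr0.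
    under eq_integral do rewrite /Phi /= hK0 mulr0 mul0r.
    by rewrite integral0.
  have /andP[Kt1 tK1] : - K <= t <= K by rewrite -ler_norml.
  rewrite -mulrN -(bump_FTC bg dal al0 tK1) EFinM.
  have lg : locint1 g by apply: locint1_continuous; apply: smooth1_continuous; case: bg.
  rewrite -integral_EFin_Rintegral//; last exact: locint1_itv.
  rewrite -integral_indicr -integralZl//; last first.
    apply: (@integrable_cutoff R _ _ leb `[t, K] g _ 1) => //.
    + by move=> y; rewrite indicE; case: (_ \in _); rewrite ?normr1// normr0.
    + by move=> y nx; rewrite indicE memNset.
    + exact: locint1_itv.
  apply: eq_integral => x _; rewrite -EFinM /Phi /hK /=; congr EFin.
  rewrite (_ : \1_`[- K, K] t = 1) ?mulr1; last first.
    by rewrite indicE mem_itvcc Kt1 tK1.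
  have [xK|Kx] := leP K `|x|; first by rewrite g0// !mul0r mulr0.
  rewrite mulrAC mulrC; congr (_ * (_ * _)); rewrite !indicE; congr (nat_of_bool _)%:R.
  have /andP[_ xK1] : - K < x < K by rewrite -ltr_norml.
  by rewrite mem_itvcc (ltW xK1) andbT; apply/idP/idP; rewrite inE.
have := Fubini iPhi.
under eq_integral do rewrite /= L.
under [X in _ = X -> _]eq_integral do rewrite /= M.
have lp : locint1 (prim h) by apply: locint1_continuous; exact: continuous_prim.
have i1 := locint1_bump lp bg.
have i2 : leb.-integrable setT (EFin \o (fun x => prim h (- K) * g x)).
  by have := integrableZl measurableT (prim h (- K)) (bump_integrable bg); apply: eq_integrable.
have i3 := locint1_bump lh bal.
move=> /(congr1 fine); rewrite -!/(Rintegral _ _ _) => E.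
transitivity (\int[leb]_x (g x * (prim h x - prim h (- K)))).
  under [RHS]eq_Rintegral do rewrite mulrBr mulrC (mulrC (g _) (prim h (- K))).
  by rewrite RintegralB// RintegralZl ?Eg ?mulr0 ?subr0//; exact: bump_integrable.
rewrite E; under eq_Rintegral do rewrite -mulN1r.
by rewrite RintegralZl// mulN1r.
Qed.

End acl1.

(** * Functions with a weak derivative on the line *)

Section acl1_main.
Context {R : realType}.
Local Notation leb := (@lebesgue_measure R).
Implicit Types f g h u : R -> R.

Lemma continuous_rat_eq0 (f : R -> R) : continuous f ->
  (forall r : rat, f (ratr r) = 0) -> forall x, f x = 0.
Proof.
move=> cf f0 x; apply/eqP; apply: contrapT => /negP fx.
have [e /= e0 H] := cf x _ (open_nbhs_nbhs (conj (@open_neq R 0) fx)).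
have xe : x < x + e by rewrite ltrDl.
have [r] := rat_in_itvoo xe.
rewrite in_itv/= => /andP[xr re].
suff : f (ratr r) != 0 by rewrite f0 eqxx.
by apply: H; rewrite /ball_/= distrC gtr0_norm ?subr_gt0// ltrBlDl.
Qed.

Lemma locint1_locally f : locint1 f -> locally_integrable setT f.
Proof.
move=> lf; have [mf itf] := lf; split => //; first exact: openT.
move=> K _ cK; have [M [_ hM]] := compact_bounded cK.
pose k := (Num.truncn M).+1.
have KK : K `<=` `]- k.+1%:R, k.+1%:R[.
  move=> x Kx; apply/itv_norm; rewrite (@le_lt_trans _ _ k%:R) ?ltr_nat//.
  exact: (hM _ (truncnS_gt M) x Kx).
have mK : measurable (K : set (measurableTypeR R)) by exact: compact_measurable.
have /integrableP[_] : leb.-integrable K (EFin \o f).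
  by apply: (integrableS _ mK KK (itf k.+1)).
by [].
Qed.

Lemma locint1D f g : locint1 f -> locint1 g -> locint1 (fun x => f x + g x).
Proof.
move=> [mf itf] [mg itg]; split; first exact: measurable_funD.
move=> k; have mI : measurable (`]- k%:R, k%:R[%classic : set (measurableTypeR R)) by [].
by have := integrableD mI (itf k) (itg k); apply: eq_integrable.
Qed.

(** The primitive vanishes at the rationals, hence everywhere by continuity, and Lebesgue's
    differentiation theorem recovers f from it. *)
Lemma locint1_ae0 f : locint1 f ->
  (forall a b : rat, \int[leb]_(x in `]ratr a, ratr b[) f x = 0) ->
  {ae leb, forall x, f x = 0}.
Proof.
move=> lf f0.
have prim0 : forall x, prim f x = 0.
  apply: continuous_rat_eq0; first exact: continuous_prim.
  move=> r.
  have H (a b : rat) : \int[leb]_(x in `[ratr a, ratr b]) f x = 0.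
    rewrite -(f0 a b) /Rintegral; congr fine; apply: integral_itv_bndoo.
    by apply/measurable_EFinP; apply: measurable_funTS; case: lf.
  have := H 0 r; have := H r 0; rewrite !rmorph0 /prim => -> ->.
  by rewrite subrr.
have F0 k x : \int[leb]_(t in `[- (k%:R : R), x]) f t = 0.
  have [kx|xk] := leP (- (k%:R : R)) x; first by rewrite -(primB lf kx) !prim0 subrr.
  by rewrite Rintegral_itv_ge// ltW.
have H k : {ae leb, forall x, - (k%:R : R) < x -> f x = 0}.
  have := @FTC1 R f (BLeft (- k%:R)) (fun y => locint1_itv _ y lf) (locint1_locally lf).
  apply: filterS; first exact: (ae_filter_ringOfSetsType leb).
  move=> x h kx; have [] := h _; first by rewrite lte_fin.
  move=> _ <-; rewrite derive1E.
  rewrite (_ : (fun _ => _) = cst 0); first exact: derive_cst.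
  by apply/funext => y; exact: F0.
have : {ae leb, forall x (k : nat), - (k%:R : R) < x -> f x = 0}.
  exact: ae_foralln.
apply: filterS; first exact: (ae_filter_ringOfSetsType leb).
move=> x h.
apply: (h (Num.truncn `|x|).+1).
by rewrite ltrNl (le_lt_trans _ (truncnS_gt _))// -normrN ler_norm.
Qed.

(** By parts, u + [prim h] pairs to zero with every mean-zero bump, so it is constant. Only rational
    endpoints and integer steepness are demanded, so that almost every line satisfies the hypothesis
    for all of these bumps at once. *)
Lemma acl1 u h : locint1 u -> locint1 h ->
  (forall (a b : rat) j, exists al, [/\ bumpfun al,
     forall x : R, is_derive x (1 : R) al (zero_bump (ratr a) (ratr b) j x) &
     \int[leb]_x (u x * zero_bump (ratr a) (ratr b) j x) = \int[leb]_x (h x * al x)]) ->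
  exists c, {ae leb, forall x, u x = c - prim h x}.
Proof.
move=> lu lh W.
have lp : locint1 (prim h) by apply: locint1_continuous; exact: continuous_prim.
pose gg x := u x + prim h x; have lgg : locint1 gg by exact: locint1D.
have b0 : bumpfun (@bump0 R) by exact: (bump_plateau 0 3 0).
(* The constant for which gg - c pairs to zero with [bump0]; a plateau being a multiple of a
   [zero_bump] plus a multiple of [bump0], it then pairs to zero with all of them. *)
pose c := (\int[leb]_x (gg x * bump0 x)) / mass0; exists c.
pose w x := gg x + - c.
have lw : locint1 w.
  by apply: locint1D => //; apply: locint1_continuous => x; exact: cvg_cst.
suff : {ae leb, forall x, w x = 0}.
  apply: filterS; first exact: (ae_filter_ringOfSetsType leb).
  move=> x /eqP; rewrite /w /gg addr_eq0 opprK => /eqP <-.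
  by rewrite addrK.
apply: locint1_ae0 => // a b.
have w0 j : \int[leb]_x (w x * plateau (ratr a) (ratr b) j x) = 0.
  set eta := plateau _ _ _; have beta : bumpfun eta by exact: bump_plateau.
  have ie := bump_integrable beta.
  have ige := locint1_bump lgg beta.
  have igb := locint1_bump lgg b0.
  have [al [bal dal E]] := W a b j.
  have bz := bump_zero_bump (ratr a) (ratr b : R) j.
  have Z : \int[leb]_x (gg x * zero_bump (ratr a) (ratr b) j x) = 0.
    under eq_Rintegral do rewrite mulrDl.
    rewrite RintegralD//; last 2 first.
    - exact: locint1_bump.
    - exact: locint1_bump.
    by rewrite E (prim_parts lh bal bz dal) subrr.
  have Z' : mass0 * \int[leb]_x (gg x * eta x) -
      (\int[leb]_x eta x) * \int[leb]_x (gg x * bump0 x) = 0.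
    have i1 : leb.-integrable setT (EFin \o (fun x => mass0 * (gg x * eta x))).
      by have := integrableZl measurableT mass0 ige; apply: eq_integrable.
    have i2 : leb.-integrable setT
        (EFin \o (fun x => (\int[leb]_x eta x) * (gg x * bump0 x))).
      by have := integrableZl measurableT (\int[leb]_x eta x) igb; apply: eq_integrable.
    rewrite -Z; transitivity (\int[leb]_x
        (mass0 * (gg x * eta x) - (\int[leb]_x eta x) * (gg x * bump0 x))).
      by rewrite (RintegralB measurableT i1 i2) (RintegralZl _ measurableT ige)
        (RintegralZl _ measurableT igb).
    by apply: eq_Rintegral => x _; rewrite /zero_bump -/eta; ring.
  under eq_Rintegral do rewrite mulrDl mulNr.
  rewrite RintegralB//; last by have := integrableZl measurableT c ie; apply: eq_integrable.
  have m0 : mass0 != 0 :> R by rewrite gt_eqF// mass0_gt0.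
  rewrite RintegralZl//; apply: (mulfI m0); rewrite mulr0 -Z' /c.
  set A := Rintegral _ _ _; set B := Rintegral _ _ _; set E' := Rintegral _ _ _.
  by field.
have mw : measurable_fun [set: measurableTypeR R] w by case: lw.
pose f_ j : measurableTypeR R -> \bar R := EFin \o (fun x => w x * plateau (ratr a) (ratr b) j x).
have ib : leb.-integrable `]ratr a, ratr b[ (EFin \o w).
  by apply: (integrableS _ _ _ (locint1_itv (ratr a) (ratr b) lw)) => //; exact: subset_itv_oo_cc.
have mI : measurable (`]ratr a, ratr b[%classic : set (measurableTypeR R)) by [].
have iw : leb.-integrable setT ((EFin \o w) \_ `]ratr a, ratr b[).
  exact/(integrable_mkcond _ mI).
have := @dominated_convergence _ _ R leb setT measurableT f_
  ((EFin \o w) \_ `]ratr a, ratr b[) (abse \o ((EFin \o w) \_ `]ratr a, ratr b[)).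
case.
- move=> j; apply/measurable_EFinP; apply: measurable_funM => //.
  exact: bump_measurable (bump_plateau _ _ _).
- exact: measurable_int iw.
- apply: aeW => x _.
  have -> : ((EFin \o w) \_ `]ratr a, ratr b[) x =
      (w x * \1_(`]ratr a, ratr b[%classic : set R) x)%:E.
    by rewrite patchE indicE; case: ifPn => _; rewrite ?mulr1// mulr0.
  apply: cvg_EFin; first exact: nearW.
  by apply: cvgM; [exact: cvg_cst|exact: cvg_plateau].
- exact: integrable_abse.
- apply: aeW => x j _; rewrite [X in (_ <= X)%E]/= patchE.
  have [bx|bx] := pselect (`]ratr a, ratr b[%classic x); last first.
    by rewrite /f_ /= plateau_out// mulr0 normr0 abse_ge0.
  rewrite mem_set//= lee_fin normrM ler_piMr//.
  by have /andP[p0 p1] := plateau_itv (ratr a) (ratr b) j x; rewrite ger0_norm.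
move=> _ _; rewrite -integral_mkcond => hcv.
have e : (\int[leb]_(x in `]ratr a, ratr b[) (EFin \o w) x = 0)%E.
  rewrite -(cvg_lim _ hcv)//; apply: lim_near_cst => //; apply: nearW => j.
  rewrite [LHS](@integral_EFin_Rintegral R) ?w0//.
  by apply: locint1_bump => //; exact: bump_plateau.
by rewrite /Rintegral e.
Qed.

End acl1_main.

(** * Absolute continuity on almost every line *)

Section acl_rV.
Context {R : realType} (m : nat) (i : 'I_m.+1).
Local Notation leb := (@lebesgue_measure R).
Local Notation lam := (@lebesgue_rV R).
Local Notation V := 'rV[R]_m.+1.
Local Notation Y := 'rV[R]_m.
Local Notation ins := (@rV_ins R m i).

(* [h] is minus the weak derivative of [u] in direction [i]. *)
Definition weak_deriv (u h : V -> R) :=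
  forall (al : 'I_m.+1 -> R -> R) (g : R -> R), (forall k, bumpfun (al k)) ->
    bumpfun g -> (forall x : R, is_derive x (1 : R) (al i) (g x)) ->
  (\int[lam m.+1]_v (u v * \prod_k (if k == i then g else al k) (v ord0 k))%:E =
   \int[lam m.+1]_v (h v * \prod_k al k (v ord0 k))%:E)%E.

(** For each bump of the countable family the identity on slices holds off a null set of lines;
    discarding the union of these sets leaves lines on which the one-dimensional lemma applies. The
    minus sign comes from the convention for [h]. *)
Lemma acl_rV (u h : V -> R) : locint u -> locint h -> weak_deriv u h ->
  {ae lam m, forall y, locint1 (fun t => h (ins (t, y))) /\
    exists c, {ae leb, forall x,
      u (ins (x, y)) = c - prim (fun t => h (ins (t, y))) x}}.
Proof.
move=> lu lh W.
have W1 al g : bumpfun al -> bumpfun g ->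
    (forall x : R, is_derive x (1 : R) al (g x)) ->
    {ae lam m, forall y, \int[leb]_x (u (ins (x, y)) * g x) =
                         \int[leb]_x (h (ins (x, y)) * al x)}.
  move=> bal bg dal; apply: weak_section => // be bbe.
  have dE (x : R) : is_derive x (1 : R) (ins_fun i al be i) (g x).
    by rewrite /ins_fun unlift_none.
  rewrite -(W (ins_fun i al be) g (bump_ins_fun i bal bbe) bg dE).
  apply: eq_integral => v _; congr (_ * _)%:E; apply: eq_bigr => k _.
  rewrite /ins_fun; case: (unliftP i k) => [j ->|->]; last by rewrite eqxx.
  by rewrite eq_sym (negbTE (neq_lift _ _)).
have al_ex (t : rat * rat * nat) : exists al, bumpfun al /\
    forall x : R, is_derive x (1 : R) al (zero_bump (ratr t.1.1) (ratr t.1.2) t.2 x).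
  have [al] := bump_prim (@bump_zero_bump R (ratr t.1.1) (ratr t.1.2) t.2)
    (integral_zero_bump _ _ _).
  by exists al.
have [al hal] := choice al_ex.
pose Q t y := \int[leb]_x (u (ins (x, y)) * zero_bump (ratr t.1.1) (ratr t.1.2) t.2 x) =
              \int[leb]_x (h (ins (x, y)) * al t x).
(* The family is enumerated by natural numbers through [unpickle], with a trivial condition at
   numbers that code nothing. *)
have HQ N : {ae lam m, forall y,
    if unpickle N is Some t then Q t y else True}.
  case: (unpickle N) => [t|]; last by apply: aeW.
  have [bal dal] := hal t.
  by apply: W1 => //; exact: bump_zero_bump.
have : {ae lam m, forall y N, if unpickle N is Some t then Q t y else True}.
  exact: ae_foralln.
move=> HQ'; apply: filterS3 HQ' (locint_section i lu) (locint_section i lh).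
move=> y hQ luy lhy; split => //; apply: acl1 => // a b j.
have [bal dal] := hal (a, b, j); exists (al (a, b, j)); split => //.
by have := hQ (pickle (a, b, j)); rewrite pickleK.
Qed.

End acl_rV.

(** * One-dimensional inequalities *)

Section chain_rule.
Context {R : realType}.
Local Notation leb := (@lebesgue_measure R).
Implicit Types f g h W H : R -> R.

(** Young's inequality for the conjugate exponents s/(s-1) and s. It also says that the graph of the
    power s lies above its tangent at y, and is used in that way for increments of powers and for
    Jensen's inequality. *)
Lemma young_powR (s x y : R) : 1 < s -> 0 <= x -> 0 <= y ->
  s * (y `^ (s - 1) * x) <= (s - 1) * y `^ s + x `^ s.
Proof.
move=> s1 x0 y0; have s0 : 0 < s by rewrite (lt_trans _ s1).
have s1' : 0 < s - 1 by rewrite subr_gt0.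
have pq : (s / (s - 1))^-1 + s^-1 = 1 by field; rewrite !gt_eqF.
have := conjugate_powR (powR_ge0 y (s - 1)) x0 (divr_gt0 s0 s1') s0 pq.
rewrite -powRrM mulrCA mulfV ?gt_eqF// mulr1.
rewrite -(ler_pM2l s0) => /le_trans; apply.
by rewrite le_eqVlt; apply/orP; left; apply/eqP; field; rewrite !gt_eqF.
Qed.

Lemma powR_lip (s x y : R) : 1 < s -> 0 <= x -> 0 <= y ->
  `|y `^ s - x `^ s| <= s * Num.max (x `^ (s - 1)) (y `^ (s - 1)) * `|y - x|.
Proof.
move=> s1; have s0 : 0 < s by rewrite (lt_trans _ s1).
have s1' : 0 < s - 1 by rewrite subr_gt0.
have H a b : 0 <= a -> a <= b ->
    `|b `^ s - a `^ s| <= s * b `^ (s - 1) * `|b - a|.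
  move=> a0 ab; have b0 := le_trans a0 ab.
  rewrite !ger0_norm ?subr_ge0//; last by apply: ge0_ler_powR => //; exact: ltW.
  have := young_powR s1 a0 b0; rewrite -(mulr_powRB1 b0 s0) -subr_ge0 => h.
  rewrite -subr_ge0; set c := b `^ (s - 1) in h *.
  by rewrite (_ : _ - _ = (s - 1) * (b * c) + a `^ s - s * (c * a))//; ring.
have M a b : 0 <= a -> a <= b -> a `^ (s - 1) <= b `^ (s - 1).
  move=> a0 ab; apply: ge0_ler_powR => //; first exact: ltW.
  by rewrite nnegrE (le_trans a0).
move=> x0 y0; have [xy|/ltW yx] := leP x y; first by rewrite (max_r (M _ _ x0 xy)) H.
by rewrite (max_l (M _ _ y0 yx)) distrC (distrC y) H.
Qed.

(** The exponent may be below 1, so zeros of W, where the power need not be differentiable, get an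
    argument of their own. *)
Lemma continuous_powR_comp (W : R -> R) (r : R) : 0 < r -> (forall x, 0 <= W x) ->
  continuous W -> continuous (fun x => W x `^ r).
Proof.
move=> r0 W0 cW x.
have := W0 x; rewrite le_eqVlt => /predU1P[Wx|Wx]; last first.
  have c2 : {for W x, continuous ((@powR R) ^~ r)}.
    apply/differentiable_continuous/derivable1_diffP.
    by apply: derivable_powR; rewrite in_itv/= Wx.
  exact: (continuous_comp (cW x) c2).
rewrite /continuous_at -Wx powR0 ?gt_eqF//.
apply/cvgr0Pnorm_lt => e e0.
have er : 0 < e `^ r^-1 by rewrite powR_gt0.
have := cW x; rewrite /continuous_at -Wx => /cvgr0Pnorm_lt /(_ _ er).
apply: filterS => y; rewrite !ger0_norm ?powR_ge0// => Wy.
rewrite -[ltRHS]powRr1 ?ltW// -(mulVf (lt0r_neq0 r0)) powRrM.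
by apply: gt0_ltr_powR => //; rewrite nnegrE// powR_ge0.
Qed.

Lemma segment_unif_continuous (G : R -> R) (a b e : R) : continuous G -> 0 < e ->
  exists2 d, 0 < d & forall x y, `[a, b]%classic x -> `|y - x| < d -> `|G y - G x| < e.
Proof.
move=> cG e0.
pose P (d x : R) := forall y, `|y - x| < d -> `|G y - G x| < e.
have e2 : 0 < e / 2 by rewrite divr_gt0.
have /compact_near_coveringP/(_ R (0^'+) P _) := @segment_compact R a b.
case=> [x _|r /= r0 h].
  have /cvgrPdist_lt/(_ _ e2)[r /= r0 h] := cG x.
  have r2 : 0 < r / 2 by rewrite divr_gt0.
  exists (ball x (r / 2), [set d | d < r / 2]) => /=.
    split; first exact: nbhsx_ballx.
    exact: nbhs_right_lt.
  move=> [x' d] /= [xx' dr] y yx'.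
  have xx'2 : `|x - x'| < r / 2 by [].
  have h1 : `|G x - G y| < e / 2.
    apply: h; rewrite /ball_/= (le_lt_trans (ler_distD x' _ _))//.
    rewrite (splitr r) ltrD// distrC; exact: lt_trans yx' dr.
  have h2 : `|G x - G x'| < e / 2.
    by apply: h; rewrite /ball_/= (lt_trans xx'2)// ltr_pdivrMr// ltr_pMr// ltr1n.
  rewrite (le_lt_trans (ler_distD (G x) _ _))// (splitr e) ltrD// distrC//.
exists (r / 2); first by rewrite divr_gt0.
move=> x y xab yx; apply: (h (r / 2)) => //=; last by rewrite divr_gt0.
by rewrite sub0r normrN ger0_norm ?divr_ge0 ?ltW// ltr_pdivrMr// ltr_pMr// ltr1n.
Qed.

End chain_rule.

Section line_inequalities.
Context {R : realType}.
Local Notation leb := (@lebesgue_measure R).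
Implicit Types f g h G W H : R -> R.

Lemma locint1M G H : continuous G -> locint1 H -> locint1 (fun x => G x * H x).
Proof.
move=> cG lH; have mG : measurable_fun [set: measurableTypeR R] G.
  exact: continuous_measurable_fun.
have [mH itH] := lH; split; first exact: measurable_funM.
move=> k; have kk : - (k%:R : R) <= k%:R by rewrite (le_trans (y := 0))// oppr_le0.
have cG' : {within `[- (k%:R : R), k%:R], continuous (fun x => `|G x|)}.
  apply: continuous_subspaceT => x.
  by apply: continuous_comp; [exact: cG|exact: norm_continuous].
have [c _ Gc] := @EVT_max R (fun x => `|G x|) (- k%:R) k%:R kk cG'.
apply: (@integrableMr _ _ R leb `]- k%:R, k%:R[%classic (measurable_itv _) G (EFin \o H)).
- exact: measurable_funTS.
- exists `|G c|; split => // M GM x /= xk; apply: le_trans (ltW GM).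
  by apply: Gc; exact: subset_itv_oo_cc.
- exact: itH.
Qed.

Lemma locint1Zl (c : R) H : locint1 H -> locint1 (fun x => c * H x).
Proof. by move=> lH; apply: (@locint1M (fun=> c)) => // x; exact: cvg_cst. Qed.

Lemma le_Rintegral_itv f g a b : locint1 f -> locint1 g ->
  (forall x, a <= x <= b -> f x <= g x) ->
  \int[leb]_(x in `[a, b]) f x <= \int[leb]_(x in `[a, b]) g x.
Proof.
move=> lf lg fg; have i1 := locint1_itv a b lf; have i2 := locint1_itv a b lg.
by apply: le_Rintegral => // x /=; rewrite in_itv/=; exact: fg.
Qed.

Variables (W H : R -> R).
Hypotheses (W0 : forall x, 0 <= W x) (cW : continuous W).
Hypotheses (H0 : forall x, 0 <= H x) (lH : locint1 H).
(** All that is kept of absolute continuity: H plays the role of a majorant of |W'|. The bound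
    passes to absolute values and truncations with the same H. *)
Hypothesis WH : forall x y, x <= y -> `|W y - W x| <= \int[leb]_(t in `[x, y]) H t.

Let Rintegral_H_ge0 a b : 0 <= \int[leb]_(t in `[a, b]) H t.
Proof. by apply: Rintegral_ge0. Qed.

(** The interval is cut into pieces on which W^(s-1) oscillates by less than e; on each of them the
    increment of W^s is at most s (max of W^(s-1)) times the integral of H. Summing leaves an error
    proportional to e. *)
Lemma powR_chain s a b : 1 < s -> a <= b ->
  `|W b `^ s - W a `^ s| <=
  s * \int[leb]_(t in `[a, b]) (W t `^ (s - 1) * H t).
Proof.
move=> s1 ab; have s0 : 0 < s by rewrite (lt_trans _ s1).
have s1' : 0 < s - 1 by rewrite subr_gt0.
pose G t := W t `^ (s - 1).
have G0 t : 0 <= G t by exact: powR_ge0.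
have cG : continuous G by exact: continuous_powR_comp.
have lGH := locint1M cG lH.
suff main e : 0 < e -> `|W b `^ s - W a `^ s| <=
    s * \int[leb]_(t in `[a, b]) (G t * H t) + s * e * \int[leb]_(t in `[a, b]) H t.
  apply/ler_addgt0Pr => e e0; set I := \int[leb]_(t in `[a, b]) H t.
  have I1 : 0 < s * (I + 1) by rewrite mulr_gt0// ltr_wpDl//; exact: Rintegral_H_ge0.
  (* The error term is s times the oscillation times I; adding 1 to I keeps the denominator positive
     when I = 0. *)
  apply: (le_trans (main (e / (s * (I + 1))) (divr_gt0 e0 I1))).
  have I1' : 0 < I + 1 by rewrite ltr_wpDl//; exact: Rintegral_H_ge0.
  rewrite lerD2l -/I (_ : _ * I = e * (I / (I + 1))); last first.
    by field; rewrite !gt_eqF.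
  by rewrite ler_piMr ?(ltW e0)// ler_pdivrMr// mul1r lerDl.
move=> e0.
have [d d0 unif] := segment_unif_continuous a b cG e0.
pose K t := s * ((G t + e) * H t).
have cGe : continuous (fun t => G t + e).
  by move=> t; apply: cvgD; [exact: cG|exact: cvg_cst].
have lK : locint1 K by apply: locint1Zl; exact: locint1M.
have step x y : a <= x -> x <= y -> y <= b -> y - x < d ->
    `|W y `^ s - W x `^ s| <= \int[leb]_(t in `[x, y]) K t.
  move=> ax xy yb yx; set mx := Num.max (G x) (G y).
  apply: (@le_trans _ _ (s * mx * \int[leb]_(t in `[x, y]) H t)).
    apply: (le_trans (powR_lip s1 (W0 x) (W0 y))); apply: ler_wpM2l; last exact: WH.
    by rewrite mulr_ge0 ?(ltW s0)// le_max G0.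
  rewrite -RintegralZl//; last exact: locint1_itv.
  apply: le_Rintegral_itv => //; first exact: locint1Zl.
  move=> t /andP[xt ty]; rewrite /K -mulrA ler_wpM2l ?(ltW s0)// ler_wpM2r//.
  rewrite ge_max; apply/andP; split; rewrite -lerBlDl.
    have : `|G t - G x| < e.
      apply: unif; first by rewrite /= in_itv/= ax (le_trans xy).
      by rewrite ger0_norm ?subr_ge0// (le_lt_trans _ yx)// lerB.
    by rewrite distrC => /ltW; apply: le_trans; exact: ler_norm.
  have : `|G t - G y| < e.
    apply: unif; first by rewrite /= in_itv/= yb (le_trans ax).
    by rewrite distrC ger0_norm ?subr_ge0// (le_lt_trans _ yx)// lerB.
  by rewrite distrC => /ltW; apply: le_trans; exact: ler_norm.
have d2 : 0 < d / 2 by rewrite divr_gt0.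
(* Pieces of length d/2 meet the strict requirement y - x < d; the induction is on the number of
   pieces needed to reach y from a. *)
have ind (k : nat) : forall y, a <= y -> y <= b -> y - a <= k%:R * (d / 2) ->
    `|W y `^ s - W a `^ s| <= \int[leb]_(t in `[a, y]) K t.
  elim: k => [|k ih] y ay yb.
    rewrite mul0r subr_le0 => ya; have -> : y = a by apply/eqP; rewrite eq_le ya.
    by rewrite subrr normr0 set_itv1 Rintegral_set1.
  move=> yk; pose x := Num.max a (y - d / 2).
  have ax : a <= x by rewrite le_max lexx.
  have xy : x <= y by rewrite ge_max ay/= lerBlDr lerDl ltW.
  have xk : x - a <= k%:R * (d / 2).
    rewrite lerBlDr ge_max lerDr mulr_ge0 ?(ltW d2)//=.
    by move: yk; rewrite -natr1 mulrDl mul1r; lra.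
  have yx : y - x < d.
    rewrite ltrBlDr addrC -ltrBlDr lt_max; apply/orP; right.
    by rewrite ltrD2l ltrN2 ltr_pdivrMr// ltr_pMr// ltr1n.
  rewrite (Rintegral_chasles lK ax xy) [leRHS]addrC.
  rewrite (le_trans (ler_distD (W x `^ s) _ _))// lerD//; first exact: step.
  by apply: ih => //; exact: le_trans xy yb.
have [N hN] : exists N : nat, b - a <= N%:R * (d / 2).
  exists (Num.truncn ((b - a) / (d / 2))).+1; rewrite -ler_pdivrMr//.
  exact/ltW/truncnS_gt.
apply: (le_trans (ind N b ab (lexx b) hN)).
rewrite -RintegralZl//; last exact: locint1_itv.
rewrite -RintegralZl//; last exact: locint1_itv.
rewrite -RintegralD//; [|exact/locint1_itv/locint1Zl..].
by apply: le_Rintegral_itv => // [|x _]; [apply: locint1D; exact: locint1Zl|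
  rewrite /K; lra].
Qed.

(** Integrability of W^p gives a point a where W(a)^s is as small as desired; the chain rule between
    a and b then bounds W(b)^s. It replaces the decay at infinity of a compactly supported
    function. *)
Lemma line_ineq s p : 1 < s -> 0 < p -> (\int[leb]_x (W x `^ p)%:E < +oo)%E ->
  forall b, ((W b `^ s)%:E <= s%:E * \int[leb]_x (W x `^ (s - 1) * H x)%:E)%E.
Proof.
move=> s1 p0 Wp b; have s0 : 0 < s by rewrite (lt_trans _ s1).
have s1' : 0 < s - 1 by rewrite subr_gt0.
have cG : continuous (fun t => W t `^ (s - 1)) by exact: continuous_powR_comp.
have lGH := locint1M cG lH; have [mGH _] := lGH.
apply/lee_addgt0Pr => e e0.
(* Otherwise W^p would be bounded below by a positive constant on the whole line. *)
have [a We] : exists a, W a < e `^ s^-1.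
  apply: contrapT => /forallNP h.
  have es0 : 0 < (e `^ s^-1) `^ p by rewrite !powR_gt0.
  move: Wp; apply/negP; rewrite -leNgt.
  apply: (@le_trans _ _ (\int[leb]_x (cst ((e `^ s^-1) `^ p)%:E x))%E).
    rewrite integral_cst//= -set_itvNyy lebesgue_measure_itv/=.
    by rewrite gt0_muley// lte_fin.
  apply: ge0_le_integral => //.
  - by move=> x _; rewrite lee_fin powR_ge0.
  - apply/measurable_EFinP; apply: continuous_measurable_fun.
    exact: continuous_powR_comp.
  - move=> x _; rewrite lee_fin; apply: ge0_ler_powR; rewrite ?nnegrE ?powR_ge0 ?(ltW p0)//.
    by rewrite leNgt; apply/negP; exact: h.
have Wae : W a `^ s <= e.
  rewrite -[leRHS]powRr1 ?(ltW e0)// -(mulVf (lt0r_neq0 s0)) powRrM.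
  by apply: ge0_ler_powR; rewrite ?nnegrE ?powR_ge0 ?(ltW s0) ?(ltW We).
have sub x y : x <= y -> ((s * \int[leb]_(t in `[x, y]) (W t `^ (s - 1) * H t))%:E <=
    s%:E * \int[leb]_x (W x `^ (s - 1) * H x)%:E)%E.
  move=> xy; rewrite EFinM lee_pmul2l ?lte_fin//.
  rewrite -integral_EFin_Rintegral//; last exact: locint1_itv.
  apply: ge0_subset_integral => //; first exact/measurable_EFinP.
  by move=> t _; rewrite lee_fin mulr_ge0// powR_ge0.
suff [x [y [xy h]]] : exists x y, x <= y /\
    `|W b `^ s - W a `^ s| <= s * \int[leb]_(t in `[x, y]) (W t `^ (s - 1) * H t).
  apply: le_trans (leeD2r e%:E (sub x y xy)); rewrite -EFinD lee_fin.
  have := le_trans (ler_norm _) h; rewrite lerBlDr => /le_trans; apply.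
  by rewrite lerD2l.
have [ab|/ltW ba] := leP a b; first by exists a, b; split => //; exact: powR_chain.
by exists b, a; split => //; rewrite distrC; exact: powR_chain.
Qed.

End line_inequalities.

(** * A weighted Poincare inequality on the line *)

Section line_poincare.
Context {R : realType}.
Local Notation leb := (@lebesgue_measure R).
Variables (W H : R -> R).
Hypotheses (W0 : forall x, 0 <= W x) (cW : continuous W).
Hypotheses (H0 : forall x, 0 <= H x) (lH : locint1 H).
Hypothesis WH : forall x y, x <= y -> `|W y - W x| <= \int[leb]_(t in `[x, y]) H t.
Variable p : R.
Hypothesis p1 : 1 < p.

Let p0 : 0 < p. Proof. by rewrite (lt_trans _ p1). Qed.

Let mpow (f : R -> R) : measurable_fun [set: measurableTypeR R] f ->
  measurable_fun [set: measurableTypeR R] (fun x => (f x `^ p)%:E).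
Proof. by move=> mf; apply/measurable_EFinP; exact: (measurableT_comp (measurable_powR p) mf). Qed.

Let one_le_powR (x : R) : 1 <= x -> 1 <= x `^ p.
Proof.
move=> x1; have := ge0_ler_powR (ltW p0) (_ : 1 \in Num.nneg) (_ : x \in Num.nneg) x1.
by rewrite powR1; apply; rewrite nnegrE// (le_trans _ x1).
Qed.

Lemma integral_cst_itv (a b c : R) : a <= b ->
  (\int[leb]_(x in `[a, b]) c%:E = (c * (b - a))%:E)%E.
Proof.
move=> ab; rewrite [LHS]integral_cst//= lebesgue_measure_itv/= lte_fin.
case: ltP => [_|ba]; first by rewrite -EFinB -EFinM.
by rewrite mule0 (_ : b - a = 0) ?mulr0//; apply/eqP; rewrite subr_eq0 eq_le ab ba.
Qed.

(** Jensen's inequality, by integrating Young's inequality taken at the mean c of H. The sharp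
    factor is (b-a)^(p-1); since b - a >= 1 it may be relaxed to (b-a)^p. *)
Lemma powR_Rintegral_le (a b : R) : a < b -> 1 <= b - a ->
  (((\int[leb]_(t in `[a, b]) H t) `^ p)%:E <=
   ((b - a) `^ p)%:E * \int[leb]_t (H t `^ p)%:E)%E.
Proof.
move=> ab ba1; set T := \int[leb]_(t in `[a, b]) H t; set l := b - a.
have l0 : 0 < l by rewrite subr_gt0.
have T0 : 0 <= T by exact: Rintegral_ge0.
have [mH _] := lH.
pose c := T / l; have c0 : 0 <= c by rewrite divr_ge0// ltW.
have Tc : T = l * c by rewrite /c mulrC divfK// gt_eqF.
have key : ((l * c `^ p)%:E <= \int[leb]_(t in `[a, b]) (H t `^ p)%:E)%E.
  have : (\int[leb]_(t in `[a, b]) (p * (c `^ (p - 1) * H t))%:E <=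
      \int[leb]_(t in `[a, b]) ((p - 1) * c `^ p + H t `^ p)%:E)%E.
    apply: ge0_le_integral => //.
    - by move=> t _; rewrite lee_fin !mulr_ge0 ?powR_ge0 ?(ltW p0).
    - apply/measurable_EFinP; apply: measurable_funTS.
      by do 2 apply: measurable_funM => //.
    - apply/measurable_EFinP; apply: measurable_funTS.
      apply: measurable_funD => //; exact: (measurableT_comp (measurable_powR p) mH).
    - by move=> t _; rewrite lee_fin; exact: young_powR.
  rewrite [leRHS](_ : _ = ((p - 1) * c `^ p * l)%:E +
      \int[leb]_(t in `[a, b]) (H t `^ p)%:E)%E; last first.
    rewrite -integral_cst_itv ?(ltW ab)// -ge0_integralD//.
    - by move=> t _; rewrite lee_fin mulr_ge0 ?powR_ge0// subr_ge0 ltW.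
    - by move=> t _; rewrite lee_fin powR_ge0.
    - by apply: measurable_funTS; exact: mpow.
  rewrite [leLHS](_ : _ = (p * (c `^ (p - 1) * T))%:E); last first.
    rewrite (_ : p * (c `^ (p - 1) * T) =
      \int[leb]_(t in `[a, b]) (p * (c `^ (p - 1) * H t))).
      by rewrite -integral_EFin_Rintegral//; apply/locint1_itv/locint1Zl/locint1Zl.
    rewrite RintegralZl//; last exact/locint1_itv/locint1Zl.
    by rewrite RintegralZl//; exact: locint1_itv.
  rewrite -leeBlDl// -EFinB; congr (_%:E <= _)%E.
  by rewrite Tc -(mulr_powRB1 c0 p0); ring.
rewrite Tc powRM ?(ltW l0)// EFinM.
apply: lee_wpmul2l; first by rewrite lee_fin powR_ge0.
apply: (@le_trans _ _ ((l * c `^ p)%:E)).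
  by rewrite lee_fin ler_peMl// powR_ge0.
apply: (le_trans key); apply: ge0_subset_integral => //.
- exact: mpow.
- by move=> t _; rewrite lee_fin powR_ge0.
Qed.

Lemma powR_le_sum (x y z : R) : 0 <= x -> 0 <= y -> 0 <= z -> x <= y + z ->
  x `^ p <= 2 `^ p * (y `^ p + z `^ p).
Proof.
move=> x0 y0 z0 xyz.
have M0 : 0 <= Num.max y z by rewrite le_max y0.
apply: (@le_trans _ _ ((2 * Num.max y z) `^ p)).
  apply: ge0_ler_powR; rewrite ?nnegrE ?(ltW p0) ?mulr_ge0//.
  apply: (le_trans xyz); rewrite mulr_natl mulr2n lerD// le_max ?lexx// orbT//.
rewrite powRM// ler_wpM2l ?powR_ge0//.
by have [_|_] := leP y z; rewrite ?lerDl ?lerDr powR_ge0.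
Qed.

(** Where |x| > 1 the weight is at least 1. For |x| <= 1, W(x) is compared with W on [1, 2], where
    the weight is again at least 1, at the cost of the integral T of H over [-1, 2]. In the
    constants, 2^p comes from the power of a sum, 3^p from the length of [-1, 2], and the further
    factor 2 from the length of [-1, 1]. *)
Lemma line_poincare :
  (\int[leb]_x (W x `^ p)%:E <=
   (1 + 2 * 2 `^ p)%:E * \int[leb]_x (`|x| `^ p * W x `^ p)%:E +
   (2 * (2 `^ p * 3 `^ p))%:E * \int[leb]_x (H x `^ p)%:E)%E.
Proof.
set X := (\int[leb]_x (`|x| `^ p * W x `^ p)%:E)%E.
set A := (\int[leb]_x (H x `^ p)%:E)%E.
have mW : measurable_fun [set: measurableTypeR R] W by exact: continuous_measurable_fun.
have mX : measurable_fun [set: measurableTypeR R] (fun x => (`|x| `^ p * W x `^ p)%:E).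
  apply/measurable_EFinP; apply: measurable_funM.
    by apply: (measurableT_comp (measurable_powR p)); exact: normr_measurable.
  exact: (measurableT_comp (measurable_powR p) mW).
have X0 : (0 <= X)%E by apply: integral_ge0 => x _; rewrite lee_fin mulr_ge0 ?powR_ge0.
have A0 : (0 <= A)%E by apply: integral_ge0 => x _; rewrite lee_fin powR_ge0.
pose B := ((2 `^ p)%:E * (X + (3 `^ p)%:E * A))%E.
have B0 : (0 <= B)%E.
  apply: mule_ge0; first by rewrite lee_fin powR_ge0.
  by apply: adde_ge0 => //; apply: mule_ge0 => //; rewrite lee_fin powR_ge0.
set T := \int[leb]_(t in `[-1, 2]) H t.
have T0 : 0 <= T by exact: Rintegral_ge0.
have TA : ((T `^ p)%:E <= (3 `^ p)%:E * A)%E.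
  have := @powR_Rintegral_le (-1) 2; rewrite (_ : 2 - -1 = 3 :> R); last by lra.
  by apply; lra.
have WB x : `|x| <= 1 -> ((W x `^ p)%:E <= B)%E.
  rewrite ler_norml => /andP[x1 x2].
  (* The interval [1, 2] has length 1, so averaging over it costs no constant. *)
  apply: (@le_trans _ _ (\int[leb]_(y in `[1%R, 2%R]) (W x `^ p)%:E)%E).
    by rewrite integral_cst_itv ?ler1n// (_ : 2 - 1 = 1 :> R) ?mulr1//; lra.
  apply: (@le_trans _ _ (\int[leb]_(y in `[1%R, 2%R])
     ((2 `^ p)%:E * ((W y `^ p)%:E + (T `^ p)%:E)))%E).
    apply: ge0_le_integral => //.
    - by move=> y _; rewrite lee_fin powR_ge0.
    - apply: measurable_funeM; apply: emeasurable_funD => //.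
      by apply: measurable_funTS; exact: mpow.
    - move=> y /=; rewrite in_itv/= => /andP[y1 y2].
      rewrite -EFinD -EFinM lee_fin; apply: powR_le_sum => //.
      have xy : x <= y by exact: le_trans y1.
      have := le_trans (ler_norm _) (le_trans (ler_distD _ _ _) (le_refl _)).
      have H1 : W x - W y <= \int[leb]_(t in `[x, y]) H t.
        by apply: (le_trans (ler_norm _)); rewrite distrC; exact: WH.
      have H2 : \int[leb]_(t in `[x, y]) H t <= T.
        rewrite /T (Rintegral_chasles lH x1 (le_trans x2 _)) ?ler1n//.
        rewrite (Rintegral_chasles lH xy y2) addrA addrAC lerDr.
        by rewrite addr_ge0// Rintegral_ge0.
      by move=> _; rewrite addrC -lerBlDr (le_trans H1).
  have mWp : measurable_fun (`[1%R, 2%R]%classic : set (measurableTypeR R)) (fun y => (W y `^ p)%:E).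
    by apply: measurable_funTS; exact: mpow.
  have mS : measurable_fun (`[1%R, 2%R]%classic : set (measurableTypeR R))
      (fun y => (W y `^ p)%:E + (T `^ p)%:E)%E by exact: emeasurable_funD.
  have S0 (y : R) : ((0 : R)%:E <= (W y `^ p)%:E + (T `^ p)%:E)%E.
    by rewrite adde_ge0// lee_fin powR_ge0.
  rewrite ge0_integralZl//.
  apply: lee_wpmul2l; first by rewrite lee_fin powR_ge0.
  rewrite ge0_integralD//; last 2 first.
  - by move=> y _; rewrite lee_fin powR_ge0.
  - by move=> y _; rewrite lee_fin powR_ge0.
  apply: leeD; last first.
    by rewrite integral_cst_itv ?ler1n// (_ : 2 - 1 = 1 :> R) ?mulr1//; lra.
  apply: (@le_trans _ _ (\int[leb]_(y in `[1%R, 2%R]) (`|y| `^ p * W y `^ p)%:E)%E).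
    apply: ge0_le_integral => //.
    - by move=> y _; rewrite lee_fin powR_ge0.
    - exact: measurable_funTS.
    - move=> y /=; rewrite in_itv/= => /andP[y1 _]; rewrite lee_fin ler_peMl ?powR_ge0//.
      apply: one_le_powR; exact: le_trans y1 (ler_norm _).
  apply: ge0_subset_integral => //.
  by move=> y _; rewrite lee_fin mulr_ge0 ?powR_ge0.
pose I1 x : \bar R := (\1_(`[-1, 1]%classic : set R) x)%:E.
have mI1 : measurable_fun [set: measurableTypeR R] I1.
  by apply/measurable_EFinP; exact: measurable_indic.
have I10 x : (0 <= I1 x)%E by rewrite lee_fin.
have mBI : measurable_fun [set: measurableTypeR R] (fun x => B * I1 x)%E.
  exact: measurable_funeM.
have BI0 x : (0 <= B * I1 x)%E by exact: mule_ge0.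
have XW0 x : (0 <= (`|x| `^ p * W x `^ p)%:E)%E by rewrite lee_fin mulr_ge0 ?powR_ge0.
apply: (@le_trans _ _ (\int[leb]_x (B * I1 x + (`|x| `^ p * W x `^ p)%:E))%E).
  apply: ge0_le_integral => //.
  - by move=> x _; rewrite lee_fin powR_ge0.
  - exact: mpow.
  - exact: emeasurable_funD.
  - move=> x _; have [x1|x1] := leP `|x| 1.
      rewrite /I1 indicE mem_itvcc -ler_norml x1 mule1.
      by apply: (le_trans (WB x x1)); rewrite leeDl.
    rewrite (@le_trans _ _ (`|x| `^ p * W x `^ p)%:E)//; last by rewrite leeDr.
    rewrite lee_fin ler_peMl ?powR_ge0//.
    by apply: one_le_powR; exact: ltW.
rewrite ge0_integralD// -/X ge0_integralZl//.
rewrite integral_indic// setIT [X in (B * X)%E](_ : _ = 2%:E); last first.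
  have : lebesgue_measure (`[-1, 1]%classic : set R) = 2%:E.
    by rewrite lebesgue_measure_itv/= lte_fin ifT -?EFinB; [congr EFin|]; lra.
  exact.
have p2 : 0 <= 2 `^ p :> R by exact: powR_ge0.
have p3 : 0 <= 3 `^ p :> R by exact: powR_ge0.
rewrite /B muleC muleA -EFinM ge0_muleDr//; last by rewrite mule_ge0// lee_fin.
rewrite addeAC EFinD ge0_muleDl ?lee_fin ?mulr_ge0// mul1e.
by rewrite muleA -EFinM mulrA (addeC X).
Qed.

End line_poincare.

(** * Gagliardo-Nirenberg inequality *)

Lemma ler_dist_min (R : realDomainType) (M a b : R) :
  `|Num.min a M - Num.min b M| <= `|a - b|.
Proof.
have [aM|Ma] := leP a M; have [bM|Mb] := leP b M => //.
- rewrite (ler0_norm (_ : a - M <= 0)) ?(ler0_norm (_ : a - b <= 0)); lra.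
- rewrite (ger0_norm (_ : 0 <= M - b)) ?(ger0_norm (_ : 0 <= a - b)); lra.
- by rewrite subrr normr0.
Qed.

Lemma ae_eq_integralT d (T : measurableType d) (R : realType)
    (mu : {measure set T -> \bar R}) (f g : T -> \bar R) :
  measurable_fun setT f -> measurable_fun setT g ->
  {ae mu, forall x, f x = g x} -> (\int[mu]_x f x = \int[mu]_x g x)%E.
Proof.
by move=> mf mg fg; apply: ae_eq_integral => //; apply: filterS fg => x fg _.
Qed.

(** * From lines to the whole space *)

Section slices.
Context {R : realType} (m : nat) (i : 'I_m.+1).
Local Notation leb := (@lebesgue_measure R).
Local Notation lam := (@lebesgue_rV R).
Local Notation V := 'rV[R]_m.+1.
Local Notation Y := 'rV[R]_m.
Local Notation ins := (@rV_ins R m i).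

Lemma rV_upd_ins t x (y : Y) : rV_upd i t (ins (x, y)) = ins (t, y).
Proof.
apply/rowP => k; rewrite rV_updE; case: (unliftP i k) => [j ->|->].
  by rewrite eq_sym (negbTE (neq_lift _ _)) !rV_ins_lift.
by rewrite eqxx rV_ins_eq.
Qed.

Lemma measurable_slice d (T : measurableType d) (F : V -> T) y :
  measurable_fun [set: V] F ->
  measurable_fun [set: measurableTypeR R] (fun x => F (ins (x, y))).
Proof. by move=> mF; exact: (measurableT_comp mF (measurable_rV_ins1 i y)). Qed.

Lemma ge0_integral_slice (F : V -> \bar R) : nnmeas F ->
  (\int[lam m.+1]_v F v = \int[lam m]_y \int[leb]_x F (ins (x, y)))%E.
Proof.
move=> [mF F0]; rewrite (ge0_integral_rV_ins i)//.
rewrite -(@fubini_tonelli2 _ _ _ _ _ leb (lam m) (F \o ins))//.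
- exact: (measurableT_comp mF (measurable_rV_ins i)).
- by move=> z; exact: F0.
Qed.

Lemma measurable_slice_integral (F : V -> \bar R) : measurable_fun [set: V] F ->
  measurable_fun [set: Y] (fun y => \int[leb]_x F (ins (x, y)))%E.
Proof.
move=> mF; apply: (@measurable_param_integral R _ _ _ _ leb (F \o ins)).
exact: (measurableT_comp mF (measurable_rV_ins i)).
Qed.

Lemma ae_slice (A : set V) : measurable A ->
  {ae lam m, forall y, {ae leb, forall x, A (ins (x, y))}} ->
  {ae lam m.+1, forall v, A v}.
Proof.
move=> mA Ay; exists (~` A); split => //; first exact: measurableC.
have mC : measurable (~` A) by exact: measurableC.
have hI : nnmeas (fun v : V => (\1_(~` A) v)%:E : \bar R).
  by split; [apply/measurable_EFinP; exact: measurable_indic|move=> v; rewrite lee_fin].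
rewrite -[LHS]/(lam m.+1 (~` A)) -(setIT (~` A)) -integral_indic// ge0_integral_slice//.
apply: ge0_ae_integral_eq0.
- exact: (measurable_slice_integral hI.1).
- by move=> y; apply: integral_ge0 => x _; rewrite lee_fin.
apply: filterS Ay => y Ay; apply: ge0_ae_integral_eq0.
- exact: (measurable_slice y hI.1).
- by move=> x; rewrite lee_fin.
apply: filterS Ay; first exact: (ae_filter_ringOfSetsType leb).
by move=> x Ax; rewrite indicE memNset// => /(_ Ax).
Qed.

Lemma ae_slice_finite (F : V -> \bar R) : nnmeas F ->
  (\int[lam m.+1]_v F v < +oo)%E ->
  {ae lam m, forall y, (\int[leb]_x F (ins (x, y)) < +oo)%E}.
Proof.
move=> hF; rewrite ge0_integral_slice// => Foo.
have I0 y : (0 <= \int[leb]_x F (ins (x, y)))%E.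
  by apply: integral_ge0 => x _; case: hF.
have : (lam m).-integrable setT (fun y => \int[leb]_x F (ins (x, y)))%E.
  apply/integrableP; split; first exact: (measurable_slice_integral hF.1).
  by under eq_integral do rewrite gee0_abs//.
move=> /(integrable_ae measurableT); apply: filterS => y /(_ I).
by rewrite ge0_fin_numE.
Qed.

Variables (u h : V -> R).
Hypotheses (lu : locint u) (lh : locint h) (W : weak_deriv i u h).

(** U is the representative c - [prim h]; only its continuity and its increment bound are passed on,
    in the form that the line inequalities take. *)
Lemma slice_ac : {ae lam m, forall y, exists U : R -> R,
  [/\ continuous U, locint1 (fun t => `|h (ins (t, y))|),
    forall x z, x <= z -> `|U z - U x| <= \int[leb]_(t in `[x, z]) `|h (ins (t, y))| &
    {ae leb, forall x, u (ins (x, y)) = U x}]}.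
Proof.
have := acl_rV lu lh W; apply: filterS => y [lhy [c hc]].
exists (fun x => c - prim (fun t => h (ins (t, y))) x); split => //.
- move=> x; apply: cvgB; first exact: cvg_cst.
  exact: continuous_prim.
- have [mh ith] := lhy; split; first exact: measurableT_comp.
  by move=> k; have := integrable_abse (ith k); apply: eq_integrable.
- move=> x z xz; rewrite [X in `|X|](_ : _ = - (prim (fun t => h (ins (t, y))) z -
      prim (fun t => h (ins (t, y))) x)); last by rewrite /=; ring.
  rewrite normrN primB//.
  by apply: le_normr_Rintegral => //; exact: locint1_itv.
Qed.

(** By Tonelli almost every slice of w^p is integrable, so the line inequality applies to the
    truncated continuous representative; both sides are then rewritten in terms of w, which agrees
    with it almost everywhere on the line. *)
Lemma gn_pointwise (M s p : R) : 0 < M -> 1 < s -> 0 < p ->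
  (\int[lam m.+1]_v (Num.min `|u v| M `^ p)%:E < +oo)%E ->
  {ae lam m.+1, forall v, ((Num.min `|u v| M `^ s)%:E <=
    s%:E * rV_part i (fun v => (Num.min `|u v| M `^ (s - 1) * `|h v|)%:E) v)%E}.
Proof.
move=> M0 s1 p0 fin; have [mu _] := lu; have [mh _] := lh.
pose w v := Num.min `|u v| M.
have w0 v : 0 <= w v by rewrite le_min normr_ge0 ltW.
have mw : measurable_fun [set: V] w.
  by apply: measurable_minr => //; exact: measurableT_comp.
have mwr r : measurable_fun [set: V] (fun v => w v `^ r).
  exact: (measurableT_comp (measurable_powR r) mw).
have hP : nnmeas (fun v => (w v `^ (s - 1) * `|h v|)%:E).
  split; last by move=> v; rewrite lee_fin mulr_ge0 ?powR_ge0.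
  by apply/measurable_EFinP; apply: measurable_funM => //; exact: measurableT_comp.
apply: (@ae_slice [set v | ((w v `^ s)%:E <= s%:E * rV_part i
    (fun v => (w v `^ (s - 1) * `|h v|)%:E) v)%E]).
  rewrite -[X in measurable X]setTI; apply: measurable_lee => //.
  - exact/measurable_EFinP.
  - by apply: measurable_funeM; case: (nnmeas_part i hP).
have hw : nnmeas (fun v => (w v `^ p)%:E).
  by split; [exact/measurable_EFinP|move=> v; rewrite lee_fin powR_ge0].
apply: filterS2 slice_ac (ae_slice_finite hw fin) => y [U [cU lhy UH uU]] finy.
pose WU x := Num.min `|U x| M.
have WU0 x : 0 <= WU x by rewrite le_min normr_ge0 ltW.
have cWU : continuous WU.
  move=> x; apply: (@continuous_min R R (fun x => `|U x|) (fun=> M) x).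
    by apply: continuous_comp; [exact: cU|exact: norm_continuous].
  exact: cvg_cst.
have wWU : {ae leb, forall x, w (ins (x, y)) = WU x}.
  apply: filterS (uU); first exact: (ae_filter_ringOfSetsType leb).
  by move=> x e; rewrite /w /WU e.
have WUH x z : x <= z -> `|WU z - WU x| <= \int[leb]_(t in `[x, z]) `|h (ins (t, y))|.
  move=> xz; apply: le_trans (UH x z xz); rewrite /WU.
  exact: le_trans (ler_dist_min _ _ _) (ler_dist_dist _ _).
have finW : (\int[leb]_x (WU x `^ p)%:E < +oo)%E.
  rewrite -(@ae_eq_integralT _ _ _ leb (fun x => (w (ins (x, y)) `^ p)%:E)%E)//.
  - exact: (measurable_slice y hw.1).
  - by apply/measurable_EFinP; apply: continuous_measurable_fun; exact: continuous_powR_comp.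
  - apply: filterS (wWU); first exact: (ae_filter_ringOfSetsType leb).
    by move=> x e; rewrite e.
have L := line_ineq WU0 cWU (fun x => normr_ge0 _) lhy WUH s1 p0 finW.
apply: filterS (wWU); first exact: (ae_filter_ringOfSetsType leb).
move=> x wx; rewrite /= wx; apply: (le_trans (L x)).
rewrite lee_pmul2l//; last by rewrite lte_fin (lt_trans ltr01).
rewrite /rV_part (@ae_eq_integralT _ _ _ leb
  (fun t => (WU t `^ (s - 1) * `|h (ins (t, y))|)%:E)%E
  (fun t => (w (ins (t, y)) `^ (s - 1) * `|h (ins (t, y))|)%:E)%E).
- by under [leRHS]eq_integral do rewrite rV_upd_ins.
- apply/measurable_EFinP; apply: measurable_funM; last by case: lhy.
  apply: (measurableT_comp (measurable_powR (s - 1))).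
  exact: continuous_measurable_fun.
- exact: (measurable_slice y (hP.1)).
- apply: filterS (wWU); first exact: (ae_filter_ringOfSetsType leb).
  by move=> t e; rewrite e.
Qed.

(** The weighted inequality on lines in direction i, integrated over the transverse variables; the
    weight is the coordinate i itself. *)
Lemma rV_poincare (p : R) : 1 < p ->
  (\int[lam m.+1]_v (`|u v| `^ p)%:E <=
   (1 + 2 * 2 `^ p)%:E * \int[lam m.+1]_v (`|v ord0 i| `^ p * `|u v| `^ p)%:E +
   (2 * (2 `^ p * 3 `^ p))%:E * \int[lam m.+1]_v (`|h v| `^ p)%:E)%E.
Proof.
move=> p1; have [mu _] := lu; have [mh _] := lh.
have mpow (g : V -> R) : measurable_fun [set: V] g ->
    measurable_fun [set: V] (fun v => `|g v| `^ p).
  move=> mg; apply: (measurableT_comp (measurable_powR p)).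
  exact: measurableT_comp.
have hu : nnmeas (fun v => (`|u v| `^ p)%:E).
  by split; [apply/measurable_EFinP; exact: mpow|move=> v; rewrite lee_fin powR_ge0].
have hh : nnmeas (fun v => (`|h v| `^ p)%:E).
  by split; [apply/measurable_EFinP; exact: mpow|move=> v; rewrite lee_fin powR_ge0].
have hx : nnmeas (fun v : V => (`|v ord0 i| `^ p * `|u v| `^ p)%:E).
  split; last by move=> v; rewrite lee_fin mulr_ge0 ?powR_ge0.
  apply/measurable_EFinP; apply: measurable_funM; last exact: mpow.
  exact: (mpow (fun v : V => v ord0 i) (measurable_rV_coord i)).
have I0 (F : V -> \bar R) : nnmeas F -> forall y, (0 <= \int[leb]_x F (ins (x, y)))%E.
  by move=> [_ F0] y; exact: integral_ge0.
have mI (F : V -> \bar R) : nnmeas F ->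
    measurable_fun [set: Y] (fun y => \int[leb]_x F (ins (x, y)))%E.
  by move=> [mF _]; exact: measurable_slice_integral.
have c1 : 0 <= 1 + 2 * 2 `^ p :> R by rewrite addr_ge0 ?mulr_ge0 ?powR_ge0.
have c2 : 0 <= 2 * (2 `^ p * 3 `^ p) :> R by rewrite !mulr_ge0 ?powR_ge0.
rewrite !ge0_integral_slice//.
have Z (F : V -> \bar R) c : nnmeas F -> 0 <= c ->
    (c%:E * (\int[lam m]_y \int[leb]_x F (ins (x, y))) =
     \int[lam m]_y (c%:E * \int[leb]_x F (ins (x, y))))%E.
  move=> hF c0; rewrite ge0_integralZl//; first exact: mI.
  by move=> y _; exact: I0.
rewrite (Z _ _ hx c1) (Z _ _ hh c2).
rewrite -ge0_integralD//; first last.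
- by apply: measurable_funeM; first [exact: (mI _ hx)|exact: (mI _ hh)].
- by move=> y _; rewrite mule_ge0//; first [exact: (I0 _ hx)|exact: (I0 _ hh)].
- by apply: measurable_funeM; first [exact: (mI _ hx)|exact: (mI _ hh)].
- by move=> y _; rewrite mule_ge0//; first [exact: (I0 _ hx)|exact: (I0 _ hh)].
apply: ae_ge0_le_integral => //.
- by move=> y _; exact: (I0 _ hu).
- exact: (mI _ hu).
- by move=> y _; rewrite adde_ge0// mule_ge0//; first [exact: (I0 _ hx)|exact: (I0 _ hh)].
- by apply: emeasurable_funD; apply: measurable_funeM; first [exact: (mI _ hx)|exact: (mI _ hh)].
apply: filterS slice_ac => y [U [cU lhy UH uU]] _.
have aU x : 0 <= `|U x| := normr_ge0 _.
have caU : continuous (fun x => `|U x|).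
  by move=> x; apply: continuous_comp; [exact: cU|exact: norm_continuous].
have UH' x z : x <= z -> `| `|U z| - `|U x| | <=
    \int[leb]_(t in `[x, z]) `|h (ins (t, y))|.
  by move=> xz; apply: le_trans (UH x z xz); exact: ler_dist_dist.
have := line_poincare aU caU (fun x => normr_ge0 _) lhy UH' p1.
have mU : measurable_fun [set: R] (fun x => `|U x| `^ p).
  apply: (measurableT_comp (measurable_powR p)); exact: continuous_measurable_fun.
rewrite (@ae_eq_integralT _ _ _ leb (fun x => (`|u (ins (x, y))| `^ p)%:E)%E
  (fun x => (`|U x| `^ p)%:E)%E); first last.
- apply: filterS (uU); first exact: (ae_filter_ringOfSetsType leb).
  by move=> t e; rewrite e.
- exact/measurable_EFinP.
- exact: (measurable_slice y hu.1).
rewrite (@ae_eq_integralT _ _ _ leb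
  (fun x => (`|(ins (x, y)) ord0 i| `^ p * `|u (ins (x, y))| `^ p)%:E)%E
  (fun x => (`|x| `^ p * `|U x| `^ p)%:E)%E)//; first last.
- apply: filterS (uU); first exact: (ae_filter_ringOfSetsType leb).
  by move=> t e; rewrite e rV_ins_eq.
- apply/measurable_EFinP; apply: measurable_funM => //.
  by apply: (measurableT_comp (measurable_powR p)); exact: normr_measurable.
- exact: (measurable_slice y hx.1).
Qed.

End slices.

Section gagliardo_nirenberg.
Context {R : realType}.
Implicit Types a b p q s r : R.

Lemma prode_le_prod (I : Type) (l : seq I) (P : pred I) (F G : I -> \bar R) :
  (forall i, P i -> 0 <= F i <= G i)%E ->
  (\prod_(i <- l | P i) F i <= \prod_(i <- l | P i) G i)%E.
Proof.
move=> FG; suff /andP[] : (0 <= \prod_(i <- l | P i) F i <= \prod_(i <- l | P i) G i)%E by [].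
apply: (big_ind2 (fun x y => 0 <= x <= y)%E) => //; first by rewrite lexx lee01.
move=> x1 x2 y1 y2 /andP[x10 x12] /andP[y10 y12].
by rewrite mule_ge0//= lee_pmul.
Qed.

Lemma le_integral_lin3 d (T : measurableType d) (mu : {measure set T -> \bar R})
    (g f1 f2 f3 : T -> R) (a1 a2 a3 A1 A2 A3 : R) :
  measurable_fun setT g -> measurable_fun setT f1 ->
  measurable_fun setT f2 -> measurable_fun setT f3 ->
  (forall x, 0 <= g x) -> (forall x, 0 <= f1 x) ->
  (forall x, 0 <= f2 x) -> (forall x, 0 <= f3 x) ->
  0 <= a1 -> 0 <= a2 -> 0 <= a3 ->
  (forall x, g x <= a1 * f1 x + a2 * f2 x + a3 * f3 x) ->
  (\int[mu]_x (f1 x)%:E <= A1%:E)%E -> (\int[mu]_x (f2 x)%:E <= A2%:E)%E ->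
  (\int[mu]_x (f3 x)%:E <= A3%:E)%E ->
  (\int[mu]_x (g x)%:E <= (a1 * A1 + a2 * A2 + a3 * A3)%:E)%E.
Proof.
move=> mg m1 m2 m3 g0 f10 f20 f30 a10 a20 a30 gf h1 h2 h3.
have Z (f : T -> R) (a : R) : measurable_fun setT f -> (forall x, 0 <= f x) -> 0 <= a ->
  [/\ measurable_fun setT (fun x => a%:E * (f x)%:E)%E,
     (forall x, 0 <= a%:E * (f x)%:E)%E &
     (\int[mu]_x (a%:E * (f x)%:E) = a%:E * \int[mu]_x (f x)%:E)%E].
  move=> mf f0 a0; split.
  - by apply: measurable_funeM; exact/measurable_EFinP.
  - by move=> x; rewrite mule_ge0// lee_fin.
  - by apply: ge0_integralZl => //; [exact/measurable_EFinP|move=> x _; rewrite lee_fin].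
have [mZ1 Z10 Z1] := Z _ _ m1 f10 a10.
have [mZ2 Z20 Z2] := Z _ _ m2 f20 a20.
have [mZ3 Z30 Z3] := Z _ _ m3 f30 a30.
apply: (@le_trans _ _ (\int[mu]_x
   (a1%:E * (f1 x)%:E + a2%:E * (f2 x)%:E + a3%:E * (f3 x)%:E))%E).
  apply: ge0_le_integral => //.
  - by move=> x _; rewrite lee_fin.
  - exact/measurable_EFinP.
  - by apply: emeasurable_funD => //; exact: emeasurable_funD.
  - by move=> x _; rewrite -!EFinM -!EFinD lee_fin.
have m12 : measurable_fun setT (fun x => a1%:E * (f1 x)%:E + a2%:E * (f2 x)%:E)%E.
  exact: emeasurable_funD.
have := @ge0_integralD _ _ _ mu setT measurableT
  (fun x => a1%:E * (f1 x)%:E + a2%:E * (f2 x)%:E)%E (fun x => a3%:E * (f3 x)%:E)%E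
  (fun x _ => adde_ge0 (Z10 x) (Z20 x)) m12 (fun x _ => Z30 x) mZ3.
have := @ge0_integralD _ _ _ mu setT measurableT
  (fun x => a1%:E * (f1 x)%:E)%E (fun x => a2%:E * (f2 x)%:E)%E
  (fun x _ => Z10 x) mZ1 (fun x _ => Z20 x) mZ2.
move=> -> ->; rewrite Z1 Z2 Z3 !EFinD !EFinM.
by rewrite !leeD// lee_wpmul2l// lee_fin.
Qed.

Lemma powR_between a p r q : 0 <= a -> 0 < p -> p <= r -> r <= q ->
  a `^ r <= a `^ p + a `^ q.
Proof.
move=> a0 p0 pr rq; have [->|an0] := eqVneq a 0.
  by rewrite !powR0 ?addr0// gt_eqF// ?(lt_le_trans p0)// (le_trans pr).
have agt0 : 0 < a by rewrite lt_neqAle eq_sym an0.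
have [a1|/ltW a1] := leP a 1.
  by rewrite (le_trans (ger_powR _ pr)) ?agt0// lerDl powR_ge0.
by rewrite (le_trans (ler_powR a1 rq))// lerDr powR_ge0.
Qed.

(* By Young's inequality [a] gets the exponent (s - 1) p / (p - 1), which the
   hypotheses place between [p] and [q]. *)
Lemma powR_young_between a b p q s : 0 <= a -> 0 <= b -> 1 < p -> p <= s ->
  (s - 1) * p <= q * (p - 1) ->
  a `^ (s - 1) * b <= a `^ p + a `^ q + b `^ p.
Proof.
move=> a0 b0 p1 ps sq.
have p0 : 0 < p by rewrite (lt_trans ltr01).
have p10 : 0 < p - 1 by rewrite subr_gt0.
have s10 : 0 < s - 1 by rewrite (lt_le_trans p10)// lerD2r.
have [ab|/ltW ba] := leP (a `^ (s - 1)) (b `^ (p - 1)).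
  apply: (@le_trans _ _ (b `^ p)); last by rewrite lerDr addr_ge0 ?powR_ge0.
  by rewrite -(mulr_powRB1 b0 p0) mulrC ler_wpM2l.
have ba' : b <= a `^ ((s - 1) / (p - 1)).
  have pi0 : 0 <= (p - 1)^-1 by rewrite invr_ge0 ltW.
  have := ge0_ler_powR pi0 (powR_ge0 b (p - 1)) (powR_ge0 a (s - 1)) ba.
  by rewrite -!powRrM mulfV ?gt_eqF// powRr1.
have r1 : p <= (s - 1) + (s - 1) / (p - 1).
  have : p - 1 + (p - 1) / (p - 1) <= (s - 1) + (s - 1) / (p - 1).
    by rewrite lerD// ?ler_pM2r ?invr_gt0// lerD2r.
  by rewrite divff ?gt_eqF// subrK.
have rq : (s - 1) + (s - 1) / (p - 1) <= q.
  have -> : (s - 1) + (s - 1) / (p - 1) = (s - 1) * p / (p - 1).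
    by field; rewrite gt_eqF.
  by rewrite ler_pdivrMr.
have := powR_between a0 p0 r1 rq.
rewrite powRD; last by rewrite gt_eqF// (lt_le_trans p0).
move=> H; apply: le_trans (le_trans H _); last by rewrite lerDl powR_ge0.
by rewrite ler_wpM2l ?powR_ge0.
Qed.

Variables (m : nat).
Local Notation lam := (@lebesgue_rV R).
Local Notation V := 'rV[R]_m.+1.
Variables (u : V -> R) (h : 'I_m.+1 -> V -> R).
Hypotheses (m0 : (0 < m)%N) (lu : locint u) (lh : forall i, locint (h i))
  (W : forall i, weak_deriv i u (h i)).
Variables (p N : R).
Hypotheses (p1 : 1 < p) (N0 : 0 < N)
  (uN : (\int[lam m.+1]_v (`|u v| `^ p)%:E <= (N `^ p)%:E)%E)
  (hN : forall i, (\int[lam m.+1]_v (`|h i v| `^ p)%:E <= (N `^ p)%:E)%E).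

(* The truncation makes the q-norm [L] of [w] finite beforehand; as w^s appears on
   the left and w^(s-1) on the right, a power [L `^ (s - 1)] can be cancelled. *)
Lemma gn_trunc (s q M : R) : 0 < M -> s = q * m%:R / m.+1%:R -> p <= s ->
  (s - 1) * p <= q * (p - 1) ->
  (\int[lam m.+1]_v (Num.min `|u v| M `^ q)%:E <= ((3 * s * N) `^ q)%:E)%E.
Proof.
move=> M0 sE ps sq; have [mu _] := lu.
have p0 : 0 < p by rewrite (lt_trans ltr01).
have s1 : 1 < s by exact: lt_le_trans ps.
have s0 : 0 < s by rewrite (lt_trans ltr01).
have mR0 : 0 < m%:R :> R by rewrite ltr0n.
have qE : q = s * (m.+1%:R / m%:R) by rewrite sE; field; rewrite !gt_eqF.
have sq' : s <= q.
  by rewrite qE ler_peMr ?(ltW s0)// ler_pdivlMr// mul1r ler_nat.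
have q0 : 0 < q by exact: lt_le_trans sq'.
have pq : p <= q by exact: le_trans sq'.
pose w v := Num.min `|u v| M.
have w0 v : 0 <= w v by rewrite le_min normr_ge0 ltW.
have mw : measurable_fun [set: V] w.
  by apply: measurable_minr => //; exact: measurableT_comp.
have mwr r : measurable_fun [set: V] (fun v => w v `^ r).
  exact: (measurableT_comp (measurable_powR r) mw).
have mhp i : measurable_fun [set: V] (fun v => `|h i v| `^ p).
  apply: (measurableT_comp (measurable_powR p)).
  by apply: measurableT_comp => //; case: (lh i).
have nw r : nnmeas (fun v => (w v `^ r)%:E).
  by split; [exact/measurable_EFinP|move=> v; rewrite lee_fin powR_ge0].
have wp : (\int[lam m.+1]_v (w v `^ p)%:E <= (N `^ p)%:E)%E.
  apply: le_trans uN; apply: ge0_le_integral => //.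
  - by move=> v _; rewrite lee_fin powR_ge0.
  - exact: (nw p).1.
  - apply/measurable_EFinP; apply: (measurableT_comp (measurable_powR p)).
    exact: measurableT_comp.
  - move=> v _; rewrite lee_fin ge0_ler_powR ?nnegrE// ?(ltW p0)//.
    by rewrite /w ge_min lexx.
(* Since w <= M and p <= q, w^q is at most M^(q-p) w^p. *)
have Kfin : (\int[lam m.+1]_v (w v `^ q)%:E < +oo)%E.
  apply: (@le_lt_trans _ _ (\int[lam m.+1]_v ((M `^ (q - p))%:E * (w v `^ p)%:E)))%E.
    apply: ge0_le_integral => //.
    - by move=> v _; rewrite lee_fin powR_ge0.
    - exact: (nw q).1.
    - by apply: measurable_funeM; exact: (nw p).1.
    - move=> v _; rewrite -EFinM lee_fin.
      have -> : w v `^ q = w v `^ (q - p) * w v `^ p.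
        by rewrite -powRD subrK// gt_eqF.
      rewrite ler_wpM2r ?powR_ge0// ge0_ler_powR ?nnegrE ?subr_ge0// ?(ltW M0)//.
      by rewrite /w ge_min lexx orbT.
  rewrite ge0_integralZl//; [|exact: (nw p).1| by move=> v _; rewrite lee_fin powR_ge0
    |by rewrite lee_fin powR_ge0].
  by rewrite lte_mul_pinfty ?lee_fin ?powR_ge0// (le_lt_trans wp)// ltry.

have K0 : (0 <= \int[lam m.+1]_v (w v `^ q)%:E)%E.
  by apply: integral_ge0 => v _; rewrite lee_fin powR_ge0.
set K := (\int[_]_v _)%E in Kfin K0 *.
have KE : K = (fine K)%:E by rewrite fineK// ge0_fin_numE.
have k0 : 0 <= fine K by exact: fine_ge0.
have [k0'|kn0] := eqVneq (fine K) 0; first by rewrite KE k0' lee_fin powR_ge0.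
have kgt0 : 0 < fine K by rewrite lt_neqAle eq_sym kn0.
pose L := fine K `^ q^-1.
have L0 : 0 < L by exact: powR_gt0.
have LK : L `^ q = fine K by rewrite -powRrM mulVf ?gt_eqF// powRr1.
suff LN : L <= 3 * s * N.
  have c1 : 0 <= 3 * s * N by rewrite !mulr_ge0// ltW.
  by rewrite KE -LK lee_fin ge0_ler_powR ?nnegrE ?(ltW L0) ?(ltW q0).
(* If L <= N the bound holds because 3 s >= 1; in the other case N/L < 1, which is used to bound the
   first of the three terms below. *)
have [LN|NL] := leP L N.
  by rewrite (le_trans LN)// ler_peMl ?(ltW N0)//; lra.
pose c := L `^ (s - 1) * N.
have c0 : 0 < c by rewrite mulr_gt0// powR_gt0.
(* The pointwise inequality is applied to w/L and |h|/N. With this scaling each of its three terms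
   integrates to at most 1, which is the origin of the factor 3. *)
have HH i : (\int[lam m.+1]_v (w v `^ (s - 1) * `|h i v|)%:E <= (3 * c)%:E)%E.
  have Li0 : 0 <= L^-1 by rewrite invr_ge0 ltW.
  have Ni0 : 0 <= N^-1 by rewrite invr_ge0 ltW.
  have mh : measurable_fun [set: V] (fun v => `|h i v|).
    by apply: measurableT_comp => //; case: (lh i).
  have wK : (\int[lam m.+1]_v (w v `^ q)%:E <= (fine K)%:E)%E by rewrite -KE.
  apply: (@le_trans _ _ ((c * L^-1 `^ p) * N `^ p + (c * L^-1 `^ q) * fine K +
      (c * N^-1 `^ p) * N `^ p)%:E).
    apply: (le_integral_lin3 _ _ _ _ _ _ _ _ _ _ _ _ wp wK (hN i)) => //.
    1: exact: measurable_funM.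
    1: by move=> v; rewrite mulr_ge0 ?powR_ge0.
    1-2: by move=> v; exact: powR_ge0.
    1-3: by rewrite mulr_ge0 ?powR_ge0// ltW.
    move=> v; have a0 : 0 <= w v * L^-1 by rewrite mulr_ge0.
    have b0 : 0 <= `|h i v| * N^-1 by rewrite mulr_ge0.
    have := powR_young_between a0 b0 p1 ps sq.
    rewrite -(ler_pM2l c0) !powRM// => H.
    rewrite [leLHS](_ : _ = c * (w v `^ (s - 1) * L^-1 `^ (s - 1) * (`|h i v| / N))).
      by apply: (le_trans H); rewrite le_eqVlt; apply/orP; left; apply/eqP; ring.
    have e : L `^ (s - 1) * L^-1 `^ (s - 1) = 1.
      by rewrite -powRM ?(ltW L0)// mulfV ?gt_eqF// powR1.
    have -> : c * (w v `^ (s - 1) * L^-1 `^ (s - 1) * (`|h i v| / N)) =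
       (L `^ (s - 1) * L^-1 `^ (s - 1)) * (N / N) * (w v `^ (s - 1) * `|h i v|).
      by rewrite /c; ring.
    by rewrite e mulfV ?gt_eqF// !mul1r.
  rewrite lee_fin [leLHS](_ : _ = c * (L^-1 `^ p * N `^ p + L^-1 `^ q * fine K +
    N^-1 `^ p * N `^ p)); last by ring.
  rewrite [leRHS]mulrC ler_pM2l//.
  have e1 : L^-1 `^ p * N `^ p <= 1.
    have h1 : 1 `^ p = 1 :> R by rewrite powR1.
    rewrite -powRM ?(ltW N0)// -[leRHS]h1.
    rewrite ge0_ler_powR ?nnegrE ?(ltW p0)//.
      by rewrite mulr_ge0// ltW.
    by rewrite mulrC ler_pdivrMr// mul1r ltW.
  have e2 : L^-1 `^ q * fine K = 1.
    by rewrite -LK -powRM ?(ltW L0)// mulVf ?gt_eqF// powR1.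
  have e3 : N^-1 `^ p * N `^ p = 1.
    by rewrite -powRM ?(ltW N0)// mulVf ?gt_eqF// powR1.
  by rewrite e2 e3; lra.
pose H i v := (s%:E * (w v `^ (s - 1) * `|h i v|)%:E)%E.
have nH i : nnmeas (fun v => (w v `^ (s - 1) * `|h i v|)%:E).
  split; last by move=> v; rewrite lee_fin mulr_ge0 ?powR_ge0.
  apply/measurable_EFinP; apply: measurable_funM => //.
  by apply: measurableT_comp => //; case: (lh i).
have nsH i : nnmeas (H i).
  split; first by apply: measurable_funeM; case: (nH i).
  by move=> v; rewrite mule_ge0// ?lee_fin ?(ltW s0)// mulr_ge0 ?powR_ge0.
have HE i : (\int[lam m.+1]_v H i v <= (s * (3 * c))%:E)%E.
  rewrite ge0_integralZl//; [|exact: (nH i).1|by move=> v _; exact: (nH i).2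
    |by rewrite lee_fin ltW].
  by rewrite EFinM lee_wpmul2l// lee_fin ltW.
have partE i v : (rV_part i (H i) v =
    s%:E * rV_part i (fun v => (w v `^ (s - 1) * `|h i v|)%:E) v)%E.
  rewrite /rV_part ge0_integralZl//.
  - exact: (measurableT_comp (nH i).1 (measurable_rV_updl i v)).
  - by move=> t _; exact: (nH i).2.
  - by rewrite lee_fin ltW.
have powm (x : R) : 0 <= x -> (\prod_(i < m.+1) (x%:E `^ m%:R^-1) =
    (x `^ (m.+1%:R / m%:R))%:E)%E.
  move=> x0; under eq_bigr do rewrite poweR_EFin.
  rewrite prodEFin prodr_const card_ord -powR_mulrn ?powR_ge0// -powRrM mulrC.
  by [].
have LW := @loomis_whitney R m.+1 H (m0 : (1 < m.+1)%N) nsH.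
have Kle : (K <= \int[lam m.+1]_v \prod_i (rV_part i (H i) v `^ m%:R^-1))%E.
  apply: ae_ge0_le_integral => //.
  - by move=> v _; rewrite lee_fin powR_ge0.
  - exact: (nw q).1.
  - by move=> v _; apply: prode_ge0 => i _; exact: poweR_ge0.
  - apply: emeasurable_prod => i; apply: measurable_fun_poweR.
    exact: (nnmeas_part i (nsH i)).1.
  have wp' : (\int[lam m.+1]_v (Num.min `|u v| M `^ p)%:E < +oo)%E.
    by rewrite (le_lt_trans wp)// ltry.
  have : {ae lam m.+1, forall v, forall i, ((w v `^ s)%:E <= rV_part i (H i) v)%E}.
    apply: filter_forall => i.
    apply: filterS (gn_pointwise lu (lh i) (@W i) M0 s1 p0 wp') => v.
    by rewrite partE.
  apply: filterS => v wv _.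
  (* Since q = s (m+1)/m, the power w^q splits into m+1 equal factors, one for each direction. *)
  rewrite [leLHS](_ : _ = (\prod_(i < m.+1) ((w v `^ s)%:E `^ m%:R^-1))%E); last first.
    by rewrite powm ?powR_ge0// -powRrM -qE.
  apply: prode_le_prod => i _; apply/andP; split; first exact: poweR_ge0.
  apply: gt0_ler_poweR => //.
  - by rewrite in_itv/= lee_fin powR_ge0 leey.
  - by rewrite in_itv/= leey andbT; exact: (nnmeas_part i (nsH i)).2.
have sc0 : 0 <= s * (3 * c).
  by apply: mulr_ge0; [exact: ltW|apply: mulr_ge0 => //; exact: ltW].
have Kle2 : (K <= ((s * (3 * c)) `^ (m.+1%:R / m%:R))%:E)%E.
  apply: (le_trans Kle); apply: (le_trans LW).
  rewrite -(powm _ sc0); apply: prode_le_prod => i _; apply/andP; split; first exact: poweR_ge0.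
  apply: gt0_ler_poweR => //.
  - rewrite in_itv/= leey andbT; by apply: integral_ge0 => v _; exact: ((nsH i).2 v).
  - by rewrite in_itv/= lee_fin sc0 leey.
(* Both sides raised to the power (m+1)/m give the bound just obtained for L^q. As c = L^(s-1) N,
   dividing by L^(s-1) leaves L <= 3 s N. *)
have : L `^ s <= s * (3 * c).
  rewrite leNgt; apply/negP => lt.
  have r0 : 0 < m.+1%:R / m%:R :> R by rewrite divr_gt0.
  have := gt0_ltr_powR r0 (_ : _ \in Num.nneg) (_ : _ \in Num.nneg) lt.
  rewrite !nnegrE powR_ge0 sc0 => /(_ isT isT).
  by rewrite ltNge -powRrM -qE LK -lee_fin -KE Kle2.
rewrite -(mulr_powRB1 (ltW L0) s0) /c.
rewrite [leRHS](_ : _ = (3 * s * N) * L `^ (s - 1)); last by ring.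
by rewrite ler_pM2r// powR_gt0.
Qed.


Lemma gn_full (s q : R) : s = q * m%:R / m.+1%:R -> p <= s ->
  (s - 1) * p <= q * (p - 1) ->
  (\int[lam m.+1]_v (`|u v| `^ q)%:E <= ((3 * s * N) `^ q)%:E)%E.
Proof.
move=> sE ps sq; have [mu _] := lu.
have p0 : 0 < p by rewrite (lt_trans ltr01).
have q0 : 0 <= q.
  have : 0 <= q * m%:R / m.+1%:R by rewrite -sE (le_trans (ltW p0)).
  by rewrite pmulr_lge0 ?invr_gt0 ?ltr0n// pmulr_lge0 ?ltr0n.
pose g k v := (Num.min `|u v| k.+1%:R `^ q)%:E.
have mg k : measurable_fun [set: V] (g k).
  apply/measurable_EFinP; apply: (measurableT_comp (measurable_powR q)).
  by apply: measurable_minr => //; exact: measurableT_comp.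
have min0 v (k : nat) : 0 <= Num.min `|u v| k.+1%:R by rewrite le_min normr_ge0/=.
have ndg v : nondecreasing_seq (g ^~ v).
  move=> k l kl; rewrite lee_fin ge0_ler_powR ?nnegrE//.
  by rewrite le_min !ge_min lexx/= ler_nat ltnS kl orbT.
have H := @cvg_monotone_convergence _ _ _ (lam m.+1) _ measurableT g mg
  (fun k v _ => powR_ge0 _ _) (fun v _ => ndg v).
have limg v : limn (g ^~ v) = (`|u v| `^ q)%:E.
  apply: cvg_lim => //; apply: cvg_near_cst.
  exists (Num.truncn `|u v|).+1 => // k /= uk; rewrite /g min_l//.
  by rewrite ltW// (lt_le_trans (truncnS_gt _))// ler_nat ltnW.
under eq_integral do rewrite -limg.
rewrite -(cvg_lim _ H)//; apply: lime_le; first by apply/cvg_ex; eexists; exact: H.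
by apply: nearW => k; exact: gn_trunc.
Qed.

(** The Gagliardo-Nirenberg estimate needs s >= p, so s is raised to p if necessary; the
    corresponding q1 = s (m+1)/m is then at least q, and the q-norm is interpolated between
    exponents p and q1. The factor 2 counts these two terms. *)
Lemma gn_interp (q : R) : p < q -> p^-1 - m.+1%:R^-1 <= q^-1 ->
  (\int[lam m.+1]_v (`|u v| `^ q)%:E <=
   (2 * (3 * Num.max (q * m%:R / m.+1%:R) p * N) `^ q)%:E)%E.
Proof.
move=> pq pqm; have [mu _] := lu.
have p0 : 0 < p by rewrite (lt_trans ltr01).
have q0 : 0 < q by rewrite (lt_trans p0).
set s := Num.max _ _; pose q1 := s * (m.+1%:R / m%:R).
have mR0 : 0 < m%:R :> R by rewrite ltr0n.
have nR0 : 0 < m.+1%:R :> R by rewrite ltr0n.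
have nm : m.+1%:R = m%:R + 1 :> R by rewrite natr1.
have sE : s = q1 * m%:R / m.+1%:R by rewrite /q1; field; rewrite !gt_eqF.
have ps : p <= s by rewrite /s le_max lexx orbT.
have s0 : 0 < s by exact: lt_le_trans ps.
have qq1 : q <= q1.
  rewrite /q1 mulrA ler_pdivlMr// -ler_pdivrMr//.
  by rewrite /s le_max lexx.
(* If s = p this amounts to p <= q1. Otherwise q1 = q, and after clearing denominators it is the
   hypothesis 1/p - 1/(m+1) <= 1/q. *)
have sq : (s - 1) * p <= q1 * (p - 1).
  rewrite /q1 /s; have [le1|/ltW le1] := leP (q * m%:R / m.+1%:R) p.
    rewrite [leLHS]mulrC -mulrA ler_pM2l// -[leLHS]mul1r ler_pM2r ?subr_gt0//.
    by rewrite ler_pdivlMr// mul1r nm lerDl.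
  have -> : q * m%:R / m.+1%:R * (m.+1%:R / m%:R) = q by field; rewrite !gt_eqF.
  have : (p^-1 - m.+1%:R^-1) * (p * q * m.+1%:R) <= q^-1 * (p * q * m.+1%:R).
    by rewrite ler_pM2r// !mulr_gt0.
  have -> : (p^-1 - m.+1%:R^-1) * (p * q * m.+1%:R) = q * m.+1%:R - p * q.
    by field; rewrite !gt_eqF.
  have -> : q^-1 * (p * q * m.+1%:R) = p * m.+1%:R by field; rewrite !gt_eqF.
  move=> H; rewrite -(ler_pM2r nR0).
  have -> : (q * m%:R / m.+1%:R - 1) * p * m.+1%:R = q * m%:R * p - m.+1%:R * p.
    by field; rewrite !gt_eqF.
  by move: H; rewrite nm !mulrDr !mulr1; lra.
(* Dividing |u| by A before interpolating makes both integrals at most 1; A >= N takes care of the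
   exponent p. *)
set A := 3 * s * N.
have A0 : 0 < A by rewrite !mulr_gt0.
have Ai0 : 0 <= A^-1 by rewrite invr_ge0 ltW.
have pw (r : R) : measurable_fun [set: V] (fun v => `|u v| `^ r).
  by apply: (measurableT_comp (measurable_powR r)); exact: measurableT_comp.
have H := @le_integral_lin3 _ _ (lam m.+1) (fun v => `|u v| `^ q) (fun v => `|u v| `^ p)
  (fun v => `|u v| `^ q1) (fun v => `|u v| `^ p) (A `^ q * A^-1 `^ p) (A `^ q * A^-1 `^ q1) 0
  (N `^ p) (A `^ q1) (N `^ p) (pw _) (pw _) (pw _) (pw _) (fun v => powR_ge0 _ _)
  (fun v => powR_ge0 _ _) (fun v => powR_ge0 _ _) (fun v => powR_ge0 _ _).
apply: le_trans (H _ _ _ _ uN (gn_full sE ps sq) uN) _ => //.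
- by rewrite mulr_ge0 ?powR_ge0.
- by rewrite mulr_ge0 ?powR_ge0.
- move=> v; rewrite mul0r addr0.
  have := powR_between (mulr_ge0 (normr_ge0 (u v)) Ai0) p0 (ltW pq) qq1.
  rewrite -(ler_pM2l (powR_gt0 q A0)) !(powRM _ (normr_ge0 (u v)) Ai0) => H'.
  have e : A `^ q * A^-1 `^ q = 1.
    by rewrite -powRM ?(ltW A0)// mulfV ?gt_eqF// powR1.
  have e' : `|u v| `^ q = A `^ q * (`|u v| `^ q * A^-1 `^ q).
    by rewrite mulrCA e mulr1.
  by rewrite e' (le_trans H')// le_eqVlt; apply/orP; left; apply/eqP; ring.
rewrite lee_fin mul0r addr0 -!mulrA -mulrDr mulrC ler_pM2r ?powR_gt0//.
have h1 : 1 `^ p = 1 :> R by rewrite powR1.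
have e1 : A^-1 `^ p * N `^ p <= 1.
  rewrite -powRM ?(ltW N0)// -[leRHS]h1.
  rewrite ge0_ler_powR ?nnegrE ?(ltW p0)//; first by rewrite mulr_ge0// ltW.
  rewrite mulrC ler_pdivrMr// mul1r /A ler_peMl ?(ltW N0)//.
  by move: p1 ps; lra.
have e2 : A^-1 `^ q1 * A `^ q1 = 1.
  by rewrite -powRM ?(ltW A0)// mulVf ?gt_eqF// powR1.
by rewrite e2; lra.
Qed.

End gagliardo_nirenberg.

(** * Local integrability of potentials *)

Section schur_test.
Context {R : realType} {d1 d2 : measure_display}
  {T : measurableType d1} {X : measurableType d2}
  (m1 : {sigma_finite_measure set T -> \bar R})
  (m : {sigma_finite_measure set X -> \bar R}).
Variables (k : T * (X * X) -> R).
Hypotheses (mk : measurable_fun setT k) (k0 : forall w, 0 <= k w).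

Let mk' : measurable_fun setT (fun w : X * (T * X) => k (w.2.1, (w.2.2, w.1))).
Proof.
apply: (measurableT_comp mk); apply: measurable_fun_pair.
  exact: (measurableT_comp measurable_fst measurable_snd).
apply: measurable_fun_pair; last exact: measurable_fst.
exact: (measurableT_comp measurable_snd measurable_snd).
Qed.

Let kg (w : X -> R) (x : T * X) : \bar R := (\int[m]_z' (k (x.1, (x.2, z')) * w z')%:E)%E.

Let mkw (w : X -> R) : measurable_fun setT w ->
  measurable_fun setT (fun x : X * (T * X) => (k (x.2.1, (x.2.2, x.1)) * w x.1)%:E).
Proof.
move=> mw; apply/measurable_EFinP; apply: measurable_funM => //.
exact: (measurableT_comp mw measurable_fst).
Qed.

Let mkg (w : X -> R) : measurable_fun setT w -> measurable_fun setT (kg w).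
Proof. by move=> mw; exact: (measurable_param_integral m (mkw mw)). Qed.

Let kg0 (w : X -> R) : (forall z, 0 <= w z) -> forall x, (0 <= kg w x)%E.
Proof. by move=> w0 x; apply: integral_ge0 => z' _; rewrite lee_fin mulr_ge0. Qed.

Let mkz (w : X -> R) t z : measurable_fun setT w ->
  measurable_fun setT (fun z' => (k (t, (z, z')) * w z')%:E).
Proof.
move=> mw; have h : measurable_fun setT (fun z' : X => (z', (t, z))).
  exact: measurable_fun_pair.
exact: (measurableT_comp (mkw mw) h).
Qed.

Lemma measurable_schur (g : X -> R) : measurable_fun setT g ->
  measurable_fun setT
    (fun z => (\int[m1]_t \int[m]_z' (k (t, (z, z')) * `|g z'|)%:E)%E).
Proof.
move=> mg; have mag : measurable_fun setT (fun z => `|g z|) by exact: measurableT_comp.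
exact: (measurable_param_integral m1 (mkg mag)).
Qed.

(** Since |g| <= 1 + |g|^p, the integral over B splits in two: the constant 1 uses the bound on the
    kernel in its second variable and gives m(B) [kap], while |g|^p uses the bound in the first
    variable after exchanging integrals. Integrability of [kap] in t finishes. *)
Lemma schur_locint (kap : T -> \bar R) (g : X -> R) (p : R) (B : set X) :
  measurable_fun setT kap ->
  (forall t z, \int[m]_z' (k (t, (z, z')))%:E <= kap t)%E ->
  (forall t z', \int[m]_z (k (t, (z, z')))%:E <= kap t)%E ->
  (\int[m1]_t kap t < +oo)%E ->
  measurable_fun setT g -> 1 <= p -> (\int[m]_z (`|g z| `^ p)%:E < +oo)%E ->
  measurable B -> (m B < +oo)%E ->
  (\int[m]_(z in B) \int[m1]_t \int[m]_z' (k (t, (z, z')) * `|g z'|)%:E < +oo)%E.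
Proof.
move=> mkap k1 k2 kapfin mg p1 gp mB Bfin.
have mag : measurable_fun setT (fun z => `|g z|) by exact: measurableT_comp.
have mgp : measurable_fun setT (fun z => `|g z| `^ p).
  exact: (measurableT_comp (measurable_powR p) mag).
have m1B : measurable_fun setT (\1_B : X -> R) by exact: measurable_indic.
have kap0 t : (0 <= kap t)%E.
  have [/eqP m0|/set0P[z _]] := eqVneq [set: X] set0.
    by apply: le_trans (k1 t point); apply: integral_ge0 => z _; rewrite lee_fin.
  by apply: le_trans (k1 t z); apply: integral_ge0 => z' _; rewrite lee_fin.
pose a := kg (fun z => `|g z|); pose b := kg (fun z => `|g z| `^ p).
have ma : measurable_fun setT a by exact: mkg.
have mb : measurable_fun setT b by exact: mkg.
have a0 x : (0 <= a x)%E by exact: kg0.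
have b0 x : (0 <= b x)%E by apply: kg0 => z; exact: powR_ge0.
have ind0 z : (0 <= (\1_B z : R)%:E)%E by rewrite lee_fin.
pose F (x : X * T) := ((\1_B x.1)%:E * a (x.2, x.1))%E.
have mF : measurable_fun setT F.
  apply: emeasurable_funM.
    by apply/measurable_EFinP; exact: (measurableT_comp m1B measurable_fst).
  by apply: (measurableT_comp ma); exact: measurable_fun_pair.
have F0 x : (0 <= F x)%E by exact: mule_ge0.
rewrite integral_mkcond (_ : (fun _ => _) \_ B =
    fun z => (\int[m1]_t F (z, t))%E); last first.
  apply/funext => z; rewrite epatch_indic /F /= muleC ge0_integralZl//.
  exact: (measurableT_comp ma).
rewrite (@fubini_tonelli _ _ _ _ _ m m1 F mF F0).
pose c := (m B + \int[m]_z (`|g z| `^ p)%:E)%E.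
have c0 : (0 <= c)%E by apply: adde_ge0 => //; apply: integral_ge0 => z _; rewrite lee_fin powR_ge0.
have cfin : c \is a fin_num by rewrite ge0_fin_numE// lte_add_pinfty.
apply: (@le_lt_trans _ _ (\int[m1]_t (c * kap t))%E); last first.
  by rewrite ge0_integralZl// lte_mul_pinfty.
apply: ge0_le_integral => //.
- by move=> t _; exact: integral_ge0.
- exact: (measurable_param_integral m mF).
- exact: measurable_funeM.
move=> t _.
have abt z : (F (z, t) <= (\1_B z)%:E * kap t + b (t, z))%E.
  have ab : (a (t, z) <= kap t + b (t, z))%E.
    apply: le_trans (leeD2r _ (k1 t z)).
    rewrite -ge0_integralD//=; last 4 first.
    - by move=> z' _; rewrite lee_fin.
    - have := mkz t z (@measurable_cst _ _ X R setT (1 : R)).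
      by under eq_fun do rewrite mulr1.
    - by move=> z' _; rewrite lee_fin mulr_ge0 ?powR_ge0.
    - exact: mkz.
    apply: ge0_le_integral => //.
    - by move=> z' _; rewrite lee_fin mulr_ge0.
    - exact: mkz.
    - apply: emeasurable_funD; last exact: mkz.
      have := mkz t z (@measurable_cst _ _ X R setT (1 : R)).
      by under eq_fun do rewrite mulr1.
    move=> z' _; rewrite -EFinD lee_fin -{2}(mulr1 (k _)) -mulrDr ler_wpM2l//.
    have [g1|/ltW g1] := leP `|g z'| 1; first by rewrite (le_trans g1)// lerDl powR_ge0.
    by rewrite (le_trans (le1r_powR g1 p1))// lerDr.
  rewrite /F /= indicE; case: (z \in B); first by rewrite !mul1e.
  by rewrite !mul0e add0e.
apply: (@le_trans _ _ (\int[m]_z ((\1_B z)%:E * kap t + b (t, z))))%E.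
  apply: ge0_le_integral => //.
  - by apply: (measurableT_comp mF).
  - apply: emeasurable_funD.
      by apply: emeasurable_funM => //; exact/measurable_EFinP.
    exact: (measurableT_comp mb).
rewrite ge0_integralD//; first last.
- exact: (measurableT_comp mb).
- by apply: emeasurable_funM => //; exact/measurable_EFinP.
- by move=> z _; exact: mule_ge0.
rewrite /c ge0_muleDl//; last first.
  by apply: integral_ge0 => z _; rewrite lee_fin powR_ge0.
rewrite leeD//.
  rewrite ge0_integralZr//; last exact/measurable_EFinP.
  by rewrite integral_indic// setIT.
have -> : ((\int[m]_z (`|g z| `^ p)%:E) * kap t = \int[m]_z (kap t * (`|g z| `^ p)%:E))%E.
  by rewrite muleC ge0_integralZl//; exact/measurable_EFinP.
pose H (x : X * X) := (k (t, x) * `|g x.2| `^ p)%:E.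
have mH : measurable_fun setT H.
  apply/measurable_EFinP; apply: measurable_funM.
    by apply: (measurableT_comp mk); exact: measurable_fun_pair.
  exact: (measurableT_comp mgp measurable_snd).
rewrite /b /kg /= (@fubini_tonelli _ _ _ _ _ m m H mH)//; last first.
  by move=> x; rewrite lee_fin mulr_ge0 ?powR_ge0.
apply: ge0_le_integral => //.
- by move=> z _; apply: integral_ge0 => z' _; rewrite lee_fin mulr_ge0 ?powR_ge0.
- exact: (measurable_param_integral m mH).
- by apply: measurable_funeM; exact/measurable_EFinP.
move=> z' _; rewrite /H /=.
under eq_integral do rewrite mulrC EFinM.
rewrite ge0_integralZl//.
- by rewrite muleC lee_wpmul2r ?lee_fin ?powR_ge0.
- by apply/measurable_EFinP; apply: (measurableT_comp mk); apply: measurable_fun_pair.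
- by move=> x _; rewrite lee_fin.
Qed.

End schur_test.

(** Real-valued integrals take the value 0 when the extended one is infinite, and [fine] never
    increases absolute values; hence the bound holds without any integrability assumption. *)
Lemma iterated_integral_le (R : realType) (d1 d2 : measure_display)
    (T : measurableType d1) (X : measurableType d2)
    (m1 : {sigma_finite_measure set T -> \bar R})
    (m : {sigma_finite_measure set X -> \bar R})
    (th : T -> R) (k : T * X -> R) (g : X -> R) :
  measurable_fun setT th -> (forall t, 0 <= th t) ->
  measurable_fun setT k -> (forall w, 0 <= k w) -> measurable_fun setT g ->
  (`|\int[m1]_t (th t * \int[m]_x (k (t, x) * g x))|%:E <=
   \int[m1]_t \int[m]_x (th t * k (t, x) * `|g x|)%:E)%E.
Proof.
move=> mth th0 mk k0 mg.
have fineE (x : \bar R) : (`|fine x|%:E <= `|x|)%E by case: x => [r| |]//=; rewrite leey.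
have msw : measurable_fun setT (fun w : X * T => (w.2, w.1)) by exact: measurable_fun_pair.
have mkg (h : X -> R) : measurable_fun setT h ->
    measurable_fun setT (fun w : X * T => (k (w.2, w.1) * h w.1)%:E).
  move=> mh; apply/measurable_EFinP; apply: measurable_funM.
    exact: (measurableT_comp mk msw).
  exact: (measurableT_comp mh measurable_fst).
have mag : measurable_fun setT (fun z => `|g z|) by exact: measurableT_comp.
have mI (h : X -> R) : measurable_fun setT h ->
    measurable_fun setT (fun t => (\int[m]_x (k (t, x) * h x)%:E)%E).
  by move=> mh; exact: (measurable_param_integral m (mkg h mh)).
have mkt t (h : X -> R) : measurable_fun setT h ->
    measurable_fun setT (fun x => (k (t, x) * h x)%:E).
  move=> mh; have mt : measurable_fun setT (fun x : X => (x, t)) by exact: measurable_fun_pair.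
  exact: (measurableT_comp (mkg h mh) mt).
have Z t : (\int[m]_x (th t * k (t, x) * `|g x|)%:E =
    (th t)%:E * \int[m]_x (k (t, x) * `|g x|)%:E)%E.
  rewrite -ge0_integralZl ?lee_fin//; last 2 first.
  - exact: mkt.
  - by move=> x _; rewrite lee_fin mulr_ge0.
  by apply: eq_integral => x _; rewrite -EFinM mulrA.
under [leRHS]eq_integral do rewrite Z.
apply: (le_trans (fineE _)); apply: (le_trans (le_abse_integral _ measurableT _)).
  apply/measurable_EFinP; apply: measurable_funM => //.
  exact: (measurableT_comp (@fine_measurable R setT measurableT) (mI g mg)).
apply: ge0_le_integral => //.
- apply: measurableT_comp => //; apply/measurable_EFinP; apply: measurable_funM => //.
  exact: (measurableT_comp (@fine_measurable R setT measurableT) (mI g mg)).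
- apply: emeasurable_funM; last exact: mI.
  exact/measurable_EFinP.
move=> t _; rewrite /= normrM EFinM (ger0_norm (th0 t)) lee_wpmul2l ?lee_fin//.
apply: (le_trans (fineE _)).
apply: (le_trans (le_abse_integral _ measurableT (mkt t g mg))).
rewrite le_eqVlt; apply/orP; left; apply/eqP; apply: eq_integral => x _.
by rewrite /= normrM ger0_norm.
Qed.

(** * Gaussian integrals and the Gamma integral at 1/2 *)

Section gaussian.
Context {R : realType}.
Local Notation leb := (@lebesgue_measure R).
Local Notation lam := (@lebesgue_rV R).

(** The integrand is a multiple of the normal density with mean c and variance 1/(2a). *)
Lemma integral_gauss (a c : R) : 0 < a ->
  (\int[leb]_x (expR (- (a * (x - c) ^+ 2)))%:E = (Num.sqrt (pi / a))%:E)%E.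
Proof.
move=> a0; pose s := Num.sqrt (2 * a)^-1.
have i0 : 0 < (2 * a)^-1 by rewrite invr_gt0 mulr_gt0.
have s0 : s != 0 by rewrite gt_eqF// sqrtr_gt0.
have s2 : s ^+ 2 = (2 * a)^-1 by rewrite sqr_sqrtr// ltW.
have pk := normal_peak_gt0 s0.
have E x : expR (- (a * (x - c) ^+ 2)) = (normal_peak s)^-1 * normal_pdf c s x.
  rewrite normal_pdfE// mulKf ?gt_eqF// /normal_fun s2; congr expR.
  by field; rewrite gt_eqF.
under eq_integral do rewrite E EFinM.
rewrite integralZl//; last exact: integrable_normal_pdf.
rewrite integral_normal_pdf mule1 /normal_peak invrK s2; congr (_%:E); congr Num.sqrt.
by rewrite -mulr_natr; field; rewrite gt_eqF.
Qed.

Lemma ge0_integral_rV_prod n (F : 'I_n -> R -> R) :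
  (forall i, measurable_fun setT (F i)) -> (forall i x, 0 <= F i x) ->
  (\int[lam n]_v (\prod_i F i (v ord0 i))%:E = \prod_i \int[leb]_x (F i x)%:E)%E.
Proof.
elim: n F => [|n ih] F mF F0.
  rewrite big_ord0 /= integral_dirac//.
    by rewrite diracT mul1e big_ord0.
  by apply/measurable_EFinP; under eq_fun do rewrite big_ord0; exact: measurable_cst.
have mco (i : 'I_n.+1) : measurable_fun [set: 'rV[R]_n.+1] (fun v => F i (v ord0 i)).
  exact: (measurableT_comp (mF i) (measurable_rV_coord i)).
have mP : measurable_fun [set: 'rV[R]_n.+1] (fun v => (\prod_i F i (v ord0 i))%:E).
  by apply/measurable_EFinP; apply: measurable_prod.
have P0 (v : 'rV[R]_n.+1) : (0 <= (\prod_i F i (v ord0 i))%:E)%E.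
  by rewrite lee_fin prodr_ge0.
rewrite (ge0_integral_rV_ins ord0)// big_ord_recl.
have E z : (\prod_i F i (rV_ins ord0 z ord0 i))%:E =
    ((F ord0 z.1)%:E * (\prod_(i < n) F (lift ord0 i) (z.2 ord0 i))%:E)%E.
  case: z => x y; rewrite big_ord_recl rV_ins_eq -EFinM; congr (_ * _)%:E.
  by apply: eq_bigr => i _; rewrite rV_ins_lift.
under eq_integral do rewrite E.
have m2 : measurable_fun [set: 'rV[R]_n] (fun y => (\prod_(i < n) F (lift ord0 i) (y ord0 i))%:E).
  apply/measurable_EFinP; apply: measurable_prod => i _.
  exact: (measurableT_comp (mF _) (measurable_rV_coord i)).
have p2 (y : 'rV[R]_n) : (0 <= (\prod_(i < n) F (lift ord0 i) (y ord0 i))%:E)%E.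
  by rewrite lee_fin prodr_ge0.
pose H (z : measurableTypeR R * 'rV[R]_n) :=
  ((F ord0 z.1)%:E * (\prod_(i < n) F (lift ord0 i) (z.2 ord0 i))%:E)%E.
have mH : measurable_fun setT H.
  apply: emeasurable_funM; last exact: (measurableT_comp m2 measurable_snd).
  by apply/measurable_EFinP; exact: (measurableT_comp (mF _) measurable_fst).
rewrite (@fubini_tonelli1 _ _ _ _ _ leb (lam n) H mH); last first.
  by move=> z; rewrite mule_ge0// lee_fin.
have Z x : (\int[lam n]_y H (x, y) = (F ord0 x)%:E *
    \int[lam n]_y (\prod_(i < n) F (lift ord0 i) (y ord0 i))%:E)%E.
  by rewrite /H /= ge0_integralZl// lee_fin.
transitivity (\int[leb]_x ((F ord0 x)%:E *
    \int[lam n]_y (\prod_(i < n) F (lift ord0 i) (y ord0 i))%:E))%E.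
  by apply: eq_integral => x _; exact: Z.
rewrite ge0_integralZr//.
- by rewrite (ih (fun i => F (lift ord0 i))).
- by apply/measurable_EFinP; exact: mF.
- by move=> x _; rewrite lee_fin.
- exact: integral_ge0.
Qed.

Let oneDsqr_pos (x : R) : 0 < oneDsqr x.
Proof. exact: lt_le_trans (oneDsqr_ge1 x). Qed.

(* Tonelli: t^(-1/2) is a multiple of the integral of exp(-t x^2) over x, and
   integrating exp(-t (1 + x^2)) in t leaves 1 / (1 + x^2). *)
Lemma gamma_half_lty :
  (\int[leb]_t (\1_`]0%R, +oo[ t * (t `^ (- (1 / 2)) * expR (- t)))%:E < +oo)%E.
Proof.
pose H (w : measurableTypeR R * measurableTypeR R) : \bar R :=
  (\1_`]0%R, +oo[ w.1 * expR (- (w.1 * (1 + w.2 ^+ 2))))%:E.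
have mH : measurable_fun setT H.
  apply/measurable_EFinP; apply: measurable_funM.
    apply: (measurableT_comp _ measurable_fst).
    exact: measurable_indic.
  apply: measurableT_comp => //; apply: measurableT_comp => //.
  apply: measurable_funM; first exact: measurable_fst.
  by apply: measurable_funD => //; apply: measurable_funX; exact: measurable_snd.
have H0 w : (0 <= H w)%E by rewrite lee_fin mulr_ge0 ?expR_ge0.
have E t : ((\1_`]0%R, +oo[ t * (t `^ (- (1 / 2)) * expR (- t)))%:E =
    (Num.sqrt pi)^-1%:E * \int[leb]_x H (t, x))%E.
  rewrite /H /= indicE; have [|] := boolP (t \in _); last first.
    by rewrite mul0r => _; under eq_integral do rewrite mul0r; rewrite integral0 mule0.
  rewrite inE/= in_itv/= andbT => t0; rewrite mul1r.
  under eq_integral do rewrite mul1r.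
  have e x : expR (- (t * (1 + x ^+ 2))) = expR (- t) * expR (- (t * (x - 0) ^+ 2)).
    by rewrite -expRD; congr expR; rewrite subr0; ring.
  under eq_integral do rewrite e EFinM.
  have mg : measurable_fun [set: R] (fun x : R => (expR (- (t * (x - 0) ^+ 2)))%:E).
    apply/measurable_EFinP; apply: measurableT_comp => //; apply: measurableT_comp => //.
    by apply: measurable_funM => //; apply: measurable_funX; exact: measurable_funB.
  rewrite ge0_integralZl ?lee_fin ?expR_ge0//.
  rewrite integral_gauss// -!EFinM; congr (_%:E).
  have -> : t `^ (- 2^-1) = (Num.sqrt t)^-1 by rewrite powRN powR12_sqrt ?(ltW t0).
  rewrite mul1r sqrtrM ?pi_ge0// sqrtrV ?(ltW t0)//.
  have : Num.sqrt (pi : R) != 0 by rewrite gt_eqF// sqrtr_gt0 pi_gt0.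
  have : Num.sqrt t != 0 by rewrite gt_eqF// sqrtr_gt0.
  by move=> h1 h2; field; rewrite h1 h2.
under eq_integral do rewrite E.
have ssp0 : 0 <= (Num.sqrt (pi : R))^-1 by rewrite invr_ge0.
rewrite ge0_integralZl//; last 2 first.
- exact: (@measurable_fun_fubini_tonelli_F _ _ _ _ _ leb H mH H0).
- by move=> t _; apply: integral_ge0 => x _; exact: H0.
rewrite lte_mul_pinfty// (@fubini_tonelli _ _ _ _ _ leb leb H mH H0).
apply: (@le_lt_trans _ _ (\int[leb]_x ((oneDsqr x)^-1)%:E)%E).
  apply: ge0_le_integral => //.
  - by move=> x _; apply: integral_ge0 => t _; exact: H0.
  - exact: (@measurable_fun_fubini_tonelli_G _ _ _ _ _ leb H mH H0).
  - apply/measurable_EFinP; apply: continuous_measurable_fun.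
    exact: continuous_oneDsqrV.
  move=> x _; have r0 : 0 < oneDsqr x by exact: oneDsqr_pos.
  apply: (@le_trans _ _ (\int[leb]_t ((oneDsqr x)^-1%:E * (exponential_pdf (oneDsqr x) t)%:E))%E).
    apply: ge0_le_integral => //.
    - exact: (measurableT_comp mH).
    - by apply: measurable_funeM; apply/measurable_EFinP; exact: measurable_exponential_pdf.
    move=> t _; rewrite /H/= -EFinM lee_fin indicE.
    have [|_] := boolP (t \in _); last first.
      by rewrite mul0r mulr_ge0// ?invr_ge0 ?(ltW r0)// exponential_pdf_ge0// ltW.
    rewrite inE/= in_itv/= andbT => t0; rewrite mul1r exponential_pdfE ?(ltW t0)//.
    by rewrite mulKf ?gt_eqF// /oneDsqr mulrC mulNr.
  have mexp : measurable_fun [set: R] (fun t => (exponential_pdf (oneDsqr x) t)%:E).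
    by apply/measurable_EFinP; exact: measurable_exponential_pdf.
  have exp0 t : [set: R] t -> (0 <= (exponential_pdf (oneDsqr x) t)%:E)%E.
    by move=> _; rewrite lee_fin exponential_pdf_ge0// ltW.
  rewrite (@ge0_integralZl _ _ _ leb setT measurableT _ mexp _ exp0); last first.
    by rewrite lee_fin invr_ge0 ltW.
  by rewrite integral_exponential_pdf// mule1.
have o0 (x : R) : 0 <= (oneDsqr x)^-1 by rewrite invr_ge0 ltW.
have oc : continuous (fun x : R => (oneDsqr x)^-1) by exact: continuous_oneDsqrV.
rewrite ge0_symfun_integralT//=; last by move=> x; rewrite /oneDsqr/= sqrrN.
rewrite (_ : [set x | _] = `[0%R, +oo[%classic); last first.
  by apply/seteqP; split => x /=; rewrite in_itv/= andbT.
by rewrite integral0y_oneDsqr ltry.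
Qed.

End gaussian.

Lemma measurable_invr (R : realType) : measurable_fun [set: R] (fun x : R => x^-1).
Proof.
rewrite (_ : (fun x => _) = fun x : R => x * (x ^+ 2) `^ (-1)); last first.
  apply/funext => x; rewrite powR_inv1 ?sqr_ge0//.
  have [->|x0] := eqVneq x 0; first by rewrite invr0 mul0r.
  by rewrite expr2 invfM mulVKf.
apply: measurable_funM => //.
by apply: (measurableT_comp (measurable_powR (-1))); exact: measurable_funX.
Qed.

(** * Hyperbolic functions *)

Section hyperbolic.
Context {R : realType}.
Implicit Types t : R.

Lemma cosh_gt0 t : 0 < cosh t.
Proof. by rewrite divr_gt0// addr_gt0// expR_gt0. Qed.

Lemma sinh_gt0 t : 0 < t -> 0 < sinh t.
Proof. by move=> t0; rewrite divr_gt0// subr_gt0 ltr_expR gtrN. Qed.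

Lemma cosh_ge_expR t : expR t / 2 <= cosh t.
Proof. by rewrite ler_pM2r ?invr_gt0// lerDl expR_ge0. Qed.

Lemma cosh_ge1 t : 1 <= cosh t.
Proof.
rewrite ler_pdivlMr// mul1r -subr_ge0.
have e0 := expR_gt0 t; rewrite expRN.
have -> : expR t + (expR t)^-1 - 2 = (expR t - 1) ^+ 2 / expR t.
  by field; rewrite gt_eqF.
by rewrite divr_ge0 ?sqr_ge0// ltW.
Qed.

Lemma sinh2 t : sinh (2 * t) = 2 * sinh t * cosh t.
Proof.
rewrite /sinh /cosh mulr_natl mulr2n opprD !expRD.
by field.
Qed.

(** Double-angle formulas: 2 coth(2t) = coth t + tanh t. The Gaussian in x - x' of the kernel
    therefore has rate coth(t)/4. *)
Lemma coth_tanh t : 0 < t -> 2 * coth (2 * t) - tanh t = cosh t / sinh t.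
Proof.
move=> t0; rewrite /coth /tanh sinh2.
have s0 := lt0r_neq0 (sinh_gt0 t0); have c0 := lt0r_neq0 (cosh_gt0 t).
have -> : cosh (2 * t) = cosh t ^+ 2 + sinh t ^+ 2.
  by rewrite /sinh /cosh mulr_natl mulr2n opprD !expRD; field.
by field; rewrite s0 c0.
Qed.

Lemma measurable_cosh : measurable_fun [set: R] (@cosh R).
Proof.
apply: measurable_funM => //; apply: measurable_funD => //.
exact: measurableT_comp.
Qed.

Lemma measurable_sinh : measurable_fun [set: R] (@sinh R).
Proof.
apply: measurable_funM => //; apply: measurable_funB => //.
exact: measurableT_comp.
Qed.

End hyperbolic.

Section product_sigma_finite.
Context {R : realType} (d : nat).
Local Notation mZ := (measurableTypeR R * 'rV[R]_d)%type.
Local Notation mu := (@lebesgue_measure R \x lebesgue_rV d)%E.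

Lemma measurable_preimage_cube k : measurable (@rV_cons R d @^-1` rV_cube k : set mZ).
Proof.
rewrite -[X in measurable X]setTI; apply: measurable_rV_cons => //.
exact: measurable_rV_cube.
Qed.

Lemma preimage_cube_lty k : (mu (@rV_cons R d @^-1` rV_cube k) < +oo)%E.
Proof. exact: (@lebesgue_rV_cube_lty R d.+1 k). Qed.

(* The sigma-finite structure of the library on products is only found for
   probabilities, hence this alias. *)
Definition lebesgue_Z : set mZ -> \bar R := mu.

HB.instance Definition _ := Measure.on lebesgue_Z.

Let lebesgue_Z_sigma_finite : sigma_finite setT lebesgue_Z.
Proof.
exists (fun k => @rV_cons R d @^-1` rV_cube k) => [|k].
  by rewrite -preimage_bigcup rV_cube_cover preimage_setT.
by split; [exact: measurable_preimage_cube|exact: preimage_cube_lty].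
Qed.

HB.instance Definition _ := Measure_isSigmaFinite.Build _ _ _ lebesgue_Z
  lebesgue_Z_sigma_finite.

End product_sigma_finite.

(** * The heat kernel and local integrability of potentials *)

Section heat_kernel.
Context {R : realType} (d : nat).
Local Notation Z := (R * 'rV[R]_d)%type.
Local Notation mZ := (measurableTypeR R * 'rV[R]_d)%type.
Local Notation leb := (@lebesgue_measure R).
Local Notation mu := (leb \x lebesgue_rV d)%E.

Lemma sqnormBC (x y : 'rV[R]_d) : sqnorm (x - y) = sqnorm (y - x).
Proof. by rewrite /sqnorm; apply: eq_bigr => j _; rewrite !mxE -opprB sqrrN. Qed.

Lemma measurable_sqnorm (e : R) :
  measurable_fun [set: measurableTypeR R * (mZ * mZ)]
    (fun w => sqnorm (w.2.1.2 + e *: w.2.2.2)).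
Proof.
have H : measurable_fun [set: measurableTypeR R * (mZ * mZ)]
    (fun w => \sum_(j < d) (w.2.1.2 ord0 j + e * w.2.2.2 ord0 j) ^+ 2).
  apply: measurable_sum => j; apply: measurable_funX; apply: measurable_funD.
    apply: (measurableT_comp (measurable_rV_coord j)).
    apply: (measurableT_comp measurable_snd).
    exact: (measurableT_comp measurable_fst measurable_snd).
  apply: measurable_funM => //; apply: (measurableT_comp (measurable_rV_coord j)).
  apply: (measurableT_comp measurable_snd).
  exact: (measurableT_comp measurable_snd measurable_snd).
move: H; congr measurable_fun; apply/funext => w.
by apply: eq_bigr => j _; rewrite !mxE.
Qed.

Lemma measurable_heat_kernel :
  measurable_fun [set: measurableTypeR R * (mZ * mZ)]
    (fun w => heat_kernel w.1 w.2.1 w.2.2).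
Proof.
have mt (f : R -> R) : measurable_fun [set: R] f ->
    measurable_fun [set: measurableTypeR R * (mZ * mZ)] (fun w => f w.1).
  by move=> mf; exact: (measurableT_comp mf measurable_fst).
have m2 : measurable_fun [set: R] (fun t : R => 2 * t) by exact: measurable_funM.
have mV (f : R -> R) : measurable_fun [set: R] f ->
    measurable_fun [set: R] (fun t => (f t)^-1).
  by move=> mf; exact: (measurableT_comp (@measurable_invr R) mf).
have mtanh : measurable_fun [set: R] (@tanh R).
  by apply: measurable_funM; [exact: measurable_sinh|exact: (mV _ measurable_cosh)].
have mcoth : measurable_fun [set: R] (@coth R).
  by apply: measurable_funM; [exact: measurable_cosh|exact: (mV _ measurable_sinh)].
have mrho : measurable_fun [set: measurableTypeR R * (mZ * mZ)]
    (fun w => w.2.1.1 - w.2.2.1 : R).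
  apply: measurable_funB.
    apply: (measurableT_comp measurable_fst).
    exact: (measurableT_comp measurable_fst measurable_snd).
  apply: (measurableT_comp measurable_fst).
  exact: (measurableT_comp measurable_snd measurable_snd).
apply: measurable_funM; first apply: measurable_funM; first apply: measurable_funM.
- exact: measurable_cst.
- exact: (mt (fun t => t `^ _) (measurable_powR _)).
- apply: (mt (fun t => sinh (2 * t) `^ _)).
  apply: (measurableT_comp (measurable_powR _)).
  exact: (measurableT_comp measurable_sinh m2).
apply: measurableT_comp => //; apply: measurable_funB; first apply: measurable_funB.
- apply: measurable_funM.
    apply: (mt (fun t => - (1 / 4) * (2 * coth (2 * t) - tanh t))).
    apply: measurable_funM => //; apply: measurable_funB => //.
    by apply: measurable_funM => //; exact: (measurableT_comp mcoth m2).
  have := measurable_sqnorm (-1); congr measurable_fun.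
  by apply/funext => w; rewrite scaleN1r.
- apply: measurable_funM; first by apply: (mt (fun t => tanh t / 4)); exact: measurable_funM.
  have := measurable_sqnorm 1; congr measurable_fun.
  by apply/funext => w; rewrite scale1r.
- apply: measurable_funM; first exact: measurable_funX.
  by apply: (mt (fun t => (4 * t)^-1)); apply: mV; exact: measurable_funM.
Qed.

Lemma heat_kernel_ge0 (t : R) (z z' : Z) : 0 <= heat_kernel t z z'.
Proof. by rewrite !mulr_ge0 ?powR_ge0 ?expR_ge0. Qed.

Lemma integral_gauss_prod (a b : R) (z : Z) : 0 < a -> 0 < b ->
  (\int[mu]_z' (expR (- (b * (z.1 - z'.1) ^+ 2)) * expR (- (a * sqnorm (z.2 - z'.2))))%:E =
   (Num.sqrt (pi / b) * Num.sqrt (pi / a) ^+ d)%:E)%E.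
Proof.
move=> a0 b0.
pose F j (x : R) := expR (- (a * (x - z.2 ord0 j) ^+ 2)).
pose G (x : R) := expR (- (b * (x - z.1) ^+ 2)).
have mgauss (r c : R) : measurable_fun [set: R] (fun x : R => expR (- (r * (x - c) ^+ 2))).
  apply: measurableT_comp => //; apply: measurableT_comp => //.
  by apply: measurable_funM => //; apply: measurable_funX; exact: measurable_funB.
have E z' : (expR (- (b * (z.1 - z'.1) ^+ 2)) * expR (- (a * sqnorm (z.2 - z'.2))))%:E =
    ((G z'.1)%:E * (\prod_j F j (z'.2 ord0 j))%:E)%E.
  rewrite -EFinM; congr (_ * _)%:E; first by rewrite /G -sqrrN opprB.
  rewrite /F -expR_sum; congr expR; rewrite /sqnorm mulr_sumr -sumrN.
  by apply: eq_bigr => j _; rewrite !mxE -sqrrN opprB.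
pose H (w : mZ) := ((G w.1)%:E * (\prod_j F j (w.2 ord0 j))%:E)%E.
have mP : measurable_fun [set: 'rV[R]_d] (fun y => (\prod_j F j (y ord0 j))%:E).
  apply/measurable_EFinP; apply: measurable_prod => j _.
  exact: (measurableT_comp (mgauss _ _) (measurable_rV_coord j)).
have mH : measurable_fun setT H.
  apply: emeasurable_funM; last exact: (measurableT_comp mP measurable_snd).
  by apply/measurable_EFinP; exact: (measurableT_comp (mgauss _ _) measurable_fst).
have P0 (y : 'rV[R]_d) : (0 <= (\prod_j F j (y ord0 j))%:E)%E.
  by rewrite lee_fin prodr_ge0// => j _; exact: expR_ge0.
have G0 x : (0 <= (G x)%:E)%E by rewrite lee_fin expR_ge0.
transitivity (\int[mu]_w H w)%E; first by apply: eq_integral => w _; exact: E.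
rewrite (@fubini_tonelli1 _ _ _ _ _ leb (lebesgue_rV d) H mH); last first.
  by move=> w; exact: mule_ge0.
transitivity (\int[leb]_x ((G x)%:E * (Num.sqrt (pi / a) ^+ d)%:E))%E.
  apply: eq_integral => x _; rewrite /fubini_F /H /= ge0_integralZl//.
  rewrite ge0_integral_rV_prod//.
    under eq_bigr do rewrite integral_gauss//.
    by rewrite prodEFin prodr_const card_ord.
    by move=> j; exact: mgauss.
  by move=> j y; exact: expR_ge0.
rewrite ge0_integralZr//.
- by rewrite integral_gauss// -EFinM.
- by apply/measurable_EFinP; exact: mgauss.
Qed.

Lemma heat_kernelC (t : R) (z z' : Z) : heat_kernel t z z' = heat_kernel t z' z.
Proof.
by rewrite /heat_kernel sqnormBC [z.2 + _]addrC -[(z.1 - z'.1) ^+ 2]sqrrN opprB.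
Qed.

Let c1 : R := 2 `^ (- (d%:R + 2) / 2) * pi `^ (- (d%:R + 1) / 2).

(** The factor exp(-(tanh t / 4) |x + x'|^2) is at most 1 and is dropped, leaving a Gaussian in z -
    z'. *)
Let heat_kernel_le (t : R) (z z' : Z) : 0 < t ->
  heat_kernel t z z' <= c1 * t `^ (- (1 / 2)) * sinh (2 * t) `^ (- (d%:R / 2)) *
    (expR (- ((4 * t)^-1 * (z.1 - z'.1) ^+ 2)) *
     expR (- (cosh t / sinh t / 4 * sqnorm (z.2 - z'.2)))).
Proof.
move=> t0; rewrite /heat_kernel /c1 ler_wpM2l// ?mulr_ge0 ?powR_ge0//.
rewrite -expRD ler_expR coth_tanh// -subr_ge0.
set S := sqnorm (z.2 - _); set S' := sqnorm (z.2 + _).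
have -> : forall x y : R, - (x * (z.1 - z'.1) ^+ 2) - y * S -
  (- (1 / 4) * (cosh t / sinh t) * S - tanh t / 4 * S' - (z.1 - z'.1) ^+ 2 * x) =
  (4^-1 * (cosh t / sinh t) - y) * S + tanh t / 4 * S'.
  by move=> x y; field; rewrite gt_eqF// sinh_gt0.
have -> : 4^-1 * (cosh t / sinh t) - cosh t / sinh t / 4 = 0 by ring.
rewrite mul0r add0r mulr_ge0//; last by apply: sumr_ge0 => j _; exact: sqr_ge0.
by rewrite /tanh divr_ge0// divr_ge0// ltW ?sinh_gt0 ?cosh_gt0.
Qed.

(** The normalization of the kernel, the Gaussian integral in rho, those in the d variables x, and
    the 2 of 1/cosh t <= 2 exp(-t). *)
Definition heat_cst : R := c1 * Num.sqrt (4 * pi) * Num.sqrt (2 * pi) ^+ d * 2.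

Lemma heat_cst_ge0 : 0 <= heat_cst.
Proof. by rewrite !mulr_ge0 ?powR_ge0 ?exprn_ge0. Qed.

(** The factor t^(-1/2) cancels against the Gaussian integral in rho, and sinh(2t)^(-d/2) against
    those in x up to (cosh t)^(-d). This exponential decay, due to the confinement in x, makes the
    time integral of t^(-1/2) times the mass converge at infinity. *)
Lemma heat_kernel_mass (t : R) (z : Z) : (0 < d)%N -> 0 < t ->
  (\int[mu]_z' (heat_kernel t z z')%:E <= (heat_cst * expR (- t))%:E)%E.
Proof.
move=> d0 t0; have s0 := sinh_gt0 t0; have c0 := cosh_gt0 t.
have mz : measurable_fun [set: mZ] (fun z' : mZ => (t, (z, z')) : measurableTypeR R * (mZ * mZ)).
  by apply: measurable_fun_pair => //; exact: measurable_fun_pair.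
set A := c1 * t `^ (- (1 / 2)) * sinh (2 * t) `^ (- (d%:R / 2)).
have A0 : 0 <= A by rewrite !mulr_ge0 ?powR_ge0.
set a := cosh t / sinh t / 4; set b := (4 * t)^-1.
have a0 : 0 < a by apply: divr_gt0 => //; exact: divr_gt0.
have b0 : 0 < b by rewrite invr_gt0 mulr_gt0.
pose G (z' : Z) := expR (- (b * (z.1 - z'.1) ^+ 2)) * expR (- (a * sqnorm (z.2 - z'.2))).
have mG : measurable_fun [set: mZ] G.
  apply: measurable_funM; apply: measurableT_comp => //; apply: measurableT_comp => //.
    apply: measurable_funM => //; apply: measurable_funX; apply: measurable_funB => //.
  apply: measurable_funM => //; have := measurableT_comp (measurable_sqnorm (-1)) mz.
  by congr measurable_fun; apply/funext => w; rewrite /= scaleN1r.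
apply: (@le_trans _ _ (\int[mu]_z' (A%:E * (G z')%:E))%E).
  apply: ge0_le_integral => //.
  - by move=> z' _; rewrite lee_fin heat_kernel_ge0.
  - by apply/measurable_EFinP; exact: (measurableT_comp measurable_heat_kernel mz).
  - by apply: measurable_funeM; exact/measurable_EFinP.
  - by move=> z' _; rewrite -EFinM lee_fin; exact: heat_kernel_le.
rewrite ge0_integralZl ?lee_fin//; last 2 first.
- exact/measurable_EFinP.
- by move=> z' _; rewrite lee_fin mulr_ge0 ?expR_ge0.
rewrite integral_gauss_prod// -EFinM lee_fin.
have st0 : Num.sqrt t != 0 by rewrite gt_eqF// sqrtr_gt0.
have sh0 : 0 < sinh (2 * t) by rewrite sinh_gt0// mulr_gt0.
have e1 : t `^ (- (1 / 2)) * Num.sqrt (pi / b) = Num.sqrt (4 * pi).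
  rewrite powRN div1r powR12_sqrt ?(ltW t0)// /b invrK.
  have -> : pi * (4 * t) = (4 * pi) * t by ring.
  by rewrite sqrtrM ?mulr_ge0 ?pi_ge0// mulrCA mulVf// mulr1.
have e2 : sinh (2 * t) `^ (- (d%:R / 2)) * Num.sqrt (pi / a) ^+ d =
    (Num.sqrt (2 * pi) / cosh t) ^+ d.
  have -> : sinh (2 * t) `^ (- (d%:R / 2)) = (Num.sqrt (sinh (2 * t)))^-1 ^+ d.
    rewrite powRN [d%:R / 2]mulrC powRrM powR12_sqrt ?(ltW sh0)// powR_mulrn ?sqrtr_ge0//.
    by rewrite exprVn.
  rewrite -exprMn; congr (_ ^+ d).
  rewrite -sqrtrV ?(ltW sh0)// -sqrtrM ?invr_ge0 ?(ltW sh0)//.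
  have -> : (sinh (2 * t))^-1 * (pi / a) = (2 * pi) * (cosh t)^-1 ^+ 2.
    by rewrite sinh2 /a; field; rewrite !gt_eqF.
  by rewrite sqrtrM ?mulr_ge0 ?pi_ge0// sqrtr_sqr ger0_norm// invr_ge0 ltW.
have -> : A * (Num.sqrt (pi / b) * Num.sqrt (pi / a) ^+ d) =
    c1 * (t `^ (- (1 / 2)) * Num.sqrt (pi / b)) *
    (sinh (2 * t) `^ (- (d%:R / 2)) * Num.sqrt (pi / a) ^+ d) by rewrite /A; ring.
rewrite e1 e2 /heat_cst exprMn -!mulrA !ler_wpM2l ?exprn_ge0 ?mulr_ge0 ?powR_ge0//.
have ci1 : (cosh t)^-1 <= 1 by rewrite invf_le1// cosh_ge1.
have ci0 : 0 <= (cosh t)^-1 by rewrite invr_ge0 ltW.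
(* One factor 1/cosh t supplies the decay; the remaining d - 1 are at most 1. *)
apply: (@le_trans _ _ (cosh t)^-1).
  by case: d d0 => // n _; rewrite exprS ler_piMr// exprn_ile1.
rewrite -[leRHS]invrK lef_pV2 ?posrE//; last by rewrite invr_gt0 mulr_gt0// expR_gt0.
by rewrite invfM expRN invrK mulrC cosh_ge_expR.
Qed.

(** The indicator lets the time integral run over the whole line, so that the Schur test applies
    with Lebesgue measure itself. *)
Definition heat_theta (t : R) : R := \1_`]0%R, +oo[ t * t `^ (- (1 / 2)).

Lemma heat_theta_pos t : 0 < t -> heat_theta t = t `^ (- (1 / 2)).
Proof. by move=> t0; rewrite /heat_theta indicE mem_set ?mul1r//= in_itv/= t0. Qed.

Lemma heat_theta_neg t : t <= 0 -> heat_theta t = 0.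
Proof.
move=> t0; rewrite /heat_theta indicE memNset ?mul0r//= in_itv/= andbT.
by apply/negP; rewrite -leNgt.
Qed.

Lemma heat_theta_ge0 t : 0 <= heat_theta t.
Proof. by rewrite mulr_ge0 ?powR_ge0. Qed.

Lemma measurable_heat_theta : measurable_fun [set: measurableTypeR R] heat_theta.
Proof.
apply: measurable_funM; first exact: measurable_indic.
exact: measurable_powR.
Qed.

(** The kernel is real, so real and imaginary parts decouple. *)
Lemma Hpar_invsqrtE (g : Z -> R[i]) z :
  complex.Re (Hpar_invsqrt g z) = (Gamma (1 / 2))^-1 *
    \int[leb]_t (heat_theta t * \int[mu]_z' (heat_kernel t z z' * complex.Re (g z'))) /\
  complex.Im (Hpar_invsqrt g z) = (Gamma (1 / 2))^-1 *
    \int[leb]_t (heat_theta t * \int[mu]_z' (heat_kernel t z z' * complex.Im (g z'))).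
Proof.
have H (F : R -> R) : \int[leb]_(t in `]0%R, +oo[) (t `^ (- (1 / 2)) * F t) =
    \int[leb]_t (heat_theta t * F t).
  rewrite Rintegral_mkcond; apply: eq_Rintegral => t _.
  rewrite patchE; have [t0|t0] := ltP 0 t.
    by rewrite heat_theta_pos// mem_set//= in_itv/= t0.
  rewrite heat_theta_neg// mul0r memNset//= in_itv/= andbT.
  by apply/negP; rewrite -leNgt.
split; rewrite /Hpar_invsqrt /Cintegral /=.
  rewrite mul0r subr0; congr (_ * _); rewrite -H; apply: eq_Rintegral => t _.
  rewrite mul0r subr0; congr (_ * _); apply: eq_Rintegral => z' _.
  by case: (g z') => x y /=; rewrite mul0r subr0.
rewrite mul0r addr0; congr (_ * _); rewrite -H; apply: eq_Rintegral => t _.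
rewrite mul0r addr0; congr (_ * _); apply: eq_Rintegral => z' _.
by case: (g z') => x y /=; rewrite mul0r addr0.
Qed.

Lemma normc_ge_abs (c : R[i]) :
  `|complex.Re c| <= ComplexField.Normc.normc c /\
  `|complex.Im c| <= ComplexField.Normc.normc c.
Proof.
case: c => x y /=; rewrite /ComplexField.Normc.normc -!sqrtr_sqr.
by split; rewrite ler_wsqrtr// ?lerDl ?lerDr sqr_ge0.
Qed.

Lemma CLnorm_powR (p : R) (f : Z -> R[i]) : p != 0 ->
  (CLnorm p f `^ p = \int[mu]_z (ComplexField.Normc.normc (f z) `^ p)%:E)%E.
Proof.
move=> p0; rewrite /CLnorm poweR_Lnorm//; apply: eq_integral => z _.
by rewrite abse_EFin poweR_EFin ger0_norm// (le_trans _ (normc_ge_abs (f z)).1).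
Qed.

Lemma Cmeasurable_normc (f : Z -> R[i]) : Cmeasurable f ->
  measurable_fun [set: mZ] (fun z => ComplexField.Normc.normc (f z)).
Proof.
move=> [mRe mIm].
have : measurable_fun [set: mZ] (fun z =>
    (complex.Re (f z) ^+ 2 + complex.Im (f z) ^+ 2) `^ (2^-1)).
  apply: (measurableT_comp (measurable_powR _)).
  by apply: measurable_funD; exact: measurable_funX.
congr measurable_fun; apply/funext => z.
by rewrite powR12_sqrt ?addr_ge0 ?sqr_ge0//; case: (f z).
Qed.

Let wk (w : measurableTypeR R * (mZ * mZ)) : R :=
  heat_theta w.1 * heat_kernel w.1 w.2.1 w.2.2.

Let mwk : measurable_fun setT wk.
Proof.
apply: measurable_funM; last exact: measurable_heat_kernel.
exact: (measurableT_comp measurable_heat_theta measurable_fst).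
Qed.

Let wk0 w : 0 <= wk w.
Proof. by rewrite mulr_ge0 ?heat_theta_ge0 ?heat_kernel_ge0. Qed.

Let majorant (g : Z -> R) (z : Z) : \bar R :=
  (\int[leb]_t \int[mu]_z' (wk (t, (z, z')) * `|g z'|)%:E)%E.

Let majorant_le (g : Z -> R) z : measurable_fun [set: mZ] g ->
  (`|\int[leb]_t (heat_theta t * \int[mu]_z' (heat_kernel t z z' * g z'))|%:E <=
   majorant g z)%E.
Proof.
move=> mg.
have mz : measurable_fun [set: measurableTypeR R * mZ]
    (fun w : measurableTypeR R * mZ => (w.1, (z, w.2)) : measurableTypeR R * (mZ * mZ)).
  by apply: measurable_fun_pair => //; exact: measurable_fun_pair.
have mk : measurable_fun [set: measurableTypeR R * mZ] (fun w => heat_kernel w.1 z w.2).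
  exact: (measurableT_comp measurable_heat_kernel mz).
have := @iterated_integral_le R _ _ (measurableTypeR R) mZ leb (@lebesgue_Z R d) heat_theta _ g measurable_heat_theta
  heat_theta_ge0 mk (fun w => heat_kernel_ge0 _ _ _) mg.
by rewrite /majorant /wk.
Qed.

Let measurable_majorant (g : Z -> R) : measurable_fun [set: mZ] g ->
  measurable_fun [set: mZ] (majorant g).
Proof. exact: (@measurable_schur R _ _ (measurableTypeR R) mZ leb (@lebesgue_Z R d) wk mwk). Qed.

(** The kernel is symmetric, so one mass bound serves both variables, and its time integral is a
    multiple of the Gamma integral at 1/2. *)
Let majorant_lty (g : Z -> R) (p : R) (B : set mZ) : (0 < d)%N -> 1 <= p ->
  measurable_fun [set: mZ] g -> (\int[mu]_z (`|g z| `^ p)%:E < +oo)%E ->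
  measurable B -> (mu B < +oo)%E -> (\int[mu]_(z in B) majorant g z < +oo)%E.
Proof.
move=> d0 p1 mg gp mB Bfin.
pose kap (t : R) : \bar R := (heat_cst%:E * (heat_theta t * expR (- t))%:E)%E.
have mte : measurable_fun [set: measurableTypeR R] (fun t => (heat_theta t * expR (- t))%:E).
  apply/measurable_EFinP; apply: measurable_funM; first exact: measurable_heat_theta.
  exact: measurableT_comp.
have te0 (t : R) : (0 <= (heat_theta t * expR (- t))%:E)%E.
  by rewrite lee_fin mulr_ge0 ?heat_theta_ge0 ?expR_ge0.
have k1 (t : R) (z : Z) : (\int[mu]_z' (wk (t, (z, z')))%:E <= kap t)%E.
  rewrite /kap /wk /=; have [t0|t0] := ltP 0 t; last first.
    rewrite heat_theta_neg//.
    by under eq_integral do rewrite mul0r; rewrite integral0 mul0r mule0.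
  have mz : measurable_fun [set: mZ] (fun z' : mZ => (t, (z, z')) : measurableTypeR R * (mZ * mZ)).
    by apply: measurable_fun_pair => //; exact: measurable_fun_pair.
  under eq_integral do rewrite EFinM.
  rewrite ge0_integralZl ?lee_fin ?heat_theta_ge0//; last 2 first.
  - by apply/measurable_EFinP; exact: (measurableT_comp measurable_heat_kernel mz).
  - by move=> z' _; rewrite lee_fin heat_kernel_ge0.
  rewrite [leRHS](_ : _ = (heat_theta t)%:E * (heat_cst * expR (- t))%:E)%E; last first.
    by rewrite -!EFinM; congr (_%:E); ring.
  by rewrite lee_wpmul2l ?lee_fin ?heat_theta_ge0//; exact: heat_kernel_mass.
apply: (@schur_locint R _ _ (measurableTypeR R) mZ leb (@lebesgue_Z R d) wk mwk wk0 kap g p B) => //.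
- exact: measurable_funeM.
- move=> t z'; apply: le_trans (k1 t z'); rewrite le_eqVlt; apply/orP; left; apply/eqP.
  by apply: eq_integral => z _; rewrite /wk /= heat_kernelC.
rewrite ge0_integralZl ?lee_fin ?heat_cst_ge0//.
rewrite lte_mul_pinfty ?lee_fin ?heat_cst_ge0//.
apply: le_lt_trans gamma_half_lty; rewrite le_eqVlt; apply/orP; left; apply/eqP.
by apply: eq_integral => t _; rewrite /heat_theta mulrA.
Qed.

(** Here the representation of f as a potential of some g in L^p enters: |f| is dominated almost
    everywhere by a multiple of the kernel integrals of |Re g| or |Im g|, to which the Schur test
    applies. *)
Lemma potential_space_locint (p : R) (f : Z -> R[i]) (B : set mZ) :
  (0 < d)%N -> 1 <= p -> potential_space p f -> measurable B -> (mu B < +oo)%E ->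
  (\int[mu]_(z in B) `|complex.Re (f z)|%:E < +oo)%E /\
  (\int[mu]_(z in B) `|complex.Im (f z)|%:E < +oo)%E.
Proof.
move=> d0 p1 [[mRe mIm] [g [[mgRe mgIm] gp] fg]] mB Bfin.
have p0 : 0 < p by exact: lt_le_trans p1.
have gfin (h : Z -> R) : measurable_fun [set: mZ] h ->
    (forall z, `|h z| <= ComplexField.Normc.normc (g z)) ->
    (\int[mu]_z (`|h z| `^ p)%:E < +oo)%E.
  move=> mh hg.
  apply: (@le_lt_trans _ _ (\int[mu]_z (ComplexField.Normc.normc (g z) `^ p)%:E)%E).
    apply: ge0_le_integral => //.
    - apply/measurable_EFinP; apply: (measurableT_comp (measurable_powR p)).
      exact: measurableT_comp.
    - apply/measurable_EFinP; apply: (measurableT_comp (measurable_powR p)).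
      exact: Cmeasurable_normc.
    - move=> z _; rewrite lee_fin ge0_ler_powR ?nnegrE ?(ltW p0)//.
      exact: le_trans (hg z).
  by rewrite -CLnorm_powR ?gt_eqF// poweR_lty.
have core (F h : Z -> R) : measurable_fun [set: mZ] F -> measurable_fun [set: mZ] h ->
    (\int[mu]_z (`|h z| `^ p)%:E < +oo)%E ->
    {ae mu, forall z, F z = (Gamma (1 / 2))^-1 *
      \int[leb]_t (heat_theta t * \int[mu]_z' (heat_kernel t z z' * h z'))} ->
    (\int[mu]_(z in B) `|F z|%:E < +oo)%E.
  move=> mF mh hfin Fh.
  have mm := measurable_majorant mh.
  have m0 z : (0 <= majorant h z)%E.
    by apply: integral_ge0 => t _; apply: integral_ge0 => z' _; rewrite lee_fin mulr_ge0.
  apply: (@le_lt_trans _ _ (\int[mu]_(z in B) (`|(Gamma (1 / 2))^-1|%:E * majorant h z))%E).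
    apply: ae_ge0_le_integral => //.
    - by apply: measurable_funTS; apply/measurable_EFinP; exact: measurableT_comp.
    - by move=> z _; rewrite mule_ge0.
    - by apply: measurable_funTS; exact: measurable_funeM.
    - apply: filterS (Fh); first exact: (ae_filter_ringOfSetsType mu).
      move=> z -> _; rewrite normrM EFinM lee_wpmul2l//.
      exact: majorant_le.
  rewrite ge0_integralZl//; last exact: measurable_funTS.
  by rewrite lte_mul_pinfty//; exact: (majorant_lty d0 p1 mh hfin mB Bfin).
split.
- apply: (core _ (fun z => complex.Re (g z)) mRe mgRe).
    by apply: gfin => // z; exact: (normc_ge_abs (g z)).1.
  apply: filterS (fg); first exact: (ae_filter_ringOfSetsType mu).
  by move=> z ->; exact: (Hpar_invsqrtE g z).1.
- apply: (core _ (fun z => complex.Im (g z)) mIm mgIm).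
    by apply: gfin => // z; exact: (normc_ge_abs (g z)).2.
  apply: filterS (fg); first exact: (ae_filter_ringOfSetsType mu).
  by move=> z ->; exact: (Hpar_invsqrtE g z).2.
Qed.

End heat_kernel.

(** * The Sobolev inequality *)

Section pairing.
Context {R : realType} (m : nat).
Local Notation lam := (@lebesgue_rV R).
Local Notation V := 'rV[R]_m.+1.

Lemma locint_lin (F G : V -> R) (a b : R) : locint F -> locint G ->
  locint (fun v => a * F v + b * G v).
Proof.
move=> [mF iF] [mG iG]; split.
  by apply: measurable_funD; exact: measurable_funM.
move=> k; have mC : measurable (@rV_cube R m.+1 k) by exact: measurable_rV_cube.
have := integrableD mC (integrableZl mC a (iF k)) (integrableZl mC b (iG k)).
exact: eq_integrable.
Qed.

Lemma locint_coord (j : 'I_m.+1) (F : V -> R) : locint F ->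
  locint (fun v => v ord0 j * F v).
Proof.
move=> [mF iF]; have mj := @measurable_rV_coord _ (measurableTypeR R) _ j.
split; first exact: measurable_funM.
move=> k; have mC : measurable (@rV_cube R m.+1 k) by exact: measurable_rV_cube.
apply: (le_integrable mC _ _ (integrableZl mC k%:R (iF k))).
  by apply/measurable_EFinP; apply: measurable_funTS; exact: measurable_funM.
move=> v /rV_cubeP vk /=; rewrite lee_fin !normrM ler_wpM2r//.
by rewrite (le_trans (ltW (vk j)))// ler_norm.
Qed.

Lemma locint_powR (F : V -> R) (p : R) : 1 <= p -> measurable_fun [set: V] F ->
  (\int[lam m.+1]_v (`|F v| `^ p)%:E < +oo)%E -> locint F.
Proof.
move=> p1 mF Fp; split => // k.
have mC : measurable (@rV_cube R m.+1 k) by exact: measurable_rV_cube.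
have mFp : measurable_fun [set: V] (fun v => `|F v| `^ p).
  by apply: (measurableT_comp (measurable_powR p)); exact: measurableT_comp.
have ip : (lam m.+1).-integrable setT (EFin \o (fun v => `|F v| `^ p)).
  apply/integrableP; split; first exact/measurable_EFinP.
  by under eq_integral do rewrite /= ger0_norm ?powR_ge0//.
have ip' : (lam m.+1).-integrable (rV_cube k) (EFin \o (fun v => `|F v| `^ p)).
  by apply: (integrableS _ _ _ ip).
have i1 : (lam m.+1).-integrable (rV_cube k) (EFin \o (cst (1 : R))).
  apply/integrableP; split; first exact/measurable_EFinP.
  under eq_integral do rewrite /= normr1.
  by rewrite integral_cst// mul1e lebesgue_rV_cube_lty.
apply: (le_integrable mC _ _ (integrableD mC i1 ip')).
  by apply/measurable_EFinP; exact: measurable_funTS.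
move=> v _ /=; rewrite lee_fin.
rewrite [leRHS]ger0_norm ?addr_ge0 ?powR_ge0//.
have [F1|/ltW F1] := leP `|F v| 1; first by rewrite (le_trans F1)// lerDl powR_ge0.
by rewrite (le_trans (le1r_powR F1 p1))// lerDr.
Qed.

Definition pairing (F : V -> R) (al : 'I_m.+1 -> R -> R) : R :=
  \int[lam m.+1]_v (F v * \prod_k al k (v ord0 k)).

Lemma pairingE F al : locint F -> (forall k, bumpfun (al k)) ->
  (\int[lam m.+1]_v (F v * \prod_k al k (v ord0 k))%:E = (pairing F al)%:E)%E.
Proof.
move=> lF bal; rewrite /pairing /Rintegral fineK//.
exact: (integrable_fin_num measurableT (locint_prod_bump lF bal)).
Qed.

Lemma pairing_lin F G (a b : R) al : locint F -> locint G ->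
  (forall k, bumpfun (al k)) ->
  pairing (fun v => a * F v + b * G v) al = a * pairing F al + b * pairing G al.
Proof.
move=> lF lG bal.
have iF := locint_prod_bump lF bal; have iG := locint_prod_bump lG bal.
have iaF : (lam m.+1).-integrable setT
    (EFin \o (fun v => a * (F v * \prod_k al k (v ord0 k)))).
  by have := integrableZl measurableT a iF; exact: eq_integrable.
have ibG : (lam m.+1).-integrable setT
    (EFin \o (fun v => b * (G v * \prod_k al k (v ord0 k)))).
  by have := integrableZl measurableT b iG; exact: eq_integrable.
rewrite /pairing -!RintegralZl// -RintegralD//.
by apply: eq_Rintegral => v _; ring.
Qed.

Lemma pairing_eq0_ae F : locint F ->
  (forall al, (forall k, bumpfun (al k)) -> pairing F al = 0) ->
  {ae lam m.+1, forall v, F v = 0}.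
Proof.
move=> lF F0; apply: du_bois_reymond => // al bal.
by rewrite pairingE// F0.
Qed.

End pairing.

(** * The estimate for real functions on row vectors *)

Section sobolev.
Context {R : realType} (d : nat).
Local Notation lam := (@lebesgue_rV R).
Local Notation V := 'rV[R]_d.+1.
Variables (u g0 : V -> R) (gp gm : 'I_d -> V -> R) (p q N : R).
Hypotheses (d0 : (0 < d)%N) (p1 : 1 < p) (pq : p < q)
  (pqd : p^-1 - d.+1%:R^-1 <= q^-1) (N0 : 0 < N) (lu : locint u).
Hypotheses (mg0 : measurable_fun [set: V] g0)
  (mgp : forall j, measurable_fun [set: V] (gp j))
  (mgm : forall j, measurable_fun [set: V] (gm j))
  (g0N : (\int[lam d.+1]_v (`|g0 v| `^ p)%:E <= (N `^ p)%:E)%E)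
  (gpN : forall j, (\int[lam d.+1]_v (`|gp j v| `^ p)%:E <= (N `^ p)%:E)%E)
  (gmN : forall j, (\int[lam d.+1]_v (`|gm j v| `^ p)%:E <= (N `^ p)%:E)%E).

Let upd i (al : 'I_d.+1 -> R -> R) g := fun k => if k == i then g else al k.

Hypotheses
  (W0 : forall al g, (forall k, bumpfun (al k)) -> bumpfun g ->
    (forall x : R, is_derive x (1 : R) (al ord0) (g x)) ->
    pairing u (upd ord0 al g) = pairing g0 al)
  (Wp : forall j al g, (forall k, bumpfun (al k)) -> bumpfun g ->
    (forall x : R, is_derive x (1 : R) (al (lift ord0 j)) (g x)) ->
    pairing u (upd (lift ord0 j) al g) +
    pairing (fun v => v ord0 (lift ord0 j) * u v) al = pairing (gp j) al)
  (Wm : forall j al g, (forall k, bumpfun (al k)) -> bumpfun g ->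
    (forall x : R, is_derive x (1 : R) (al (lift ord0 j)) (g x)) ->
    - pairing u (upd (lift ord0 j) al g) +
    pairing (fun v => v ord0 (lift ord0 j) * u v) al = pairing (gm j) al).

Let lp (F : V -> R) : measurable_fun [set: V] F ->
  (\int[lam d.+1]_v (`|F v| `^ p)%:E <= (N `^ p)%:E)%E -> locint F.
Proof.
move=> mF FN; apply: (locint_powR (ltW p1) mF).
by rewrite (le_lt_trans FN)// ltry.
Qed.

Let lg0 : locint g0 := lp mg0 g0N.
Let lgp j : locint (gp j) := lp (mgp j) (gpN j).
Let lgm j : locint (gm j) := lp (mgm j) (gmN j).

Let bump_upd i al g : (forall k, bumpfun (al k)) -> bumpfun g ->
  forall k, bumpfun (upd i al g k).
Proof. by move=> bal bg k; rewrite /upd; case: ifP. Qed.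

(** A_0 = -d/drho and (A_j - A_{-j})/2 = -d/dx_j: minus the weak derivatives, as [weak_deriv]
    expects. *)
Let h i : V -> R :=
  if unlift ord0 i is Some j then (fun v => 2^-1 * gp j v + - 2^-1 * gm j v) else g0.

Let lh i : locint (h i).
Proof. by rewrite /h; case: unlift => // j; exact: locint_lin. Qed.

Let Wh i : weak_deriv i u (h i).
Proof.
move=> al g bal bg dg.
rewrite (pairingE lu (bump_upd i bal bg)) (pairingE (lh i) bal); congr (_%:E).
rewrite /h; case: (unliftP ord0 i) dg => [j ->|->] dg; last exact: W0.
rewrite pairing_lin// -(Wp bal bg dg) -(Wm bal bg dg).
by field.
Qed.

(* The sum of the relations for [A_pos j] and [A_neg j]. *)
Let coord_ae j :
  {ae lam d.+1, forall v : V, v ord0 (lift ord0 j) * u v = (gp j v + gm j v) / 2}.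
Proof.
pose F v := 2^-1 * gp j v + 2^-1 * gm j v.
have lF : locint F by exact: locint_lin.
have lc := locint_coord (lift ord0 j) lu.
have := pairing_eq0_ae (locint_lin 1 (-1) lc lF).
move=> H; apply: filterS (H _) => [v|al bal]; first by rewrite /F; lra.
have [g bg dg] := bump_derive (bal (lift ord0 j)).
rewrite pairing_lin// /F pairing_lin// -(Wp bal bg dg) -(Wm bal bg dg).
by field.
Qed.

Let half_powR (a b : R) : `|(a + b) / 2| `^ p <= `|a| `^ p + `|b| `^ p.
Proof.
have p0 : 0 < p by rewrite (lt_trans ltr01).
wlog ab : a b / `|b| <= `|a|.
  move=> H; have [|/ltW] := leP `|b| `|a|; first exact: H.
  by move=> ?; rewrite [a + b]addrC [_ + _ `^ p]addrC; exact: H.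
rewrite (@le_trans _ _ (`|a| `^ p))// ?lerDl ?powR_ge0//.
rewrite ge0_ler_powR ?nnegrE ?(ltW p0)//.
rewrite normrM [`|2^-1|]ger0_norm// ler_pdivrMr//.
by rewrite (le_trans (ler_normD _ _))//; lra.
Qed.

Let half_int (F a b : V -> R) : measurable_fun [set: V] F ->
  measurable_fun [set: V] a -> measurable_fun [set: V] b ->
  {ae lam d.+1, forall v, F v = (a v + b v) / 2} ->
  (\int[lam d.+1]_v (`|a v| `^ p)%:E <= (N `^ p)%:E)%E ->
  (\int[lam d.+1]_v (`|b v| `^ p)%:E <= (N `^ p)%:E)%E ->
  (\int[lam d.+1]_v (`|F v| `^ p)%:E <= (2 * N `^ p)%:E)%E.
Proof.
move=> mF ma mb Fab aN bN.
have pw (G : V -> R) : measurable_fun [set: V] G ->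
    measurable_fun [set: V] (fun v => (`|G v| `^ p)%:E).
  move=> mG; apply/measurable_EFinP; apply: (measurableT_comp (measurable_powR p)).
  exact: measurableT_comp.
have pw0 (G : V -> R) v : (0 <= (`|G v| `^ p)%:E)%E by rewrite lee_fin powR_ge0.
apply: (@le_trans _ _ (\int[lam d.+1]_v ((`|a v| `^ p)%:E + (`|b v| `^ p)%:E))%E).
  apply: ae_ge0_le_integral => //; [exact: pw| | |].
  - by move=> v _; exact: adde_ge0.
  - by apply: emeasurable_funD; exact: pw.
  - apply: filterS Fab => v -> _; rewrite -EFinD lee_fin; exact: half_powR.
have := @ge0_integralD _ _ _ (lam d.+1) setT measurableT (fun v => (`|a v| `^ p)%:E)
  (fun v => (`|b v| `^ p)%:E) (fun v _ => pw0 a v) (pw _ ma) (fun v _ => pw0 b v) (pw _ mb).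
move=> ->; have -> : ((2 * N `^ p)%:E = (N `^ p)%:E + (N `^ p)%:E)%E.
  by rewrite -EFinD; congr (_%:E); ring.
exact: (leeD aN bN).
Qed.

(** The two coefficients of [rV_poincare], each times the 2 that bounds the p-th powers of half-sums
    and half-differences of components. *)
Definition sobolev_cst : R := 2 * (1 + 2 * 2 `^ p) + 2 * (2 * (2 `^ p * 3 `^ p)).

Lemma sobolev_rV :
  (\int[lam d.+1]_v (`|u v| `^ q)%:E <=
   (2 * (3 * Num.max (q * d%:R / d.+1%:R) p * (sobolev_cst `^ p^-1 * N)) `^ q)%:E)%E.
Proof.
have p0 : 0 < p by rewrite (lt_trans ltr01).
have [mu _] := lu.
have c2 : 0 <= 2 `^ p :> R := powR_ge0 _ _.
have c23 : 0 <= 2 `^ p * 3 `^ p :> R by rewrite mulr_ge0 ?powR_ge0.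
have K0 : 0 < sobolev_cst by rewrite /sobolev_cst; lra.
have K2 : 2 <= sobolev_cst by rewrite /sobolev_cst; lra.
(* A common bound for u and all [h i]: [sobolev_cst] is what the Poincare inequality yields for u,
   and being at least 2 it also covers the derivatives. *)
set N' := sobolev_cst `^ p^-1 * N.
have N'0 : 0 < N' by rewrite mulr_gt0// powR_gt0.
have N'p : N' `^ p = sobolev_cst * N `^ p.
  by rewrite powRM ?powR_ge0 ?(ltW N0)// -powRrM mulVf ?gt_eqF// powRr1// ltW.
have mh i : measurable_fun [set: V] (h i) by case: (lh i).
have hN2 i : (\int[lam d.+1]_v (`|h i v| `^ p)%:E <= (2 * N `^ p)%:E)%E.
  move: (mh i); rewrite /h; case: unlift => [j|] mhi; last first.
    by rewrite (le_trans g0N)// lee_fin ler_peMl ?powR_ge0//; lra.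
  have mb : measurable_fun [set: V] (fun v => - gm j v) by exact: measurableT_comp.
  have bN : (\int[lam d.+1]_v (`|- gm j v| `^ p)%:E <= (N `^ p)%:E)%E.
    by under eq_integral do rewrite normrN; exact: gmN.
  have ab : {ae lam d.+1, forall v : V,
      2^-1 * gp j v + - 2^-1 * gm j v = (gp j v + - gm j v) / 2}.
    by apply: nearW => v; field.
  exact: (half_int mhi (mgp j) mb ab (gpN j) bN).
have hN i : (\int[lam d.+1]_v (`|h i v| `^ p)%:E <= (N' `^ p)%:E)%E.
  by rewrite (le_trans (hN2 i))// N'p lee_fin ler_wpM2r ?powR_ge0.
(* Any x-axis will do for the Poincare inequality; index 0 of x is coordinate [lift ord0 j] of the
   row vector. *)
pose j := Ordinal d0.
have uN : (\int[lam d.+1]_v (`|u v| `^ p)%:E <= (N' `^ p)%:E)%E.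
  apply: (le_trans (rV_poincare lu (lh (lift ord0 j)) (@Wh _) p1)).
  have xu : (\int[lam d.+1]_v (`|v ord0 (lift ord0 j)| `^ p * `|u v| `^ p)%:E <=
      (2 * N `^ p)%:E)%E.
    under eq_integral do rewrite -powRM// -normrM.
    have [mc _] := locint_coord (lift ord0 j) lu.
    exact: (half_int mc (mgp j) (mgm j) (coord_ae j) (gpN j) (gmN j)).
  rewrite N'p /sobolev_cst.
  rewrite (_ : _ * N `^ p = (1 + 2 * 2 `^ p) * (2 * N `^ p) +
    2 * (2 `^ p * 3 `^ p) * (2 * N `^ p)); last by ring.
  rewrite [leRHS]EFinD; apply: leeD.
    by rewrite [leRHS]EFinM; apply: lee_wpmul2l => //; rewrite lee_fin; lra.
  rewrite [leRHS]EFinM; apply: lee_wpmul2l; last exact: hN2.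
  by rewrite lee_fin; lra.
exact: (gn_interp d0 lu lh (@Wh) p1 N'0 uN hN pq pqd).
Qed.

End sobolev.

(** * From row vectors to R x R^d and from components to pairings *)

Section transfer.
Context {R : realType} (d : nat).
Local Notation Z := (R * 'rV[R]_d)%type.
Local Notation mZ := (measurableTypeR R * 'rV[R]_d)%type.
Local Notation mu := (@lebesgue_measure R \x lebesgue_rV d)%E.
Local Notation lam := (@lebesgue_rV R).
Local Notation V := 'rV[R]_d.+1.
Local Notation del := (@rV_del R d ord0).

Lemma measurable_del (F : Z -> \bar R) : measurable_fun [set: mZ] F ->
  measurable_fun [set: V] (fun v => F (del v)).
Proof. by move=> mF; exact: (measurableT_comp mF (@measurable_rV_del R d ord0)). Qed.

Lemma measurable_delR (F : Z -> R) : measurable_fun [set: mZ] F ->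
  measurable_fun [set: V] (fun v => F (del v)).
Proof. by move=> mF; exact: (measurableT_comp mF (@measurable_rV_del R d ord0)). Qed.

Lemma integral_del (F : Z -> \bar R) : measurable_fun [set: mZ] F ->
  (\int[mu]_z F z = \int[lam d.+1]_v F (del v))%E.
Proof.
move=> mF; rewrite (integral_rV_ins ord0); last exact: measurable_del.
by apply: eq_integral => z _; rewrite rV_insK.
Qed.

Lemma prod_bump_del al (v : V) : prod_bump al (del v) = \prod_k al k (v ord0 k).
Proof. by apply: eq_bigr => k _; rewrite /coordZ rV_delK. Qed.

Lemma measurable_prod_bump al : (forall k, bumpfun (al k)) ->
  measurable_fun [set: mZ] (@prod_bump R d al).
Proof.
move=> bal.
have H : measurable_fun [set: V] (fun v => \prod_k al k (v ord0 k)).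
  by apply: measurable_prod_coord => k; have [] := bal k.
exact: (measurableT_comp H (@measurable_rV_ins R d ord0)).
Qed.

(** Real and imaginary parts are handled together: what matters is that c is additive, odd, bounded
    by the modulus, and commutes with pairing against real test functions. *)
Variable c : R[i] -> R.
Hypothesis cP : c = (@complex.Re R) \/ c = (@complex.Im R).

Let cD x y : c (x + y) = c x + c y.
Proof. by case: cP => ->; case: x; case: y. Qed.

Let cN x : c (- x) = - c x.
Proof. by case: cP => ->; case: x. Qed.

Let c_le x : `|c x| <= ComplexField.Normc.normc x.
Proof. by case: cP => ->; have [] := normc_ge_abs x. Qed.

Let c_dist (f : Z -> R[i]) (phi : Z -> R) :
  c (dist_of f phi) = \int[mu]_z (c (f z) * phi z).
Proof.
case: cP => ->; apply: eq_Rintegral => z _; case: (f z) => x y /=.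
  by rewrite mulr0 subr0.
by rewrite mulr0 add0r.
Qed.

Let cmeas (f : Z -> R[i]) : Cmeasurable f -> measurable_fun [set: mZ] (fun z => c (f z)).
Proof. by case: cP => -> []. Qed.

Let pull (f : Z -> R[i]) (v : V) : R := c (f (del v)).

Let dist_pairing f al : Cmeasurable f -> (forall k, bumpfun (al k)) ->
  c (dist_of f (prod_bump al)) = pairing (pull f) al.
Proof.
move=> mf bal; rewrite c_dist /pairing /Rintegral integral_del.
  by congr fine; apply: eq_integral => v _; rewrite prod_bump_del.
apply/measurable_EFinP; apply: measurable_funM; first exact: cmeas.
exact: measurable_prod_bump.
Qed.

Let dist_pairing_x f j al : Cmeasurable f -> (forall k, bumpfun (al k)) ->
  c (dist_of f (fun z => x_ j z * prod_bump al z)) =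
  pairing (fun v => v ord0 (lift ord0 j) * pull f v) al.
Proof.
move=> mf bal; rewrite c_dist /pairing /Rintegral integral_del.
  congr fine; apply: eq_integral => v _; rewrite prod_bump_del /x_ /rV_del/= mxE.
  by congr (_%:E); rewrite /pull; ring.
apply/measurable_EFinP; apply: measurable_funM; first exact: cmeas.
apply: measurable_funM; last exact: measurable_prod_bump.
exact: (measurableT_comp (measurable_rV_coord j) measurable_snd).
Qed.

Lemma dirZ0 : dirZ ord0 = e_rho d :> Z.
Proof. by rewrite /dirZ unlift_none. Qed.

Lemma dirZ_lift j : dirZ (lift ord0 j) = e_x j :> Z.
Proof. by rewrite /dirZ liftK. Qed.

Lemma sobolev_part (p q N : R) (f G0 : Z -> R[i]) (Gp Gm : 'I_d -> Z -> R[i]) :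
  (0 < d)%N -> 1 < p -> p < q -> p^-1 - d.+1%:R^-1 <= q^-1 -> 0 < N ->
  potential_space p f ->
  Lp p G0 -> (forall j, Lp p (Gp j)) -> (forall j, Lp p (Gm j)) ->
  (CLnorm p G0 <= N%:E)%E -> (forall j, CLnorm p (Gp j) <= N%:E)%E ->
  (forall j, CLnorm p (Gm j) <= N%:E)%E ->
  (forall phi, test_function phi -> A_0 (dist_of f) phi = dist_of G0 phi) ->
  (forall j phi, test_function phi -> A_pos j (dist_of f) phi = dist_of (Gp j) phi) ->
  (forall j phi, test_function phi -> A_neg j (dist_of f) phi = dist_of (Gm j) phi) ->
  (\int[mu]_z (`|c (f z)| `^ q)%:E <=
   (2 * (3 * Num.max (q * d%:R / d.+1%:R) p * (sobolev_cst p `^ p^-1 * N)) `^ q)%:E)%E.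
Proof.
move=> d0 p1 pq pqd N0 pf [mG0 _] lGp lGm nG0 nGp nGm A0 Ap Am.
have p0 : 0 < p by rewrite (lt_trans ltr01).
have mf : Cmeasurable f by case: pf.
have mpow (h : Z -> R) r : measurable_fun [set: mZ] h ->
    measurable_fun [set: mZ] (fun z => (`|h z| `^ r)%:E).
  move=> mh; apply/measurable_EFinP; apply: (measurableT_comp (measurable_powR r)).
  exact: measurableT_comp.
rewrite integral_del; last exact: (mpow _ q (cmeas mf)).
have mpull g : Cmeasurable g -> measurable_fun [set: V] (pull g).
  by move=> mg; exact: (measurable_delR (cmeas mg)).
have pullN g : Cmeasurable g -> (CLnorm p g <= N%:E)%E ->
    (\int[lam d.+1]_v (`|pull g v| `^ p)%:E <= (N `^ p)%:E)%E.
  move=> mg gN.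
  rewrite -(integral_del (F := fun z => (`|c (g z)| `^ p)%:E)); last exact: (mpow _ p (cmeas mg)).
  apply: (@le_trans _ _ (\int[mu]_z (ComplexField.Normc.normc (g z) `^ p)%:E)%E).
    apply: ge0_le_integral => //; first exact: (mpow _ p (cmeas mg)).
      apply/measurable_EFinP; apply: (measurableT_comp (measurable_powR p)).
      exact: Cmeasurable_normc.
    move=> z _; rewrite lee_fin ge0_ler_powR ?nnegrE ?(ltW p0)//.
    exact: le_trans (c_le (g z)).
  rewrite -CLnorm_powR ?gt_eqF// -poweR_EFin gt0_ler_poweR ?(ltW p0)//.
    by rewrite in_itv/= leey Lnorm_ge0.
  by rewrite in_itv/= leey lee_fin ltW.
have lu : locint (pull f).
  split; first exact: mpull.
  move=> k; apply/integrableP; split.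
    by apply/measurable_EFinP; apply: measurable_funTS; exact: mpull.
  have mB := @measurable_preimage_cube R d k.
  have [fRe fIm] := potential_space_locint d0 (ltW p1) pf mB (@preimage_cube_lty R d k).
  have : (\int[mu]_(z in @rV_cons R d @^-1` rV_cube k) `|c (f z)|%:E < +oo)%E.
    by case: cP => ->.
  rewrite integral_mkcond integral_del; last first.
    apply/(measurable_restrictT _ _).1 => //; apply: measurable_funTS.
    by apply/measurable_EFinP; apply: measurableT_comp => //; exact: cmeas.
  rewrite [in X in _ -> X]integral_mkcond; congr (_ < _)%E.
  apply: eq_integral => v _; rewrite !patchE.
  have -> : (del v \in @rV_cons R d @^-1` rV_cube k) = (v \in rV_cube k).
    rewrite -[v in RHS](rV_delK ord0).
    by apply/idP/idP => /set_mem ?; apply/mem_set.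
  by [].
have bupd (i : 'I_d.+1) (al : 'I_d.+1 -> R -> R) (g : R -> R) :
    (forall k, bumpfun (al k)) -> bumpfun g ->
    forall k, bumpfun (if k == i then g else al k).
  by move=> bal bg k; case: ifP.
apply: (@sobolev_rV R d (pull f) (pull G0) (fun j => pull (Gp j)) (fun j => pull (Gm j))
  p q N) => //.
- exact: mpull.
- by move=> j; apply: mpull; case: (lGp j).
- by move=> j; apply: mpull; case: (lGm j).
- exact: pullN.
- by move=> j; apply: pullN => //; case: (lGp j).
- by move=> j; apply: pullN => //; case: (lGm j).
- move=> al g bal bg dg.
  have := A0 _ (test_prod_bump bal); rewrite /A_0 /dist_partial opprK => H.
  rewrite -(dist_pairing mG0 bal) -H -dirZ0 (derive_prod_bump dg).
  by rewrite dist_pairing//; exact: bupd.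
- move=> j al g bal bg dg; have [mG _] := lGp j.
  have := Ap j _ (test_prod_bump bal); rewrite /A_pos /dist_partial /dist_mul opprK => H.
  rewrite -(dist_pairing mG bal) -H cD -dirZ_lift (derive_prod_bump dg) dist_pairing_x//.
  by rewrite dist_pairing//; exact: bupd.
- move=> j al g bal bg dg; have [mG _] := lGm j.
  have := Am j _ (test_prod_bump bal); rewrite /A_neg /dist_partial /dist_mul => H.
  rewrite -(dist_pairing mG bal) -H cD cN -dirZ_lift (derive_prod_bump dg) dist_pairing_x//.
  by rewrite dist_pairing//; exact: bupd.
Qed.

End transfer.

(** * Complex-valued functions and the gradient norm *)

Section complex_estimate.
Context {R : realType} (d : nat).
Local Notation Z := (R * 'rV[R]_d)%type.
Local Notation mZ := (measurableTypeR R * 'rV[R]_d)%type.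
Local Notation mu := (@lebesgue_measure R \x lebesgue_rV d)%E.

Lemma normc_le_ReIm (x : R[i]) :
  ComplexField.Normc.normc x <= `|complex.Re x| + `|complex.Im x|.
Proof.
case: x => a b /=; rewrite -[leRHS]ger0_norm ?addr_ge0// -sqrtr_sqr ler_wsqrtr//.
rewrite sqrrD !real_normK ?num_real// addrAC lerDl.
by rewrite mulrn_wge0// mulr_ge0.
Qed.

(** 2^q comes from the power of |Re f| + |Im f|; the 4 counts the two parts, each carrying the 2 of
    the interpolation. The rest is the constant of the real estimate, free of the bound N. *)
Definition potential_cst (p q : R) : R :=
  (4 * 2 `^ q) `^ q^-1 *
  (3 * Num.max (q * d%:R / d.+1%:R) p * sobolev_cst p `^ p^-1).

Lemma sobolev_complex (p q N : R) (f G0 : Z -> R[i]) (Gp Gm : 'I_d -> Z -> R[i]) :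
  (0 < d)%N -> 1 < p -> p < q -> p^-1 - d.+1%:R^-1 <= q^-1 -> 0 < N ->
  potential_space p f ->
  Lp p G0 -> (forall j, Lp p (Gp j)) -> (forall j, Lp p (Gm j)) ->
  (CLnorm p G0 <= N%:E)%E -> (forall j, CLnorm p (Gp j) <= N%:E)%E ->
  (forall j, CLnorm p (Gm j) <= N%:E)%E ->
  (forall phi, test_function phi -> A_0 (dist_of f) phi = dist_of G0 phi) ->
  (forall j phi, test_function phi -> A_pos j (dist_of f) phi = dist_of (Gp j) phi) ->
  (forall j phi, test_function phi -> A_neg j (dist_of f) phi = dist_of (Gm j) phi) ->
  (CLnorm q f <= (potential_cst p q * N)%:E)%E.
Proof.
move=> d0 p1 pq pqd N0 pf lG0 lGp lGm nG0 nGp nGm A0 Ap Am.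
have p0 : 0 < p by rewrite (lt_trans ltr01).
have q1 : 1 < q by exact: lt_trans pq.
have q0 : 0 < q by rewrite (lt_trans ltr01).
have mf : Cmeasurable f by case: pf.
have [mRe mIm] := mf.
set A := 3 * Num.max (q * d%:R / d.+1%:R) p * (sobolev_cst p `^ p^-1 * N).
have A0' : 0 <= A.
  apply: mulr_ge0; last by rewrite mulr_ge0 ?powR_ge0// ltW.
  by rewrite mulr_ge0// le_max (ltW p0) orbT.
have sRe := sobolev_part (or_introl erefl) d0 p1 pq pqd N0 pf lG0 lGp lGm nG0 nGp nGm A0 Ap Am.
have sIm := sobolev_part (or_intror erefl) d0 p1 pq pqd N0 pf lG0 lGp lGm nG0 nGp nGm A0 Ap Am.
have mpow (h : Z -> R) : measurable_fun [set: mZ] h ->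
    measurable_fun [set: mZ] (fun z => `|h z| `^ q).
  move=> mh; apply: (measurableT_comp (measurable_powR q)).
  exact: measurableT_comp.
have mn : measurable_fun [set: mZ] (fun z => ComplexField.Normc.normc (f z) `^ q).
  apply: (measurableT_comp (measurable_powR q)); exact: Cmeasurable_normc.
have n0 z : 0 <= ComplexField.Normc.normc (f z).
  by apply: le_trans (normc_ge_abs (f z)).1.
have key : (\int[mu]_z (ComplexField.Normc.normc (f z) `^ q)%:E <=
    ((4 * 2 `^ q) * A `^ q)%:E)%E.
  have := @le_integral_lin3 R _ _ mu (fun z => ComplexField.Normc.normc (f z) `^ q)
    (fun z => `|complex.Re (f z)| `^ q) (fun z => `|complex.Im (f z)| `^ q)
    (fun z => `|complex.Im (f z)| `^ q) (2 `^ q) (2 `^ q) 0 _ _ _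
    mn (mpow _ mRe) (mpow _ mIm) (mpow _ mIm) (fun z => powR_ge0 _ _)
    (fun z => powR_ge0 _ _) (fun z => powR_ge0 _ _) (fun z => powR_ge0 _ _)
    (powR_ge0 _ _) (powR_ge0 _ _) (lexx 0) _ sRe sIm sIm.
  have -> : 4 * 2 `^ q * A `^ q = 2 `^ q * (2 * A `^ q) + 2 `^ q * (2 * A `^ q) +
    0 * (2 * A `^ q) by ring.
  apply=> z; rewrite mul0r addr0 -mulrDr.
  by apply: powR_le_sum => //; exact: normc_le_ReIm.
have c0 : 0 <= 4 * 2 `^ q :> R by rewrite mulr_ge0 ?powR_ge0.
have -> : (potential_cst p q * N)%:E = (((4 * 2 `^ q) * A `^ q)%:E `^ q^-1)%E.
  rewrite poweR_EFin powRM ?powR_ge0// -powRrM mulfV ?gt_eqF// powRr1//.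
  by congr (_%:E); rewrite /potential_cst /A; ring.
have -> : CLnorm q f = ((CLnorm q f `^ q) `^ q^-1)%E.
  by rewrite -poweRrM mulfV ?gt_eqF// poweRe1// Lnorm_ge0.
rewrite CLnorm_powR ?gt_eqF// gt0_ler_poweR ?invr_ge0 ?(ltW q0)//.
- rewrite in_itv/= leey andbT; apply: integral_ge0 => z _.
  by rewrite lee_fin powR_ge0.
- by rewrite in_itv/= leey andbT lee_fin mulr_ge0 ?powR_ge0.
Qed.

Lemma dist_Lnorm_ge0 (p : R) (u : (Z -> R) -> R[i]) : (0 <= dist_Lnorm p u)%E.
Proof. by apply: le_ereal_inf_tmp => _ [g _ <-]; exact: Lnorm_ge0. Qed.

Lemma dist_Lnorm_adherent (p e : R) (u : (Z -> R) -> R[i]) : 0 < e ->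
  (dist_Lnorm p u < +oo)%E ->
  exists2 g, Lp p g /\ (CLnorm p g <= dist_Lnorm p u + e%:E)%E &
    forall phi, test_function phi -> u phi = dist_of g phi.
Proof.
move=> e0 ufin.
have fu : dist_Lnorm p u \is a fin_num by rewrite ge0_fin_numE// dist_Lnorm_ge0.
have [_ [g [lg gu] <-] /ltW gle] := lb_ereal_inf_adherent e0 fu.
by exists g.
Qed.

End complex_estimate.

(** The gradient norm is a sum of infima, each at most the whole sum G when G is finite; so every
    component has a representative of norm at most G + e', and the homogeneous estimate is applied
    with this common bound before e tends to 0. *)
Theorem theorem5p4 (R : realType) (d : nat) (p q : R)
  (hd : (3 <= d)%N) (hp : 1 < p) (hq : 1 < q)
  (hpq1 : p^-1 - (d.+1%:R)^-1 <= q^-1) (hpq2 : q^-1 < p^-1) :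
  exists2 C : R, 0 < C &
    forall f : R * 'rV[R]_d -> R[i], potential_space p f ->
      (CLnorm q f <= C%:E * gradient_Lnorm p f)%E.
Proof.
have d0 : (0 < d)%N by exact: leq_trans hd.
have p0 : 0 < p by rewrite (lt_trans ltr01).
have q0 : 0 < q by rewrite (lt_trans ltr01).
have pq : p < q by rewrite -ltf_pV2.
have C0 : 0 < potential_cst d p q.
  have K0 : 0 < sobolev_cst p.
    have c2 : 0 <= 2 `^ p :> R := powR_ge0 _ _.
    have c23 : 0 <= 2 `^ p * 3 `^ p :> R by rewrite mulr_ge0 ?powR_ge0.
    by rewrite /sobolev_cst; lra.
  apply: mulr_gt0; first by rewrite powR_gt0// mulr_gt0// powR_gt0.
  apply: mulr_gt0; last exact: powR_gt0.
  by rewrite mulr_gt0// lt_max p0 orbT.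
exists (potential_cst d p q) => // f pf.
set T0 := dist_Lnorm p (A_0 (dist_of f)).
set Tp := fun j => dist_Lnorm p (A_pos j (dist_of f)).
set Tm := fun j => dist_Lnorm p (A_neg j (dist_of f)).
have T00 : (0 <= T0)%E by exact: dist_Lnorm_ge0.
have Tp0 j : (0 <= Tp j)%E by exact: dist_Lnorm_ge0.
have Tm0 j : (0 <= Tm j)%E by exact: dist_Lnorm_ge0.
have GE : gradient_Lnorm p f = (T0 + \sum_(j < d) Tp j + \sum_(j < d) Tm j)%E by [].
have sp0 : (0 <= \sum_(j < d) Tp j)%E by exact: sume_ge0.
have sm0 : (0 <= \sum_(j < d) Tm j)%E by exact: sume_ge0.
have le0 : (T0 <= gradient_Lnorm p f)%E.
  by rewrite GE -addeA leeDl// adde_ge0.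
have lep j : (Tp j <= gradient_Lnorm p f)%E.
  apply: (@le_trans _ _ (\sum_(j < d) Tp j)%E).
    by rewrite (bigD1 j)//= leeDl// sume_ge0.
  by rewrite GE [(T0 + _)%E]addeC -addeA leeDl// adde_ge0.
have lem j : (Tm j <= gradient_Lnorm p f)%E.
  apply: (@le_trans _ _ (\sum_(j < d) Tm j)%E).
    by rewrite (bigD1 j)//= leeDl// sume_ge0.
  by rewrite GE leeDr// adde_ge0.
(* An infinite gradient norm occurs when some component has no representative in L^p; as the
   constant is positive, the inequality is then trivial. *)
have [Goo|Gfin] := eqVneq (gradient_Lnorm p f) +oo%E.
  by rewrite Goo gt0_muley ?leey// lte_fin.
have {}Gfin : gradient_Lnorm p f \is a fin_num.
  by rewrite ge0_fin_numE ?ltey// (le_trans T00).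
set G := fine (gradient_Lnorm p f).
have GG : gradient_Lnorm p f = G%:E by rewrite fineK.
have G0 : 0 <= G by rewrite -lee_fin -GG (le_trans T00).
rewrite GG; apply/lee_addgt0Pr => e e0.
(* Scaled so that the constant times e' is e. It also keeps the common bound G + e' positive when G
   = 0. *)
pose e' := e / potential_cst d p q.
have e'0 : 0 < e' by rewrite divr_gt0.
have adh (u : (R * 'rV[R]_d -> R) -> R[i]) : (dist_Lnorm p u <= G%:E)%E ->
    exists g, [/\ Lp p g, (CLnorm p g <= (G + e')%:E)%E &
      forall phi, test_function phi -> u phi = dist_of g phi].
  move=> uG; have [|g [lg gle] gu] := dist_Lnorm_adherent e'0 (u := u) (p := p).
    by rewrite (le_lt_trans uG)// ltry.
  by exists g; split => //; rewrite (le_trans gle)// EFinD leeD2r.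
have [|g0 [lg0 ng0 ag0]] := adh (A_0 (dist_of f)).
  by rewrite -GG; exact: le0.
have /choice[gp hgp] : forall j, exists g, [/\ Lp p g, (CLnorm p g <= (G + e')%:E)%E &
    forall phi, test_function phi -> A_pos j (dist_of f) phi = dist_of g phi].
  by move=> j; apply: adh; rewrite -GG; exact: lep.
have /choice[gm hgm] : forall j, exists g, [/\ Lp p g, (CLnorm p g <= (G + e')%:E)%E &
    forall phi, test_function phi -> A_neg j (dist_of f) phi = dist_of g phi].
  by move=> j; apply: adh; rewrite -GG; exact: lem.
have N0 : 0 < G + e' by rewrite ltr_wpDl.
have lgp j : Lp p (gp j) by have [] := hgp j.
have lgm j : Lp p (gm j) by have [] := hgm j.
have ngp j : (CLnorm p (gp j) <= (G + e')%:E)%E by have [] := hgp j.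
have ngm j : (CLnorm p (gm j) <= (G + e')%:E)%E by have [] := hgm j.
have agp j phi : test_function phi -> A_pos j (dist_of f) phi = dist_of (gp j) phi.
  by have [_ _] := hgp j; exact.
have agm j phi : test_function phi -> A_neg j (dist_of f) phi = dist_of (gm j) phi.
  by have [_ _] := hgm j; exact.
apply: (le_trans (sobolev_complex d0 hp pq hpq1 N0 pf lg0 lgp lgm ng0 ngp ngm ag0 agp agm)).
rewrite mulrDr /e' mulrCA mulfV ?gt_eqF// mulr1.
by rewrite -EFinM EFinD.
Qed.
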